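(* Let $\alpha\in(0,1)$. There exists a constant $C>0$, depending only on $\alpha$, such that the following holds. For positive integers $n,m$ with $m=\alpha n$, let $$H_{n,m}(z)=\sum_{j=0}^{n}A_j z^j+\sum_{j=0}^{m}B_j\overline{z}^{\,j},\qquad z\in\mathbb{C},$$ where $A_0,\dots,A_n,B_0,\dots,B_m$ are independent and identically distributed standard complex Gaussian random variables, and let $N_{H_{n,m}}(\mathbb{C})$ be the number of zeros of $H_{n,m}$ in $\mathbb{C}$. Then, as $n\to\infty$ through positive integers for which $m=\alpha n$ is an integer, $$\mathbb{E}\big[N_{H_{n,m}}(\mathbb{C})\big]\sim C\,n,$$ that is, for every sequence of pairs of positive integers $(n_k,m_k)$ with $m_k=\alpha n_k$ and $n_k\to\infty$ one has $\mathbb{E}[N_{H_{n_k,m_k}}(\mathbb{C})]/n_k\to C$.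
   Context: A random harmonic polynomial is $H_{n,m}(z)=p_n(z)+\overline{q_m(z)}$ with $p_n,q_m$ random analytic polynomials of degrees $n\ge m$. In the Kac model considered here, all coefficients are i.i.d. standard complex Gaussians $N_{\mathbb{C}}(0,1)$: a random variable $A\sim N_{\mathbb{C}}(0,1)$ is a centered complex Gaussian with $\mathbb{E}[A]=\mathbb{E}[A^2]=0$ and $\mathbb{E}[|A|^2]=1$ (i.e. real and imaginary parts are independent real Gaussians with mean $0$ and variance $1/2$). Since the coefficients of $q_m$ are circularly symmetric, $\overline{q_m(z)}$ may be written as $\sum_{j=0}^m B_j\overline{z}^{\,j}$ with $B_j$ i.i.d. $N_{\mathbb{C}}(0,1)$, independent of the $A_j$. For $T\subseteq\mathbb{C}$, $N_H(T)$ denotes the number of points $z\in T$ with $H(z)=0$. *)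

(* Defs.v *)
From HB Require Import structures.
From mathcomp Require Import all_boot all_order all_algebra.
From mathcomp Require Import all_classical all_reals all_analysis.
From mathcomp Require Import complex.

Set Implicit Arguments.
Unset Strict Implicit.
Unset Printing Implicit Defensive.

Import Order.TTheory GRing.Theory Num.Theory.
Import numFieldNormedType.Exports.

Local Open Scope classical_set_scope.
Local Open Scope ring_scope.
Local Open Scope complex_scope.

(* The Borel structure of R[i] is that of R * R, through this bijection. *)
Definition cpair (R : realType) (z : R[i]) : R * R :=
  (complex.Re z, complex.Im z).

Definition mutually_independent (R : realType) (d d' : measure_display)
    (T : measurableType d) (U : measurableType d') (P : probability T R)
    (I : finType) (X : I -> T -> U) : Prop :=
  forall (J : {set I}) (B : I -> set U),
    (forall i, measurable (B i)) ->
    P (\bigcap_(i in [set` J]) (X i @^-1` B i)) =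
    (\prod_(i in J) P (X i @^-1` B i))%E.

(* The second parameter of [normal_prob] is the standard deviation, so the
   real and imaginary parts have variance 1/2. *)
Definition std_complex_gaussian (R : realType) (d : measure_display)
    (T : measurableType d) (P : probability T R) (Z : T -> R[i]) : Prop :=
  let X := fun w => complex.Re (Z w) in
  let Y := fun w => complex.Im (Z w) in
  [/\ measurable_fun setT X /\ measurable_fun setT Y,
      forall B : set R, measurable B ->
        P (X @^-1` B) = normal_prob 0 (Num.sqrt 2^-1) B,
      forall B : set R, measurable B ->
        P (Y @^-1` B) = normal_prob 0 (Num.sqrt 2^-1) B &
      forall B B' : set R, measurable B -> measurable B' ->
        P (X @^-1` B `&` Y @^-1` B') =
        (P (X @^-1` B) * P (Y @^-1` B'))%E].

Definition kac_coefficients (R : realType) (d : measure_display)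
    (T : measurableType d) (P : probability T R) (n m : nat)
    (A : 'I_n.+1 -> T -> R[i]) (B : 'I_m.+1 -> T -> R[i]) : Prop :=
  let Z := fun i : 'I_n.+1 + 'I_m.+1 =>
    match i with inl j => A j | inr j => B j end in
  (forall i, std_complex_gaussian P (Z i)) /\
  mutually_independent P (fun i w => cpair (Z i w)).

Definition harmonic_poly (R : realType) (n m : nat)
    (a : 'I_n.+1 -> R[i]) (b : 'I_m.+1 -> R[i]) (z : R[i]) : R[i] :=
  \sum_(j < n.+1) a j * z ^+ j + \sum_(j < m.+1) b j * z^* ^+ j.

(* Number of zeros in S, +oo when there are infinitely many. *)
Definition num_zeros (R : realType) (H : R[i] -> R[i]) (S : set R[i]) :
    \bar R :=
  counting [set z | S z /\ H z = 0].

Definition expected_zeros (R : realType) (d : measure_display)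
    (T : measurableType d) (P : probability T R) (n m : nat)
    (A : 'I_n.+1 -> T -> R[i]) (B : 'I_m.+1 -> T -> R[i]) : \bar R :=
  (\int[P]_w num_zeros (harmonic_poly (A ^~ w) (B ^~ w)) setT)%E.

(* Main.v *)
Require Import Defs.
From HB Require Import structures.
From mathcomp Require Import all_boot all_order all_algebra.
From mathcomp Require Import finmap.
From mathcomp Require Import all_classical all_reals all_analysis.
From mathcomp Require Import measurable_realfun.
From mathcomp Require Import complex.
From mathcomp Require Import zify.
From mathcomp Require Import ring lra.

Set Implicit Arguments.
Unset Strict Implicit.
Unset Printing Implicit Defensive.

Import Order.TTheory GRing.Theory Num.Theory.
Import numFieldNormedType.Exports.

Local Open Scope classical_set_scope.
Local Open Scope ring_scope.
Local Open Scope complex_scope.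

(* Given all coefficients but [A 0], the zeros of [H] are the points at which the
   harmonic polynomial [G = A 0 - H] takes the value [A 0].  The area formula for [G]
   therefore gives the Kac-Rice formula: the density of zeros at [z] is
   [E (| |dG/dz|^2 - |dG/dzbar|^2 | * rho (G z))], where [rho] is the density of [A 0].
   An orthogonal change of the Gaussian coefficients puts [G z] on a single coordinate;
   the factor [rho] only rescales that coordinate.  The density is then
   [Phi s11 s12 s22 / (pi * K)], where [K = Var (H z)], the [s_ij] are the conditional
   covariances of the two derivatives given [H z = 0], and everything is a rational
   function of power sums in [t = |z|^2].

   With [t = 1 + x / n], the power sums have explicit limits for [x <> 0].  The
   rescaled density is at most [M / (1 + x^2)]: for [t <= 1] by the closed forms of
   the power sums; for [t >= 1] because [s11] is bounded by the variance of
   [z dH/dz - n H] and the sums up to [m] are smaller than those up to [n] by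
   a factor [t ^ (n - m)].  Dominated convergence gives the limit, which is
   positive because [s11 > s22] in the limit for [x > 0]. *)

(** The area formula is an identity in [[0, +oo]] valid through critical points and infinite fibres,
    so degenerate or accumulating zeros are covered by the same statement, and nonnegativity lets
    Tonelli exchange all integrals. It is proved by counting: the number of occupied dyadic squares
    increases to the number of preimages, and the image of a small square has area close to the
    Jacobian times that of the square, with an error that stays uniform where the Jacobian vanishes.
    Singling out [A 0] works because the constant term shifts [H] without touching its derivatives.
    [Phi] is handled only through homogeneity, continuity, an upper bound linear in the variances
    and the lower bound [(s11 - s22) * G2]; the constant therefore comes out as an integral over the
    rescaled line and not in closed form. The assumption [alpha < 1] acts twice: it makes
    [t ^ (n - m)] grow, which gives the decay for [t > 1], and it makes the gap [s11 - s22] strictly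
    positive in the limit. *)

Section image_measure.
Context d d' (T1 : measurableType d) (T2 : measurableType d') (R : realType).

Definition image_measure (m : {measure set T1 -> \bar R}) (f : T1 -> T2)
    (mf : measurable_fun setT f) : {measure set T2 -> \bar R} :=
  measure_function_pushforward__canonical__measure_function_Measure m mf.

Lemma image_measureE m f mf A : @image_measure m f mf A = m (f @^-1` A).
Proof. by []. Qed.

Lemma ge0_integral_image (m : {measure set T1 -> \bar R}) (f : T1 -> T2)
    (mf : measurable_fun setT f) (g : T2 -> \bar R) :
  measurable_fun setT g -> (forall y, 0 <= g y)%E ->
  (\int[image_measure m mf]_y g y = \int[m]_x g (f x))%E.
Proof. by move=> mg g0; rewrite (ge0_integral_pushforward mf). Qed.

End image_measure.

(** * Lebesgue measure on the line and in the plane under affine maps *)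

Section shear.
Context d1 d2 (T1 : measurableType d1) (T2 : measurableType d2) (R : realType).
Variables (m1 : {sigma_finite_measure set T1 -> \bar R})
          (m2 : {sigma_finite_measure set T2 -> \bar R}).
Local Open Scope ereal_scope.

(** Tonelli with the second variable outermost: on each slice only a substitution in the first
    variable remains. *)
Lemma ge0_integral_shear (h : T1 * T2 -> T1) (k : \bar R) :
  measurable_fun setT h -> 0 <= k ->
  (forall (y : T2) (f : T1 -> \bar R), measurable_fun setT f -> (forall x, 0 <= f x) ->
     \int[m1]_x f (h (x, y)) = k * \int[m1]_x f x) ->
  forall F : T1 * T2 -> \bar R, measurable_fun setT F -> (forall x, 0 <= F x) ->
  \int[m1 \x m2]_p F (h p, p.2) = k * \int[m1 \x m2]_p F p.
Proof.
move=> mh k0 H F mF F0.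
have mF' : measurable_fun setT (fun p => F (h p, p.2)).
  by apply: measurableT_comp => //; exact: measurable_fun_pair.
rewrite fubini_tonelli2// fubini_tonelli2// -ge0_integralZl//=.
- apply: eq_integral => y _; rewrite /fubini_G/=.
  rewrite (H y (fun x => F (x, y)))//.
  exact: measurableT_comp.
- exact: measurable_fun_fubini_tonelli_G.
- by move=> y _; apply: integral_ge0.
Qed.

Lemma ge0_integral_swap (F : T1 * T2 -> \bar R) :
  measurable_fun setT F -> (forall x, 0 <= F x) ->
  \int[m2 \x m1]_p F (p.2, p.1) = \int[m1 \x m2]_p F p.
Proof.
move=> mF F0.
have mF' : measurable_fun setT (fun p : T2 * T1 => F (p.2, p.1)).
  by apply: measurableT_comp => //; exact: measurable_fun_pair.
by rewrite fubini_tonelli1// fubini_tonelli2.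
Qed.

End shear.

Section lebesgue_affine.
Variable R : realType.
Local Notation leb := (@lebesgue_measure R).

(** The image of Lebesgue measure under the affine map, multiplied by [|a|], gives every half-open
    interval its length, hence is Lebesgue measure by uniqueness. *)
Lemma lebesgue_affine (a b : R) (f : R -> \bar R) : a != 0 ->
  measurable_fun setT f -> (forall x, 0 <= f x)%E ->
  (\int[leb]_x f (a * x + b)%R = `|a|^-1%:E * \int[leb]_x f x)%E.
Proof.
move=> a0 mf f0.
have na0 : 0 < `|a| by rewrite normr_gt0.
pose phi (x : measurableTypeR R) : measurableTypeR R := a * x + b.
have mphi : measurable_fun setT phi.
  by apply: measurable_funD => //; exact: measurable_funM.
rewrite -(ge0_integral_image leb mphi); [|exact: mf|by []].
pose nu : {measure set (measurableTypeR R) -> \bar R} :=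
  mscale (NngNum (ltW na0)) (image_measure leb mphi).
have E A : measurable A -> leb A = nu A.
  apply: lebesgue_measure_unique => _ [[u v] _ <-].
  rewrite /nu/= /mscale/= (image_measureE leb mphi).
  (* For [a < 0] the preimage of []u, v]] is reversed, closed on the left and open on the right. *)
  rewrite [X in (_ * leb X)%E](_ : _ =
    if 0 < a then `](u - b)/a, (v - b)/a]%classic
    else `[(v - b)/a, (u - b)/a[%classic); last first.
    apply/seteqP; rewrite /phi/=; case: ltgtP a0 => // [ap|an] _; split => x /=;
    rewrite !in_itv/=.
    - by rewrite ltr_pdivrMr// ler_pdivlMr// mulrC ltrBlDr lerBrDr.
    - by rewrite ltr_pdivrMr// ler_pdivlMr// mulrC ltrBlDr lerBrDr.
    - by rewrite ltr_ndivlMr// ler_ndivrMr// mulrC ltrBlDr lerBrDr andbC.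
    - by rewrite ltr_ndivlMr// ler_ndivrMr// mulrC ltrBlDr lerBrDr andbC.
  rewrite lebesgue_measure_itv/= lte_fin.
  case: (ltgtP 0 a) a0 => // [ap|an] _; rewrite lebesgue_measure_itv/= lte_fin.
    rewrite ltr_pM2r ?invr_gt0// ltrD2r; case: ifPn => _; last by rewrite mule0.
    rewrite -!EFinB -EFinM gtr0_norm//; congr EFin; field; exact: lt0r_neq0.
  rewrite ltr_nM2r ?invr_lt0// ltrD2r; case: ifPn => _; last by rewrite mule0.
  rewrite -!EFinB -EFinM ltr0_norm//; congr EFin; field; exact: ltr0_neq0.
transitivity ((`|a|^-1)%:E * \int[nu]_x f x)%E; last first.
  congr (_ * _)%E; apply: eq_measure_integral => A mA _; exact/esym/E.
rewrite /nu ge0_integral_mscale//= muleA -EFinM mulVf ?mul1e//.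
by rewrite gt_eqF.
Qed.

End lebesgue_affine.

Definition lebR (R : realType) (A : set R) : \bar R := @lebesgue_measure R A.
HB.instance Definition _ (R : realType) := isMeasure.Build _ _ _ (@lebR R)
  (measure0 (@lebesgue_measure R)) (measure_ge0 (@lebesgue_measure R)) (@measure_semi_sigma_additive _ _ _ (@lebesgue_measure R)).
HB.instance Definition _ (R : realType) := Measure_isSigmaFinite.Build _ _ _ (@lebR R) (sigma_finiteT (@lebesgue_measure R)).
Definition leb2 (R : realType) (A : set (R * R)%type) : \bar R := (@lebR R \x @lebR R)%E A.
HB.instance Definition _ (R : realType) := Measure.copy (@leb2 R) (@lebR R \x @lebR R)%E.
Lemma leb2_sigma_finite (R : realType) : sigma_finite setT (@leb2 R).
Proof.
have /sigma_finiteP[F [TF ndF Foo]] := sigma_finiteT (@lebR R).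
exists (fun n => F n `*` F n).
 rewrite -setXTT TF predeqE => -[x y]; split.
    move=> [/= [n _ Fnx] [k _ Gky]]; exists (maxn n k) => //; split.
    - by move: x Fnx; exact/subsetPset/ndF/leq_maxl.
    - by move: y Gky; exact/subsetPset/ndF/leq_maxr.
  by move=> [n _ []/= ? ?]; split; exists n.
move=> k; have [? ?] := Foo k.
split; first exact: measurableX.
by rewrite /leb2 product_measure1E// lte_mul_pinfty// ge0_fin_numE.
Qed.
HB.instance Definition _ (R : realType) := Measure_isSigmaFinite.Build _ _ _ (@leb2 R) (@leb2_sigma_finite R).

(* [lebesgue_measure] lives on the alias [measurableTypeR R]; [lebR] transports
   it to the canonical measurable structure of [R], used in [R * R]. *)
Lemma lebR_integral (R : realType) (f : R -> \bar R) :
  measurable_fun setT f -> (forall x, 0 <= f x)%E ->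
  (\int[@lebR R]_x f x =
   \int[@lebesgue_measure R]_x (f : measurableTypeR R -> \bar R) x)%E.
Proof.
move=> mf f0.
pose i (x : measurableTypeR R) : R := x.
have mi : measurable_fun setT i by move=> mT A mA; rewrite setTI.
rewrite -[RHS](ge0_integral_image lebesgue_measure mi mf f0).
by apply: eq_measure_integral.
Qed.

Lemma lebR_affine (R : realType) (a b : R) (f : R -> \bar R) : a != 0 ->
  measurable_fun setT f -> (forall x, 0 <= f x)%E ->
  (\int[@lebR R]_x f (a * x + b)%R = `|a|^-1%:E * \int[@lebR R]_x f x)%E.
Proof.
move=> a0 mf f0; rewrite !lebR_integral//; first exact: lebesgue_affine.
apply: measurableT_comp => //.
by apply: measurable_funD => //; exact: measurable_funM.
Qed.

Section plane.
Variable R : realType.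
Local Notation leb := (@lebR R).
Local Notation l2 := (@leb2 R).

Let pos (F : (R * R)%type -> \bar R) := forall p, (0 <= F p)%E.

Lemma lebesgue2_swap (F : R * R -> \bar R) : measurable_fun setT F -> pos F ->
  (\int[l2]_p F (p.2, p.1) = \int[l2]_p F p)%E.
Proof. by move=> mF F0; exact: (@ge0_integral_swap _ _ _ _ R leb leb F mF F0). Qed.

Lemma lebesgue2_shear (a : R) (h : R -> R) (F : R * R -> \bar R) :
  a != 0 -> measurable_fun setT h -> measurable_fun setT F -> pos F ->
  (\int[l2]_p F (a * p.1 + h p.2, p.2)%R = `|a|^-1%:E * \int[l2]_p F p)%E.
Proof.
move=> a0 mh mF F0.
apply: (@ge0_integral_shear _ _ _ _ _ leb leb (fun p => a * p.1 + h p.2)) => //.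
- apply: measurable_funD; first exact: measurable_funM.
  exact: measurableT_comp.
- by move=> y f mf f0; exact: (lebR_affine (h y) a0 mf f0).
Qed.

Lemma lebesgue2_shear2 (a : R) (h : R -> R) (F : R * R -> \bar R) :
  a != 0 -> measurable_fun setT h -> measurable_fun setT F -> pos F ->
  (\int[l2]_p F (p.1, a * p.2 + h p.1)%R = `|a|^-1%:E * \int[l2]_p F p)%E.
Proof.
move=> a0 mh mF F0.
have mF' : measurable_fun setT (fun p : R * R => F (p.2, p.1)).
  by apply: measurableT_comp => //; exact: measurable_fun_pair.
rewrite -[in RHS]lebesgue2_swap// -(lebesgue2_shear _ mh mF')//=.
rewrite -[RHS]lebesgue2_swap//.
apply: measurableT_comp => //; apply: measurable_fun_pair => //=.
apply: measurable_funD; first exact: measurable_funM.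
exact: measurableT_comp.
Qed.

(** For [a != 0] the map is a shear in the first coordinate with factor [a] followed by one in the
    second with factor [(a * d - b * c) / a]. If [a = 0] then [b != 0], and swapping the variables
    exchanges the columns. *)
Lemma lebesgue2_linear (a b c d : R) (p0 : R * R) (F : R * R -> \bar R) :
  a * d - b * c != 0 -> measurable_fun setT F -> pos F ->
  (\int[l2]_p F ((a * p.1 + b * p.2 + p0.1)%R, (c * p.1 + d * p.2 + p0.2)%R) =
   `|a * d - b * c|^-1%:E * \int[l2]_p F p)%E.
Proof.
wlog a0 : a b c d F / a != 0.
  move=> W D0 mF F0; have [a0|a0] := eqVneq a 0; last exact: W.
  have b0 : b != 0.
    by apply: contraNneq D0 => ->; rewrite a0 !mul0r subrr.
  have mL : measurable_fun setT (fun p : R * R =>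
      F (a * p.1 + b * p.2 + p0.1, c * p.1 + d * p.2 + p0.2)).
    apply: measurableT_comp => //; apply: measurable_fun_pair => /=;
    by repeat (apply: measurable_funD || apply: measurable_funM) => //.
  rewrite -lebesgue2_swap//=.
  have := W b a d c F b0 _ mF F0; rewrite distrC => <-; last first.
    by rewrite -oppr_eq0 opprB.
  by apply: eq_integral => p _ /=; rewrite ![_ + _ * p.1]addrC.
move=> D0 mF F0.
pose G (q : R * R) := F (q.1, (a * d - b * c) / a * q.2 + (c / a * (q.1 - p0.1) + p0.2)).
have mG : measurable_fun setT G.
  apply: measurableT_comp => //; apply: measurable_fun_pair => //=.
  by repeat (apply: measurable_funD || apply: measurable_funM || apply: measurable_funB) => //.
rewrite (eq_integral (fun p => G (a * p.1 + (b * p.2 + p0.1), p.2))); last first.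
  by move=> p _; rewrite /G/=; congr F; congr pair => /=; [rewrite addrA|field].
rewrite (@lebesgue2_shear a (fun y => b * y + p0.1) G)//; last 2 first.
- by apply: measurable_funD => //; exact: measurable_funM.
- by move=> p; exact: F0.
rewrite (@lebesgue2_shear2 ((a * d - b * c) / a) (fun x => c / a * (x - p0.1) + p0.2))//.
- by rewrite muleA -EFinM -invfM -normrM mulrC divfK.
- by rewrite mulf_neq0// invr_eq0.
- by repeat (apply: measurable_funD || apply: measurable_funM || apply: measurable_funB) => //.
Qed.

End plane.

(** * Densities and the standard complex Gaussian measure *)

Section density.
Context d (T : measurableType d) (R : realType).
Variables (mu nu : {measure set T -> \bar R}) (f : T -> R).
Hypotheses (mf : measurable_fun setT f) (f0 : forall x, 0 <= f x).
Hypothesis nuE : forall A, measurable A -> nu A = (\int[mu]_(x in A) (f x)%:E)%E.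
Local Open Scope ereal_scope.
Import HBNNSimple.

(** Monotone convergence along simple approximations of [g] reduces the identity to level sets,
    where it is [nuE]. *)
Lemma ge0_integral_density (g : T -> \bar R) :
  measurable_fun setT g -> (forall x, 0 <= g x) ->
  \int[nu]_x g x = \int[mu]_x (g x * (f x)%:E).
Proof.
move=> mg g0.
pose g_ := nnsfun_approx measurableT mg.
have ndg x : nondecreasing_seq (fun n => (g_ n x)%:E).
  by move=> a b ab; rewrite lee_fin; exact/lefP/nd_nnsfun_approx.
have cvg x : EFin \o (g_ ^~ x) @ \oo --> g x by exact: cvg_nnsfun_approx.
have mgf n : measurable_fun setT (fun x => (g_ n x)%:E * (f x)%:E).
  by apply: emeasurable_funM; exact/measurable_EFinP.
transitivity (limn (fun n => \int[nu]_x (g_ n x)%:E)).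
  rewrite -monotone_convergence//.
  - by apply: eq_integral => x _; apply/esym/cvg_lim => //; exact: cvg.
  - by move=> n; exact/measurable_EFinP.
  - by move=> n x _; rewrite lee_fin.
transitivity (limn (fun n => \int[mu]_x ((g_ n x)%:E * (f x)%:E))); last first.
  rewrite -monotone_convergence//.
  - apply: eq_integral => x _; apply/cvg_lim => //.
    by apply: cvgeZr; [|exact: cvg].
  - by move=> n x _; rewrite mule_ge0 ?lee_fin//.
  - by move=> x _ a b ab; rewrite lee_wpmul2r ?lee_fin// -?lee_fin ndg.
apply: congr_lim; apply/funext => n.
rewrite integralT_nnsfun sintegralE.
have E x : (g_ n x)%:E * (f x)%:E =
    \sum_(r \in range (g_ n)) (r * \1_(g_ n @^-1` [set r]) x)%:E * (f x)%:E.
  rewrite fimfunE -fsumEFin// ge0_mule_fsuml// => r.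
  exact: nnfun_muleindic_ge0.
rewrite [RHS](eq_integral _ _ (fun x _ => E x)).
rewrite ge0_integral_fsum//; last 2 first.
- by move=> r; apply: emeasurable_funM; [apply/measurable_EFinP/measurable_funM|exact/measurable_EFinP].
- by move=> r x _; rewrite mule_ge0 ?lee_fin//; exact: nnfun_muleindic_ge0.
apply: eq_fsbigr => r _.
have [r0|r0] := ltP r 0%R.
  rewrite preimage_nnfun0// measure0 mule0; apply/esym/integral0_eq => x _.
  by rewrite indicE in_set0 mulr0 mul0e.
under eq_integral do rewrite EFinM -muleA.
rewrite ge0_integralZl//.
- rewrite nuE//= [in LHS]integral_mkcond; congr (_ * _).
  apply: eq_integral => x _; rewrite patchE indicE.
  by case: ifPn; rewrite ?mul1e ?mul0e.
- by apply: emeasurable_funM; exact/measurable_EFinP.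
- by move=> x _; rewrite mule_ge0 ?lee_fin//.
Qed.

End density.

Section gaussian.
Variable R : realType.
Local Notation leb := (@lebR R).
Local Notation l2 := (@leb2 R).

Definition sigma0 : R := Num.sqrt 2^-1.

Definition gauss1 (x : R) : R := normal_pdf 0 sigma0 x.

Definition rho (w : R * R) : R := expR (- (w.1 ^+ 2 + w.2 ^+ 2)) / pi.

Lemma gauss1E x : gauss1 x = (Num.sqrt pi)^-1 * expR (- x ^+ 2).
Proof.
have h0 : (0 : R) < 2^-1 by rewrite invr_gt0.
have s0 : sigma0 != 0 by rewrite gt_eqF// sqrtr_gt0.
rewrite /gauss1 normal_pdfE// /normal_peak /normal_fun sqr_sqrtr ?ltW//.
rewrite subr0 -mulr_natr mulrAC mulVf ?mul1r// -(mulr_natr 2^-1) mulVf//.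
by rewrite divr1.
Qed.

Lemma gauss1_ge0 x : 0 <= gauss1 x. Proof. exact: normal_pdf_ge0. Qed.

Lemma measurable_gauss1 : measurable_fun setT gauss1.
Proof. exact: measurable_normal_pdf. Qed.

Lemma rhoE w : rho w = gauss1 w.1 * gauss1 w.2.
Proof.
rewrite !gauss1E /rho opprD expRD mulrACA -invfM -expr2 sqr_sqrtr ?pi_ge0//.
by rewrite mulrC.
Qed.

Lemma rho_ge0 w : 0 <= rho w. Proof. by rewrite rhoE mulr_ge0 ?gauss1_ge0. Qed.

Lemma measurable_rho : measurable_fun setT rho.
Proof.
rewrite (_ : rho = fun w => gauss1 w.1 * gauss1 w.2); last exact/funext/rhoE.
by apply: measurable_funM; apply: measurableT_comp => //; exact: measurable_gauss1.
Qed.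

(** The law of a standard complex Gaussian in real coordinates. *)
Definition gam (A : set (R * R)%type) : \bar R := (\int[l2]_(p in A) (rho p)%:E)%E.

Let gam0 : gam set0 = 0%E. Proof. exact: integral_set0. Qed.

Let gam_ge0 A : (0 <= gam A)%E.
Proof. by apply: integral_ge0 => p _; rewrite lee_fin rho_ge0. Qed.

Let gam_sigma_additive : semi_sigma_additive gam.
Proof.
move=> F mF tF mUF; rewrite /gam ge0_integral_bigcup//.
- by apply: is_cvg_ereal_nneg_natsum_cond => n _ _; exact: gam_ge0.
- by apply/measurable_EFinP; apply: measurable_funTS; exact: measurable_rho.
- by move=> x _; rewrite lee_fin rho_ge0.
Qed.

HB.instance Definition _ := isMeasure.Build _ _ _ gam
  gam0 gam_ge0 gam_sigma_additive.

Lemma gauss1_normal_prob (B : set R) : measurable B ->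
  (normal_prob 0 (Num.sqrt 2^-1) B = \int[leb]_x (\1_B x * gauss1 x)%:E)%E.
Proof.
move=> mB; rewrite lebR_integral; last 2 first.
- apply/measurable_EFinP; apply: measurable_funM; last exact: measurable_gauss1.
  exact: measurable_indic.
- by move=> x; rewrite lee_fin mulr_ge0 ?gauss1_ge0.
rewrite /normal_prob integral_mkcond; apply: eq_integral => x _.
by rewrite patchE indicE; case: ifPn; rewrite ?mul1r ?mul0r.
Qed.

Lemma gam_rect (A B : set R) : measurable A -> measurable B ->
  (gam (A `*` B) = normal_prob 0 (Num.sqrt 2^-1) A * normal_prob 0 (Num.sqrt 2^-1) B)%E.
Proof.
move=> mA mB; rewrite !gauss1_normal_prob// /gam integral_mkcond.
have mg (C : set R) : measurable C -> measurable_fun setT (fun x => \1_C x * gauss1 x).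
  move=> mC; apply: measurable_funM; last exact: measurable_gauss1.
  exact: measurable_indic.
rewrite (eq_integral (fun p => ((\1_A p.1 * gauss1 p.1) * (\1_B p.2 * gauss1 p.2))%:E));
  last first.
  move=> p _; rewrite patchE rhoE; case: ifPn.
    by rewrite inE => -[/= pA pB]; rewrite !indicE !mem_set// !mul1r.
  rewrite notin_setE/= => pAB; congr EFin; rewrite !indicE.
  have [pA|pA] := boolP (p.1 \in A); last by rewrite !mul0r.
  have [pB|pB] := boolP (p.2 \in B); last by rewrite mul0r mulr0.
  by case: pAB; split; exact: set_mem.
rewrite [LHS](@fubini_tonelli1 _ _ _ _ _ leb leb); last 2 first.
- apply/measurable_EFinP; apply: measurable_funM.
    exact: (measurableT_comp (mg _ mA) measurable_fst).
  exact: (measurableT_comp (mg _ mB) measurable_snd).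
- by move=> p; rewrite lee_fin; do !apply: mulr_ge0; rewrite ?gauss1_ge0.
rewrite -ge0_integralZr//; last 3 first.
- by apply/measurable_EFinP; exact: mg.
- by move=> x _; rewrite lee_fin mulr_ge0 ?gauss1_ge0.
- by apply: integral_ge0 => x _; rewrite lee_fin mulr_ge0 ?gauss1_ge0.
apply: eq_integral => x _; rewrite /fubini_F/=.
under eq_integral do rewrite EFinM.
rewrite ge0_integralZl//.
- by apply/measurable_EFinP; exact: mg.
- by move=> y _; rewrite lee_fin mulr_ge0 ?gauss1_ge0.
- by rewrite lee_fin mulr_ge0 ?gauss1_ge0.
Qed.

Let gamT : gam setT = 1%E.
Proof.
rewrite -setXTT gam_rect// /normal_prob.
by rewrite integral_normal_pdf mule1.
Qed.

HB.instance Definition _ := Measure_isProbability.Build _ _ R gam gamT.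

Lemma ge0_integral_gam (g : R * R -> \bar R) :
  measurable_fun setT g -> (forall x, 0 <= g x)%E ->
  (\int[gam]_x g x = \int[l2]_x (g x * (rho x)%:E))%E.
Proof.
move=> mg g0; apply: ge0_integral_density => //.
- exact: measurable_rho.
- exact: rho_ge0.
Qed.

End gaussian.

(** * Differentiability of harmonic polynomials *)

Section modulus.
Variable R : realType.
Implicit Types x y z w : R[i].

(** The modulus as an element of [R]; the norm of the numeric field [R[i]] takes its values in
    [R[i]]. *)
Definition nc (z : R[i]) : R := Num.sqrt (complex.Re z ^+ 2 + complex.Im z ^+ 2).

Lemma ncE z : nc z = ComplexField.Normc.normc z. Proof. by case: z. Qed.
Lemma ncM z w : nc (z * w) = nc z * nc w.
Proof. by rewrite !ncE ComplexField.Normc.normcM. Qed.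
Lemma ncD z w : nc (z + w) <= nc z + nc w.
Proof. by rewrite !ncE le_normcD. Qed.
Lemma ncN z : nc (- z) = nc z. Proof. by rewrite !ncE normcN. Qed.
Lemma ncB z w : nc (z - w) <= nc z + nc w.
Proof. by rewrite (le_trans (ncD _ _))// ncN. Qed.
Lemma ncC z w : nc (z - w) = nc (w - z). Proof. by rewrite -ncN opprB. Qed.
Lemma nc_ge0 z : 0 <= nc z. Proof. exact: sqrtr_ge0. Qed.
Lemma nc0 : nc 0 = 0. Proof. by rewrite ncE ComplexField.Normc.normc0. Qed.
Lemma nc1 : nc 1 = 1. Proof. by rewrite ncE ComplexField.Normc.normc1. Qed.
Lemma nc_eq0 z : (nc z == 0) = (z == 0).
Proof.
apply/eqP/eqP => [|->]; last exact: nc0.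
by rewrite ncE => /ComplexField.Normc.eq0_normc.
Qed.
Lemma ncV z : nc z^-1 = (nc z)^-1.
Proof. by rewrite !ncE ComplexField.Normc.normcV. Qed.

(* [conjc] at a fixed carrier: [z^*] is parsed as either [conjc] or [Num.conj]. *)
Definition cj (z : R[i]) : R[i] := conjc z.

Lemma cjD z w : cj (z + w) = cj z + cj w. Proof. exact: rmorphD. Qed.
Lemma cjN z : cj (- z) = - cj z. Proof. exact: rmorphN. Qed.
Lemma cjB z w : cj (z - w) = cj z - cj w. Proof. exact: rmorphB. Qed.
Lemma cjM z w : cj (z * w) = cj z * cj w. Proof. exact: rmorphM. Qed.
Lemma cjV z : cj z^-1 = (cj z)^-1. Proof. exact: conjc_inv. Qed.
Lemma cjR (a : R) : cj a%:C = a%:C. Proof. exact: conjc_real. Qed.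
Lemma cjK z : cj (cj z) = z. Proof. exact: conjcK. Qed.
Lemma cj0 : cj 0 = 0. Proof. exact: rmorph0. Qed.
Lemma ncJ z : nc (cj z) = nc z. Proof. by case: z => a b; rewrite /nc/= sqrrN. Qed.
Lemma ncX z n : nc (z ^+ n) = nc z ^+ n.
Proof. by elim: n => [|n IH]; rewrite ?nc1// !exprS ncM IH. Qed.
Lemma nc_sqr z : nc z ^+ 2 = complex.Re z ^+ 2 + complex.Im z ^+ 2.
Proof. by rewrite sqr_sqrtr// addr_ge0// sqr_ge0. Qed.
Lemma nc_Re z : `|complex.Re z| <= nc z.
Proof. by rewrite -sqrtr_sqr ler_wsqrtr// lerDl sqr_ge0. Qed.
Lemma nc_Im z : `|complex.Im z| <= nc z.
Proof. by rewrite -sqrtr_sqr ler_wsqrtr// lerDr sqr_ge0. Qed.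
Lemma nc_le z : nc z <= `|complex.Re z| + `|complex.Im z|.
Proof.
rewrite -[leRHS]ger0_norm ?addr_ge0// -sqrtr_sqr ler_wsqrtr//.
by rewrite sqrrD !real_normK ?num_real// addrAC lerDl mulrn_wge0// mulr_ge0.
Qed.
Lemma ncR (a : R) : nc a%:C = `|a|.
Proof. by rewrite /nc/= expr0n/= addr0 sqrtr_sqr. Qed.

End modulus.
Arguments cj : simpl never.
Arguments nc : simpl never.

Section C11.
Variable R : realType.
Variable r : R.
Hypothesis r0 : 0 <= r.
Implicit Types f g df dg : R[i] -> R[i].

(** Differentiability with one explicit constant on the whole disc: quadratic Taylor remainder,
    Lipschitz derivative and bounds. The class is stable under sums and products, which gives
    polynomials by induction, and the uniform [M] later yields one mesh size for all squares in the
    disc. *)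
Definition C11_with (M : R) f df := forall z w, nc z <= r -> nc w <= r ->
  [/\ nc (f z - f w - df w * (z - w)) <= M * nc (z - w) ^+ 2,
      nc (df z - df w) <= M * nc (z - w), nc (f w) <= M & nc (df w) <= M].

Definition C11 f df := exists M, C11_with M f df.

Lemma C11_weaken M M' f df : M <= M' -> C11_with M f df -> C11_with M' f df.
Proof.
move=> MM' H z w zr wr; have [H1 H2 H3 H4] := H z w zr wr; split.
- by rewrite (le_trans H1)// ler_wpM2r// sqr_ge0.
- by rewrite (le_trans H2)// ler_wpM2r// nc_ge0.
- exact: le_trans MM'.
- exact: le_trans MM'.
Qed.

Lemma C11_common f df g dg : C11 f df -> C11 g dg ->
  exists M, [/\ 1 <= M, C11_with M f df & C11_with M g dg].
Proof.
move=> [M Hf] [N Hg]; exists (Num.max 1 (Num.max M N)); split.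
- by rewrite le_max lexx.
- by apply: C11_weaken Hf; rewrite !le_max lexx orbT.
- by apply: C11_weaken Hg; rewrite !le_max lexx !orbT.
Qed.

Lemma C11_Lip M f df : 0 <= M -> C11_with M f df -> forall z w, nc z <= r -> nc w <= r ->
  nc (f z - f w) <= M * (2 * r + 1) * nc (z - w).
Proof.
move=> M0 H z w zr wr; have [H1 _ _ H4] := H z w zr wr.
have -> : f z - f w = (f z - f w - df w * (z - w)) + df w * (z - w) by ring.
rewrite (le_trans (ncD _ _))// ncM.
have h : nc (z - w) <= 2 * r by rewrite (le_trans (ncB _ _))//; lra.
have h0 := nc_ge0 (z - w).
have : nc (df w) * nc (z - w) <= M * nc (z - w) by rewrite ler_wpM2r.
have : nc (z - w) ^+ 2 <= 2 * r * nc (z - w) by rewrite expr2 ler_wpM2r.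
move=> /(ler_wpM2l M0); lra.
Qed.

Lemma C11_cst c : C11 (fun=> c) (fun=> 0).
Proof.
exists (nc c) => z w _ _; rewrite !subrr mul0r subrr nc0; split=> //.
- by rewrite mulr_ge0 ?nc_ge0// sqr_ge0.
- by rewrite mulr_ge0 ?nc_ge0.
- exact: nc_ge0.
Qed.

Lemma C11_id : C11 id (fun=> 1).
Proof.
exists (1 + r) => z w zr wr; rewrite mul1r !subrr nc0 nc1; split => //.
- by rewrite mulr_ge0 ?addr_ge0// sqr_ge0.
- by rewrite mulr_ge0 ?addr_ge0// nc_ge0.
- by rewrite (le_trans wr)// lerDr.
- by rewrite lerDl.
Qed.

Lemma C11_add f df g dg : C11 f df -> C11 g dg ->
  C11 (fun z => f z + g z) (fun z => df z + dg z).
Proof.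
move=> Hf Hg; have [M [M1 {}Hf {}Hg]] := C11_common Hf Hg.
exists (M + M) => z w zr wr.
have [f1 f2 f3 f4] := Hf z w zr wr; have [g1 g2 g3 g4] := Hg z w zr wr.
split.
- have -> : f z + g z - (f w + g w) - (df w + dg w) * (z - w) =
   (f z - f w - df w * (z - w)) + (g z - g w - dg w * (z - w)) by ring.
  by rewrite (le_trans (ncD _ _))// mulrDl lerD.
- rewrite opprD addrACA (le_trans (ncD _ _))// mulrDl lerD//.
- by rewrite (le_trans (ncD _ _))// lerD.
- by rewrite (le_trans (ncD _ _))// lerD.
Qed.

Lemma C11_mul f df g dg : C11 f df -> C11 g dg ->
  C11 (fun z => f z * g z) (fun z => df z * g z + f z * dg z).
Proof.
move=> Hf Hg; have [M [M1 {}Hf {}Hg]] := C11_common Hf Hg.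
have M0 : 0 <= M by lra.
(* With the Lipschitz constant [M * (2 * r + 1)] of [f] and [g], the largest of the four estimates
   has constant [(4 * r + 4) * M ^+ 2]; the witness leaves a factor 2 to spare. *)
exists (4 * M ^+ 2 * (2 * r + 2)) => z w zr wr.
have [f1 f2 f3 f4] := Hf z w zr wr; have [g1 g2 g3 g4] := Hg z w zr wr.
have [_ _ f3z f4z] := Hf w z wr zr; have [_ _ g3z g4z] := Hg w z wr zr.
have fL := C11_Lip M0 Hf zr wr; have gL := C11_Lip M0 Hg zr wr.
have h0 := nc_ge0 (z - w).
set h := nc (z - w) in fL gL h0 f1 f2 g1 g2 *.
have M20 : 0 <= M ^+ 2 by rewrite sqr_ge0.
have MM : M * M = M ^+ 2 by rewrite expr2.
have Mr : 0 <= M ^+ 2 * r by rewrite mulr_ge0.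
split.
- have -> : f z * g z - f w * g w - (df w * g w + f w * dg w) * (z - w) =
    (f z - f w - df w * (z - w)) * g z + f w * (g z - g w - dg w * (z - w))
    + df w * ((z - w) * (g z - g w)) by ring.
  rewrite (le_trans (ncD _ _))// (le_trans (lerD (ncD _ _) (lexx _)))// !ncM -/h.
  have A1 := ler_pM (nc_ge0 _) (nc_ge0 _) f1 g3z.
  have A2 := ler_pM (nc_ge0 _) (nc_ge0 _) f3 g1.
  have A3 := ler_pM (nc_ge0 _) (mulr_ge0 h0 (nc_ge0 _)) f4 (ler_wpM2l h0 gL).
  apply: le_trans (lerD (lerD A1 A2) A3) _.
  have : 0 <= M ^+ 2 * h ^+ 2 by rewrite mulr_ge0// sqr_ge0.
  have : 0 <= M ^+ 2 * r * h ^+ 2 by rewrite mulr_ge0// sqr_ge0.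
  lra.
- have -> : df z * g z + f z * dg z - (df w * g w + f w * dg w) =
    (df z - df w) * g z + df w * (g z - g w) + ((f z - f w) * dg z + f w * (dg z - dg w))
    by ring.
  rewrite (le_trans (ncD _ _))// (le_trans (lerD (ncD _ _) (ncD _ _)))// !ncM.
  have A1 := ler_pM (nc_ge0 _) (nc_ge0 _) f2 g3z.
  have A2 := ler_pM (nc_ge0 _) (nc_ge0 _) f4 gL.
  have A3 := ler_pM (nc_ge0 _) (nc_ge0 _) fL g4z.
  have A4 := ler_pM (nc_ge0 _) (nc_ge0 _) f3 g2.
  apply: le_trans (lerD (lerD A1 A2) (lerD A3 A4)) _.
  have : 0 <= M ^+ 2 * h by rewrite mulr_ge0.
  have : 0 <= M ^+ 2 * r * h by rewrite mulr_ge0.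
  lra.
- rewrite ncM (le_trans (ler_pM (nc_ge0 _) (nc_ge0 _) f3 g3))//.
  lra.
- rewrite (le_trans (ncD _ _))// !ncM.
  apply: le_trans (lerD (ler_pM (nc_ge0 _) (nc_ge0 _) f4 g3)
    (ler_pM (nc_ge0 _) (nc_ge0 _) f3 g4)) _.
  lra.
Qed.

Lemma C11_ext f df g dg : f =1 g -> df =1 dg -> C11 f df -> C11 g dg.
Proof. by move=> /funext <- /funext <-. Qed.

Lemma C11_exp n : C11 (fun z => z ^+ n) (fun z => n%:R * z ^+ n.-1).
Proof.
elim: n => [|n IH].
  by apply: C11_ext (C11_cst 1) => z; rewrite ?expr0 ?mul0r.
apply: C11_ext (C11_mul C11_id IH) => z; first by rewrite exprS.
by case: n {IH} => [|n]; rewrite /= ?mul0r ?mulr0 ?addr0 ?mul1r// exprS -[in RHS]natr1; ring.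
Qed.

Lemma C11_sum n (c : 'I_n -> R[i]) : C11 (fun z => \sum_(j < n) c j * z ^+ j)
   (fun z => \sum_(j < n) c j * (j%:R * z ^+ j.-1)).
Proof.
elim: n c => [|n IH] c.
  by apply: C11_ext (C11_cst 0) => z; rewrite big_ord0.
apply: C11_ext (C11_add (IH (fun j => c (widen_ord (leqnSn n) j)))
   (C11_mul (C11_cst (c ord_max)) (C11_exp n))) => z /=.
  by rewrite big_ord_recr.
by rewrite big_ord_recr/= mul0r add0r.
Qed.

End C11.

(** * Nearly linear maps of the plane: inversion by fixed points, areas of images *)

HB.instance Definition _ (R : realType) (m n : nat) := Complete.on 'M[R]_(m.+1, n.+1).

Section fixpoint.
Variable R : realType.

Let row2 (p : R * R) : 'rV[R]_2 := \row_(i < 2) (if i == 0 then p.1 else p.2).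
Let pair2 (v : 'rV[R]_2) : R * R := (v 0 0, v 0 1).

Let row2K : cancel row2 pair2.
Proof. by case=> a b; rewrite /pair2 !mxE. Qed.

Let norm_row2 (v : 'rV[R]_2) : `|v| = `|pair2 v|.
Proof.
rewrite -[RHS]/(Num.max `|v 0 0| `|v 0 1|) -[LHS]/(mx_norm v) mx_normrE.
apply/eqP; rewrite eq_le; apply/andP; split.
  apply/bigmax_leP; split; first by rewrite le_max normr_ge0.
  move=> -[i j] _ /=; rewrite !ord1 le_max.
  case: j => -[|[|//]] jlt.
    by rewrite (_ : Ordinal jlt = 0) ?lexx//; exact/val_inj.
  by rewrite (_ : Ordinal jlt = 1) ?lexx ?orbT//; exact/val_inj.
rewrite ge_max; apply/andP; split.
  exact: (@le_bigmax _ _ _ _ (fun ij => `|v ij.1 ij.2|) (0, 0)).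
exact: (@le_bigmax _ _ _ _ (fun ij => `|v ij.1 ij.2|) (0, 1)).
Qed.

(** Banach's fixed point theorem on a closed ball of the sup norm, transported along the isometry
    with ['rV[R]_2]. *)
Lemma fixpoint_square (h : R) (q : {nonneg R}) (g : R * R -> R * R) :
  0 <= h -> q%:num < 1 ->
  (forall x, `|x| <= h -> `|g x| <= h) ->
  (forall x y, `|x| <= h -> `|y| <= h -> `|g x - g y| <= q%:num * `|x - y|) ->
  exists2 x, `|x| <= h & g x = x.
Proof.
move=> h0 q1 gh gq.
pose U : set 'rV[R]_2 := closed_ball_ Num.norm 0 h.
have UE v : U v <-> `|pair2 v| <= h.
  by rewrite /U /closed_ball_/= sub0r normrN norm_row2.
pose G (v : 'rV[R]_2) := row2 (g (pair2 v)).
have GU : set_fun U U G.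
  by move=> v /UE vh; apply/UE; rewrite row2K; exact: gh.
pose Gm := isFun.Build _ _ _ _ _ GU.
pose GF : {fun U >-> U} := HB.pack G Gm.
have cG : is_contraction GF.
  exists q; split=> //; case=> v w [/= /UE vh /UE wh].
  rewrite /GF/= !norm_row2.
  have pB a b : pair2 (a - b) = pair2 a - pair2 b by rewrite /pair2 !mxE.
  by rewrite !pB !row2K; exact: gq.
have [|| v Uv vE] := banach_fixed_point cG.
- exact: closed_closed_ball_.
- by exists 0; rewrite /U /closed_ball_/= subrr normr0.
exists (pair2 v); first exact/UE.
by rewrite [in RHS]vE /GF/= row2K.
Qed.

End fixpoint.

Section linear_images.
Variable R : realType.
Local Notation leb := (@lebR R).
Local Notation l2 := (@leb2 R).
Implicit Types (a b w h z : R[i]) (p q : R * R).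

Definition cx (p : R * R) : R[i] := p.1 +i* p.2.

Arguments cx : simpl never.

Lemma cxK p : cpair (cx p) = p. Proof. by case: p. Qed.
Lemma cpairK z : cx (cpair z) = z. Proof. by case: z. Qed.

Lemma cxB p q : cx (p - q) = cx p - cx q. Proof. by []. Qed.
Lemma cxD p q : cx (p + q) = cx p + cx q. Proof. by []. Qed.

Lemma cpair_cxD p z : cpair (cx p + z) = p + cpair z.
Proof. by case: p; case: z. Qed.

Lemma norm_cpair z : `|cpair z| <= nc z.
Proof. by rewrite ge_max nc_Re nc_Im. Qed.

Lemma nc_cx p : nc (cx p) <= 2 * `|p|.
Proof.
by rewrite (le_trans (nc_le _))// mulrDl mul1r lerD// le_max lexx ?orbT.
Qed.

Lemma mulJ_nc a : a * cj a = (nc a ^+ 2)%:C.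
Proof.
case: a => x y; rewrite nc_sqr /=; apply/eqP; rewrite eq_complex /=.
by apply/andP; split; apply/eqP; ring.
Qed.

Definition sqr_box (t : R) : set (R * R)%type := `[- t, t] `*` `[- t, t].

Lemma measurable_sqr_box t : measurable (sqr_box t).
Proof. exact: measurableX. Qed.

Lemma leb2_sqr_box t : 0 <= t -> l2 (sqr_box t) = ((2 * t) ^+ 2)%:E.
Proof.
move=> t0; rewrite /leb2 product_measure1E//= /lebR lebesgue_measure_itv/= lte_fin.
have [tt|] := ltP (- t) t; first by rewrite -EFinB -EFinM; congr EFin; ring.
move=> tt; have -> : t = 0 by lra.
by rewrite mul0e mulr0 expr0n.
Qed.

Lemma sqr_boxP t p : sqr_box t p <-> `|p| <= t.
Proof.
rewrite /sqr_box /= !in_itv/= -!ler_norml -[ `|p|]/(Num.max `|p.1| `|p.2|) ge_max.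
by split => [[-> ->]|/andP[]].
Qed.

Lemma measurable_clinear (P S b : R[i]) : measurable_fun setT
  (fun p => cpair (P * cx p + S * cj (cx p) + b)).
Proof.
rewrite (_ : (fun p => _) = fun p : R * R =>
    (complex.Re P * p.1 - complex.Im P * p.2 + (complex.Re S * p.1 + complex.Im S * p.2) + complex.Re b,
     complex.Re P * p.2 + complex.Im P * p.1 + (complex.Im S * p.1 - complex.Re S * p.2) + complex.Im b)).
  apply: measurable_fun_pair => /=;
  by repeat (apply: measurable_funB || apply: measurable_funD || apply: measurable_funM) => //.
by apply/funext; case: P S b => [? ?] [? ?] [? ?] [? ?]; rewrite /cpair/=; congr pair; ring.
Qed.

(** As a real linear map, [h |-> P h + S cj h] has determinant [|P|^2 - |S|^2]. *)
Lemma leb2_clinear (P S b : R[i]) (X : set (R * R)%type) : measurable X ->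
  nc P ^+ 2 - nc S ^+ 2 != 0 ->
  (l2 [set p | X (cpair (P * cx p + S * cj (cx p) + b)%R)] =
   `|nc P ^+ 2 - nc S ^+ 2|^-1%:E * l2 X)%E.
Proof.
move=> mX D0.
pose p1 := complex.Re P; pose p2 := complex.Im P.
pose s1 := complex.Re S; pose s2 := complex.Im S.
have DE : nc P ^+ 2 - nc S ^+ 2 = (p1 + s1) * (p1 - s1) - (s2 - p2) * (p2 + s2).
  by rewrite !nc_sqr -/p1 -/p2 -/s1 -/s2; ring.
rewrite DE -[in RHS](setIT X) -integral_indic//.
rewrite -(@lebesgue2_linear R (p1 + s1) (s2 - p2) (p2 + s2) (p1 - s1) (cpair b)
  (fun p => (\1_X p)%:E)); first last.
- by move=> p; rewrite lee_fin.
- exact/measurable_EFinP/measurable_indic.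
- by rewrite -DE.
rewrite -[X in l2 X]setIT -integral_indic//; last first.
  by rewrite -(setTI [set p | _]); exact: measurable_clinear.
apply: eq_integral => p _ /=; congr EFin; congr (\1_X _).
rewrite /p1 /p2 /s1 /s2; case: P S b p {D0 DE p1 p2 s1 s2} => [? ?] [? ?] [? ?] [? ?].
by rewrite /cpair/=; congr pair; ring.
Qed.

Lemma rlinear_inv a b h : nc a ^+ 2 - nc b ^+ 2 != 0 ->
  let D := (nc a ^+ 2 - nc b ^+ 2)%:C in
  cj a / D * (a * h + b * cj h) + (- b / D) * cj (a * h + b * cj h) = h.
Proof.
move=> D0 D.
have D0' : D != 0 by rewrite /D eq_complex /= eqxx andbT.
rewrite cjD !cjM cjK.
have -> : cj a / D * (a * h + b * cj h) + - b / D * (cj a * cj h + cj b * h) =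
  (a * cj a - b * cj b) / D * h by ring.
by rewrite !mulJ_nc -rmorphB -/D divff// mul1r.
Qed.

Lemma rlinear_inv' a b h : nc a ^+ 2 - nc b ^+ 2 != 0 ->
  let D := (nc a ^+ 2 - nc b ^+ 2)%:C in
  let k := cj a / D * h + (- b / D) * cj h in a * k + b * cj k = h.
Proof.
move=> D0 D k.
have D0' : D != 0 by rewrite /D eq_complex /= eqxx andbT.
have DJ : cj D = D by rewrite /D cjR.
rewrite /k cjD !cjM !cjK !cjV DJ cjN.
have -> : a * (cj a / D * h + - b / D * cj h) + b * (a / D * cj h + - cj b / D * h) =
  (a * cj a - b * cj b) / D * h by ring.
by rewrite !mulJ_nc -rmorphB -/D divff// mul1r.
Qed.

Variables (a b : R[i]) (theta : R).
Hypotheses (theta0 : 0 < theta) (thetaP : theta <= `|nc a - nc b|).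
Let D : R := nc a ^+ 2 - nc b ^+ 2.

Let DE : D = (nc a - nc b) * (nc a + nc b). Proof. by rewrite /D subr_sqr. Qed.

Let sum_gt0 : 0 < nc a + nc b.
Proof.
have := nc_ge0 a; have := nc_ge0 b; have := theta0.
move: thetaP; rewrite ler_normr => /orP[]; lra.
Qed.

Lemma det_neq0 : nc a ^+ 2 - nc b ^+ 2 != 0.
Proof.
rewrite -/D DE mulf_neq0//; last by rewrite gt_eqF.
by have := lt_le_trans theta0 thetaP; rewrite normr_gt0.
Qed.

Let P := cj a / D%:C.
Let S := - b / D%:C.

Let detPS : nc P ^+ 2 - nc S ^+ 2 = D^-1.
Proof.
rewrite /P /S !ncM ncN ncJ ncV ncR !exprMn -mulrBl -/D exprVn real_normK ?num_real//.
by rewrite expr2 invfM mulrA divff ?mul1r// det_neq0.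
Qed.

(** The inverse has norm at most [(|a| + |b|) / |D| = 1 / | |a| - |b| |]; thus [theta] is a lower
    bound for the smallest singular value. *)
Lemma rlinear_inv_bound h : nc (P * h + S * cj h) <= nc h / theta.
Proof.
rewrite (le_trans (ncD _ _))// !ncM ncN !ncJ ncV ncR -!mulrDl mulrC ler_wpM2l ?nc_ge0//.
rewrite DE normrM invfM (gtr0_norm sum_gt0) mulrCA divff ?gt_eqF// mulr1.
by rewrite lef_pV2// posrE// (lt_le_trans theta0).
Qed.

(** The inverse linear map sends [U] into a box of half-side [t + eta / theta], since it enlarges
    the error [eta] by at most [1 / theta]. *)
Lemma leb2_image_le (U : set (R * R)%type) w (t eta : R) : measurable U ->
  0 <= t -> 0 <= eta ->
  (forall u, U u -> exists2 h : R * R, `|h| <= t &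
     nc (cx u - w - (a * cx h + b * cj (cx h))) <= eta) ->
  (l2 U <= (`|nc a ^+ 2 - nc b ^+ 2| * (2 * (t + eta / theta)) ^+ 2)%:E)%E.
Proof.
move=> mU t0 eta0 HU.
have te : 0 <= t + eta / theta by rewrite addr_ge0// divr_ge0// ltW.
pose X := sqr_box (t + eta / theta).
have D0 : nc P ^+ 2 - nc S ^+ 2 != 0 by rewrite detPS invr_eq0 det_neq0.
have mX := measurable_sqr_box (t + eta / theta).
have -> : (`|nc a ^+ 2 - nc b ^+ 2| * (2 * (t + eta / theta)) ^+ 2)%:E =
  l2 [set p | X (cpair (P * cx p + S * cj (cx p) - (P * w + S * cj w)))].
  by rewrite leb2_clinear// detPS normfV invrK leb2_sqr_box// -EFinM.
apply: le_measure; rewrite ?inE//.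
  rewrite -(setTI [set p | _]); exact: measurable_clinear.
move=> u /HU[h ht hu] /=; apply/sqr_boxP.
set e := cx u - w - (a * cx h + b * cj (cx h)) in hu.
have -> : P * cx u + S * cj (cx u) - (P * w + S * cj w) = cx h + (P * e + S * cj e).
  have := rlinear_inv (cx h) det_neq0; rewrite /= -/P -/S.
  set L := a * cx h + _ in e hu * => E.
  have eu : cx u = w + L + e by rewrite /e; ring.
  have cu : cj (cx u) = cj w + cj L + cj e.
    by rewrite [in LHS]eu !cjD.
  by rewrite cu eu -E; ring.
rewrite cpair_cxD.
rewrite (le_trans (ler_normD _ _))// lerD// (le_trans (norm_cpair _))//.
by rewrite (le_trans (rlinear_inv_bound _))// ler_wpM2r// invr_ge0 ltW.
Qed.

End linear_images.

Section real_C11.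
Variable R : realType.
Variable r : R.

(** The real-differentiable analogue of [C11_with], with [D1] and [D2] the Wirtinger derivatives in
    [z] and [cj z]. *)
Definition RC11_with (M : R) (Phi D1 D2 : R[i] -> R[i]) := forall z w : R[i], nc z <= r -> nc w <= r ->
  [/\ nc (Phi z - Phi w - (D1 w * (z - w) + D2 w * cj (z - w))) <= M * nc (z - w) ^+ 2,
      nc (D1 z - D1 w) <= M * nc (z - w),
      nc (D2 z - D2 w) <= M * nc (z - w),
      nc (D1 w) <= M & nc (D2 w) <= M].

Lemma C11_harmonic (p dp q dq : R[i] -> R[i]) : C11 r p dp -> C11 r q dq ->
  exists2 M, 1 <= M & RC11_with M (fun z => p z + q (cj z)) dp (fun z => dq (cj z)).
Proof.
move=> Hp Hq; have [M [M1 {}Hp {}Hq]] := C11_common Hp Hq.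
exists (2 * M); first lra.
move=> z w zr wr; have [p1 p2 p3 p4] := Hp z w zr wr.
have [|| q1 q2 q3 q4] := Hq (cj z) (cj w); rewrite ?ncJ//.
rewrite -cjB ncJ in q1 q2.
have h0 := nc_ge0 (z - w).
have Mh : 0 <= M * nc (z - w) by rewrite mulr_ge0//; lra.
split.
- have -> : p z + q (cj z) - (p w + q (cj w)) - (dp w * (z - w) + dq (cj w) * cj (z - w)) =
    (p z - p w - dp w * (z - w)) + (q (cj z) - q (cj w) - dq (cj w) * cj (z - w)) by ring.
  by rewrite (le_trans (ncD _ _))//; lra.
- by lra.
- by lra.
- by lra.
- by lra.
Qed.

Local Notation l2 := (@leb2 R).

(** Quantitative inverse function theorem: every [u] that the inverse differential at [m] sends into
    the box of half-side [(1 - 2 * q) * t] is a value of [Phi] on the open box of half-side [t],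
    found by a simplified Newton iteration. The condition [16 * M * t <= q * theta] makes that
    iteration a [q]-contraction. *)
Lemma leb2_image_ge (M : R) (Phi D1 D2 : R[i] -> R[i]) (m : R * R) (t theta q : R) (U : set (R * R)%type) :
  RC11_with M Phi D1 D2 -> 0 <= M -> 0 < t -> 0 < theta ->
  theta <= `|nc (D1 (cx m)) - nc (D2 (cx m))| ->
  (forall x : R * R, `|x| <= t -> nc (cx (m + x)) <= r) ->
  0 < q -> 2 * q <= 1 -> 16 * M * t <= q * theta ->
  measurable U ->
  (forall x : R * R, `|x| < t -> U (cpair (Phi (cx (m + x))))) ->
  ((`|nc (D1 (cx m)) ^+ 2 - nc (D2 (cx m)) ^+ 2| * (2 * ((1 - 2 * q) * t)) ^+ 2)%:E
     <= l2 U)%E.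
Proof.
move=> HPhi M0 t0 theta0 thetaP boxr q0 q1 qP mU UP.
set a := D1 (cx m) in thetaP *; set b := D2 (cx m) in thetaP *.
have D0 := det_neq0 theta0 thetaP.
set D := nc a ^+ 2 - nc b ^+ 2 in D0 *.
pose P := cj a / D%:C; pose S := - b / D%:C.
have Abound h : nc (P * h + S * cj h) <= nc h / theta.
  exact: (rlinear_inv_bound theta0 thetaP).
have detPS : nc P ^+ 2 - nc S ^+ 2 = D^-1.
  rewrite /P /S !ncM ncN ncJ ncV ncR !exprMn -mulrBl -/D exprVn real_normK ?num_real//.
  by rewrite expr2 invfM mulrA divff ?mul1r.
pose w0 := Phi (cx m).
have T0 : 0 <= (1 - 2 * q) * t by rewrite mulr_ge0//; lra.
pose X := sqr_box ((1 - 2 * q) * t).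
have mX : measurable X := measurable_sqr_box _.
have -> : (`|D| * (2 * ((1 - 2 * q) * t)) ^+ 2)%:E =
  l2 [set p | X (cpair (P * cx p + S * cj (cx p) + - (P * w0 + S * cj w0)))].
  rewrite leb2_clinear//; last by rewrite detPS invr_eq0.
  by rewrite detPS normfV invrK leb2_sqr_box// -EFinM.
apply: le_measure; rewrite ?inE//.
  by rewrite -(setTI [set p | _]); exact: measurable_clinear.
move=> u /= /sqr_boxP.
set k := cpair _ => kt.
have kE : cx k = P * (cx u - w0) + S * cj (cx u - w0).
  by rewrite /k cpairK cjB; ring.
(* With [A] the inverse of the differential at [m], this is the Newton map
   [x - A (Phi (m + x) - u)]; its fixed points solve [Phi (m + x) = u]. *)
pose g (x : R * R) : R * R :=
  k + x - cpair (P * (Phi (cx (m + x)) - w0) + S * cj (Phi (cx (m + x)) - w0)).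
have gq x y : `|x| <= t -> `|y| <= t -> `|g x - g y| <= q * `|x - y|.
  move=> xt yt.
  pose h := cx (x - y).
  have hE : cx (m + x) - cx (m + y) = h by rewrite -cxB /h; congr cx; rewrite opprD addrACA subrr add0r.
  pose e := Phi (cx (m + x)) - Phi (cx (m + y)) - (a * h + b * cj h).
  have gE : g x - g y = - cpair (P * e + S * cj e).
    rewrite -[LHS]cxK -[- cpair _]cxK; congr cpair.
    have := rlinear_inv h D0; rewrite /= -/D -/P -/S => Eh.
    have cxN p : cx (- p) = - cx p by [].
    rewrite cxN cpairK cxB /g !cxB !cxD !cpairK /e !cjB.
    have := Eh; rewrite /h cxB => {}Eh.
    apply/eqP; rewrite -subr_eq0.
    rewrite -[X in X == _]addr0 -[X in _ + X](subrr (cx x - cx y)) -[X in _ + (X - _)]Eh.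
    by apply/eqP; ring.
  rewrite gE normrN (le_trans (norm_cpair _))// (le_trans (Abound _))//.
  have h4 : nc h <= 2 * `|x - y| by exact: nc_cx.
  have xy : `|x - y| <= 2 * t by rewrite (le_trans (ler_normB _ _))//; lra.
  have h0 := nc_ge0 h.
  have [H1 _ _ _ _] := HPhi _ _ (boxr _ xt) (boxr _ yt).
  have m0 : nc (cx m) <= r by rewrite -[m]addr0; apply: boxr; rewrite normr0 ltW.
  have [_ H2 H3 _ _] := HPhi _ _ (boxr _ yt) m0.
  rewrite hE in H1.
  have yE : cx (m + y) - cx m = cx y by rewrite -cxB addrAC subrr add0r.
  rewrite yE -/a -/b in H2 H3.
  have y2 : nc (cx y) <= 2 * t by rewrite (le_trans (nc_cx _))//; lra.
  (* Linearizing at [m + y], the Taylor remainder costs [4 * M * t * nc h], and moving each of the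
     two derivatives from [m + y] to [m] costs [2 * M * t * nc h]. *)
  have e8 : nc e <= 8 * M * t * nc h.
    have -> : e = (Phi (cx (m + x)) - Phi (cx (m + y)) -
        (D1 (cx (m + y)) * h + D2 (cx (m + y)) * cj h)) +
        ((D1 (cx (m + y)) - a) * h + (D2 (cx (m + y)) - b) * cj h) by rewrite /e; ring.
    rewrite (le_trans (ncD _ _))// (le_trans (lerD H1 (ncD _ _)))// !ncM ncJ.
    have A1 : nc h ^+ 2 <= 4 * t * nc h by rewrite expr2 ler_wpM2r//; lra.
    have A2 : nc (D1 (cx (m + y)) - a) * nc h <= M * (2 * t) * nc h.
      by rewrite ler_wpM2r// (le_trans H2)// ler_wpM2l.
    have A3 : nc (D2 (cx (m + y)) - b) * nc h <= M * (2 * t) * nc h.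
      by rewrite ler_wpM2r// (le_trans H3)// ler_wpM2l.
    have A4 := ler_wpM2l M0 A1.
    lra.
  rewrite ler_pdivrMr//.
  have B1 : 8 * M * t * nc h <= 8 * M * t * (2 * `|x - y|).
    by rewrite ler_wpM2l// !mulr_ge0// ltW.
  have B2 : 16 * M * t * `|x - y| <= q * theta * `|x - y| by rewrite ler_wpM2r.
  lra.
have g0 : g 0 = k.
  rewrite /g !addr0 subrr cj0 !mulr0 addr0.
  by apply: subr0.
have gsmall x : `|x| <= t -> `|g x| <= (1 - q) * t.
  move=> xt; have -> : g x = (g x - g 0) + k by rewrite g0 subrK.
  rewrite (le_trans (ler_normD _ _))//.
  have := gq x 0 xt; rewrite normr0 subr0 => /(_ (ltW t0)) H.
  have : q * `|x| <= q * t by rewrite ler_wpM2l// ltW.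
  by move: kt; lra.
(* The strict inequality puts the fixed point in the open box, where [UP] applies. *)
have qt : (1 - q) * t < t by rewrite -subr_gt0 mulrBl mul1r opprB addrC subrK mulr_gt0.
have [|x xt|x y xt yt|x xt gx] := @fixpoint_square R t (NngNum (ltW q0)) g (ltW t0).
- by rewrite /=; lra.
- by rewrite (le_trans (gsmall _ _))// ltW.
- exact: gq.
have xlt : `|x| < t by rewrite -gx (le_lt_trans (gsmall _ xt)).
have := UP x xlt; congr U.
rewrite -[RHS]cxK; congr cpair.
have E1 : P * (Phi (cx (m + x)) - w0) + S * cj (Phi (cx (m + x)) - w0) =
          P * (cx u - w0) + S * cj (cx u - w0).
  rewrite -kE -[LHS]cpairK; congr cx.
  move: gx; rewrite /g => /eqP; rewrite addrAC -subr_eq0 addrK subr_eq0 => /eqP ->.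
  by [].
have := rlinear_inv' (Phi (cx (m + x)) - w0) D0.
have := rlinear_inv' (cx u - w0) D0.
rewrite /= -/D -/P -/S E1 => -> /eqP; rewrite subr_eq => /eqP ->.
by rewrite subrK.
Qed.

End real_C11.

(** * The area formula in the plane *)

Section square_area.
Variable R : realType.
Local Notation l2 := (@leb2 R).

(** Half-open, so that a square is the disjoint union of its four halves and every point is counted
    exactly once. *)
Definition hsq (c : R * R) (s : R) : set (R * R)%type :=
  `[c.1, c.1 + s[ `*` `[c.2, c.2 + s[.

Definition mid (c : R * R) (s : R) : R * R := (c.1 + s / 2, c.2 + s / 2).

Lemma measurable_hsq c s : measurable (hsq c s).
Proof. exact: measurableX. Qed.

Lemma leb2_hsq c s : 0 <= s -> l2 (hsq c s) = (s ^+ 2)%:E.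
Proof.
move=> s0; rewrite /leb2 product_measure1E//= /lebR !lebesgue_measure_itv/= !lte_fin.
rewrite !ltrDl; have [s1|] := ltP 0 s.
  by rewrite -!EFinB -EFinM; congr EFin; ring.
by move=> s1; have -> : s = 0 by lra.
Qed.

Lemma hsq_mid c s p : hsq c s p -> `|p - mid c s| <= s / 2.
Proof.
case=> /=; rewrite !in_itv/= => /andP[a1 a2] /andP[b1 b2].
rewrite ge_max/= /mid/= !ler_norml.
by apply/andP; split; apply/andP; split; lra.
Qed.

Lemma mid_hsq c s x : `|x| < s / 2 -> hsq c s (mid c s + x).
Proof.
rewrite gt_max !ltr_norml => /andP[/andP[a1 a2] /andP[b1 b2]].
by split => /=; rewrite in_itv/=; apply/andP; split; lra.
Qed.

Lemma hsqP c s p : hsq c s p <->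
  [/\ c.1 <= p.1, p.1 < c.1 + s, c.2 <= p.2 & p.2 < c.2 + s].
Proof.
rewrite /hsq/= !in_itv/=; split; first by move=> [/andP[? ?] /andP[? ?]].
by move=> [-> -> -> ->].
Qed.

Variables (r M : R) (Phi D1 D2 : R[i] -> R[i]).
Hypothesis HPhi : RC11_with r M Phi D1 D2.
Hypothesis M1 : 1 <= M.

Let M0 : 0 <= M. Proof. by move: M1; lra. Qed.

Definition jac (z : R[i]) : R := nc (D1 z) ^+ 2 - nc (D2 z) ^+ 2.

Definition imsq c s := [set u | exists2 p, hsq c s p & cpair (Phi (cx p)) = u].

Definition in_disc c s := forall x : R * R, `|x| <= s / 2 -> nc (cx (mid c s + x)) <= r.

(** Radial rescaling of [a]. Where the differential is nearly singular, replacing [a] by [a'] makes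
    the gap of moduli exactly [th], so that the upper area estimate applies at the price of an error
    of order [th]. *)
Lemma perturb_modulus (a b : R[i]) (th : R) : `|nc a - nc b| < th ->
  exists2 a' : R[i], nc a' = nc b + th & nc (a - a') <= 2 * th.
Proof.
move=> /[dup] h; rewrite ltr_norml => /andP[h1 h2].
have b0 := nc_ge0 b; have th0 : 0 < th by rewrite (le_lt_trans _ h).
have [a0|a0] := eqVneq a 0.
  exists (nc b + th)%:C; first by rewrite ncR ger0_norm//; lra.
  rewrite a0 sub0r ncN ncR ger0_norm ?addr_ge0//; last lra.
  by move: h1 h2; rewrite a0 nc0; lra.
have na : 0 < nc a by rewrite lt_def nc_eq0 a0 nc_ge0.
exists (a * ((nc b + th) / nc a)%:C).
  rewrite ncM ncR ger0_norm; first by rewrite mulrC divfK ?gt_eqF.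
  by rewrite divr_ge0 ?ltW//; lra.
have -> : a - a * ((nc b + th) / nc a)%:C = a * (1 - (nc b + th) / nc a)%:C.
  by rewrite rmorphB/= mulrBr mulr1.
rewrite ncM ncR -[X in X * _](gtr0_norm na) -normrM mulrBr mulr1 mulrC divfK ?gt_eqF//.
by rewrite ler_norml; apply/andP; split; lra.
Qed.

Lemma jac_le z : nc z <= r -> `|jac z| <= M ^+ 2.
Proof.
move=> zr; have [_ _ _ h1 h2] := HPhi zr zr.
have := lerXn2r 2 (nc_ge0 _) M0 h1; have := lerXn2r 2 (nc_ge0 _) M0 h2.
have := sqr_ge0 (nc (D1 z)); have := sqr_ge0 (nc (D2 z)).
by rewrite /jac ler_norml => *; apply/andP; split; lra.
Qed.

(** If the gap [| |D1| - |D2| |] at the midpoint is at least [th], [leb2_image_ge] and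
    [leb2_image_le] apply to the differential. Otherwise [|jac| <= 2 * M * th] is below [e]: the
    lower bound is trivial, and the upper one comes from a perturbed differential. *)
Lemma square_area (e : R) : 0 < e -> exists2 d : R, 0 < d &
  forall c s, 0 < s -> s <= d -> in_disc c s -> measurable (imsq c s) ->
   (((`|jac (cx (mid c s))| - e) * s ^+ 2)%:E <= l2 (imsq c s))%E /\
   (l2 (imsq c s) <= ((`|jac (cx (mid c s))| + e) * s ^+ 2)%:E)%E.
Proof.
move=> e0.
have MM : 1 <= M ^+ 2 by rewrite expr_ge1.
have M20 : 0 <= M ^+ 2 by lra.
have Mgt : 0 < M by move: M1; lra.
(* In the degenerate case the image area is at most [3 * M * th * (7 * s) ^+ 2], and
   [147 = 3 * 49]. *)
pose th := Num.min 1 (e / (147 * M)).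
have th0 : 0 < th by rewrite lt_min ltr01 divr_gt0//; lra.
have th1 : th <= 1 by rewrite ge_min lexx.
have the : 147 * M * th <= e.
  by rewrite mulrC -ler_pdivlMr ?ge_min ?lexx ?orbT//; lra.
(* The bound for [s / th]. It makes the contraction factor [8 * M * (s / th)] at most [1 / 2], and
   that factor times [4 * M ^+ 2] at most [e]. *)
pose k := Num.min 1 e / (32 * M ^+ 3).
have k0 : 0 < k by rewrite divr_gt0 ?lt_min ?ltr01// mulr_gt0// exprn_gt0.
have k1 : 32 * M ^+ 3 * k <= 1.
  by rewrite /k mulrC divfK ?ge_min ?lexx// gt_eqF// mulr_gt0// exprn_gt0.
have ke : 32 * M ^+ 3 * k <= e.
  by rewrite /k mulrC divfK ?ge_min ?lexx ?orbT// gt_eqF// mulr_gt0// exprn_gt0.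
have M3 : M ^+ 3 = M * M ^+ 2 by rewrite exprS.
have Mk0 : 0 <= M * k by rewrite mulr_ge0// ltW.
have Mk1 : M * k <= M ^+ 3 * k.
  by rewrite ler_pM2r// M3 ler_peMr//.
exists (th * k); first exact: mulr_gt0.
move=> c s s0 sd hc mU.
set m := mid c s; set z0 := cx m.
have s2 : 0 < s ^+ 2 by rewrite exprn_gt0.
have hs2 : 0 <= s / 2 by lra.
have hMs : 0 <= M * s ^+ 2 by rewrite mulr_ge0// ltW.
have hths : 0 <= 3 * th * s by rewrite mulr_ge0 ?mulr_ge0// ltW.
have sthk : s / th <= k by rewrite ler_pdivrMr// mulrC.
have sth0 : 0 <= s / th by rewrite divr_ge0// ltW.
have sthE : s / th * th = s by rewrite divfK// gt_eqF.
have Msth : M * (s / th) <= M * k by rewrite ler_wpM2l.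
have m_r : nc z0 <= r by have := hc 0; rewrite addr0 normr0; apply; lra.
have J_M := jac_le m_r.
have U_lin u : imsq c s u -> exists2 h : R * R, `|h| <= s / 2 &
    nc (cx u - Phi z0 - (D1 z0 * cx h + D2 z0 * cj (cx h))) <= M * s ^+ 2 /\ nc (cx h) <= s.
  move=> [p Qp <-]; rewrite cpairK; exists (p - m); first exact: hsq_mid.
  have hn : nc (cx (p - m)) <= s by rewrite (le_trans (nc_cx _))//; have := hsq_mid Qp; rewrite -/m; lra.
  have pr : nc (cx p) <= r by have := hc _ (hsq_mid Qp); rewrite addrC subrK.
  split=> //; have [H _ _ _ _] := HPhi pr m_r.
  rewrite cxB -/z0 in hn *.
  apply: le_trans H _; apply: ler_wpM2l => //.
  by apply: lerXn2r; rewrite ?nnegrE ?nc_ge0// ltW.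
have [nd|dg] := leP th `|nc (D1 z0) - nc (D2 z0)|.
  split.
    (* With this [q], the condition [16 * M * t <= q * theta] is an equality at [t = s / 2] and
       [theta = th]. *)
    have q0 : 0 < 8 * (M * (s / th)).
      by rewrite mulr_gt0// mulr_gt0// divr_gt0.
    have qe : 8 * (M * (s / th)) * (4 * M ^+ 2) <= e.
      apply: le_trans ke; rewrite M3.
      have := ler_wpM2r M20 Msth; lra.
    have q2 : 2 * (8 * (M * (s / th))) <= 1 by lra.
    have := @leb2_image_ge R r M Phi D1 D2 m (s / 2) th (8 * (M * (s / th))) (imsq c s)
      HPhi M0 _ th0 nd hc q0 q2 _ mU.
    rewrite divr_gt0// => /(_ isT) H.
    apply: le_trans (H _ _).
    + rewrite lee_fin -/(jac z0).
      set q := 8 * _ in q0 qe q2 *.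
      have -> : 2 * ((1 - 2 * q) * (s / 2)) = (1 - 2 * q) * s by field.
      rewrite exprMn [leRHS]mulrA ler_pM2r//.
      have J0 : 0 <= `|jac z0| by [].
      have : `|jac z0| * q <= M ^+ 2 * q by rewrite ler_wpM2r// ltW.
      have : 0 <= `|jac z0| * q ^+ 2 by rewrite mulr_ge0// sqr_ge0.
      by lra.
    + by have := sthE; set u := s / th; move=> <-; lra.
    + by move=> x xs; exists (m + x) => //; exact: mid_hsq.
  have := @leb2_image_le R _ _ th th0 nd (imsq c s) (Phi z0) (s / 2) (M * s ^+ 2) mU.
  move=> /(_ hs2 hMs) H.
  apply: le_trans (H _) _.
    by move=> u /U_lin[h hs [hu _]]; exists h.
  rewrite lee_fin -/(jac z0).
  have -> : 2 * (s / 2 + M * s ^+ 2 / th) = (1 + 2 * (M * (s / th))) * s by rewrite expr2; field; exact: lt0r_neq0.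
  rewrite exprMn [leLHS]mulrA ler_pM2r//.
  set x := M * (s / th) in Msth *.
  have x0 : 0 <= x by rewrite mulr_ge0.
  have x1 : x <= 1 by lra.
  have xx : x ^+ 2 <= x by rewrite expr2 ler_piMr.
  have J0 : 0 <= `|jac z0| by [].
  have A1 : `|jac z0| * x ^+ 2 <= `|jac z0| * x by rewrite ler_wpM2l.
  have A2 : `|jac z0| * x <= M ^+ 2 * x by rewrite ler_wpM2r.
  have A3 : 32 * (M ^+ 2 * x) <= e.
    apply: le_trans ke; rewrite M3.
    have := ler_wpM2r M20 Msth; lra.
  by lra.
(* The nearly singular case. *)
have [a' na' aa'] := perturb_modulus dg.
have [_ _ _ d1M d2M] := HPhi m_r m_r.
split.
  apply: (@le_trans _ _ 0%E) => //; rewrite lee_fin.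
  rewrite nmulr_rle0// ?ltW//.
  have -> : `|jac z0| = `|nc (D1 z0) - nc (D2 z0)| * (nc (D1 z0) + nc (D2 z0)).
    by rewrite /jac subr_sqr normrM [X in _ * X]ger0_norm// addr_ge0// nc_ge0.
  have : `|nc (D1 z0) - nc (D2 z0)| * (nc (D1 z0) + nc (D2 z0)) <= th * (2 * M).
    by rewrite ler_pM ?addr_ge0 ?nc_ge0//; lra.
  have : 0 < M * th by rewrite mulr_gt0.
  lra.
have nd' : th <= `|nc a' - nc (D2 z0)| by rewrite na' addrAC subrr add0r gtr0_norm.
(* The error [3 * th * s] is [2 * th * s] for replacing [D1 z0] by [a'], plus the Taylor remainder
   [M * s ^+ 2 <= th * s]. *)
have := @leb2_image_le R _ _ th th0 nd' (imsq c s) (Phi z0) (s / 2) (3 * th * s) mU.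
move=> /(_ hs2 hths) H.
apply: le_trans (H _) _.
  move=> u /U_lin[h hs [hu hns]]; exists h => //.
  have -> : cx u - Phi z0 - (a' * cx h + D2 z0 * cj (cx h)) =
    (cx u - Phi z0 - (D1 z0 * cx h + D2 z0 * cj (cx h))) + (D1 z0 - a') * cx h by ring.
  rewrite (le_trans (ncD _ _))// ncM.
  have : nc (D1 z0 - a') * nc (cx h) <= 2 * th * s.
    by rewrite ler_pM ?nc_ge0.
  have : M * s ^+ 2 <= th * s.
    rewrite expr2 mulrA ler_pM2r// -[in leLHS]sthE mulrA -[leRHS]mul1r ler_pM2r//.
    lra.
  lra.
rewrite lee_fin na'.
have -> : 2 * (s / 2 + 3 * th * s / th) = 7 * s by field; exact: lt0r_neq0.
rewrite exprMn [leLHS]mulrA ler_pM2r//.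
have b0 := nc_ge0 (D2 z0).
have -> : (nc (D2 z0) + th) ^+ 2 - nc (D2 z0) ^+ 2 = th * (2 * nc (D2 z0) + th) by ring.
rewrite ger0_norm; last by rewrite mulr_ge0 ?addr_ge0 ?mulr_ge0// ltW.
have : th * (2 * nc (D2 z0) + th) <= th * (3 * M).
  by rewrite ler_pM2l//; move: M1; lra.
have : 0 <= `|jac z0| by [].
by rewrite [7 ^+ 2]expr2; lra.
Qed.

End square_area.

(** * Measurability of the event that a square contains a zero *)

Section zero_set_measurable.
Variables (R : realType) (d : measure_display) (W : measurableType d).
Variable phi : W -> R * R -> R.
Hypothesis mphi : forall p, measurable_fun setT (phi ^~ p).
Hypothesis phi0 : forall w p, 0 <= phi w p.

Definition box (c : R * R) (s : R) : set (R * R)%type :=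
  `[c.1, c.1 + s] `*` `[c.2, c.2 + s].

Let grid (c : R * R) (s : R) (i j l : nat) : R * R :=
  (c.1 + s * (i%:R / j.+1%:R), c.2 + s * (l%:R / j.+1%:R)).

Lemma boxP c s p : box c s p <->
  [/\ c.1 <= p.1, p.1 <= c.1 + s, c.2 <= p.2 & p.2 <= c.2 + s].
Proof.
rewrite /box/= !in_itv/=; split; first by move=> [/andP[? ?] /andP[? ?]].
by move=> [-> -> -> ->].
Qed.

Let grid_approx (c : R * R) (s e : R) p : 0 <= s -> 0 < e -> box c s p ->
  exists i j l, [/\ (i <= j.+1)%N, (l <= j.+1)%N & `|p - grid c s i j l| <= e].
Proof.
move=> s0 e0 /boxP[a1 a2 b1 b2].
have [s00|sn0] := eqVneq s 0.
  exists 0%N, 0%N, 0%N; split => //.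
  by rewrite /grid s00 !mul0r ge_max/= !ler_norml; apply/andP; split; apply/andP; split; lra.
have sp : 0 < s by rewrite lt_def sn0.
pose j := Num.truncn (s / e).
have jb : s / e < j.+1%:R by exact: truncnS_gt.
have je : s / j.+1%:R <= e.
  by rewrite ler_pdivrMr// mulrC -ler_pdivrMr// ltW.
have ap (x y : R) : x <= y -> y <= x + s ->
    exists2 i, (i <= j.+1)%N & `|y - (x + s * (i%:R / j.+1%:R))| <= e.
  move=> xy yx; pose u := (y - x) / s * j.+1%:R.
  have u0 : 0 <= u by rewrite /u !mulr_ge0// ?invr_ge0// subr_ge0.
  have uj : u <= j.+1%:R.
    by rewrite -[leRHS]mul1r ler_wpM2r// ler_pdivrMr// mul1r; lra.
  exists (Num.truncn u).
    by rewrite -(ler_nat R) (le_trans _ uj)// truncn_le.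
  have /andP[t1 t2] := truncn_itv u0.
  have yE : y = x + s * (u / j.+1%:R) by rewrite /u mulfK// mulrCA divff// mulr1 addrC subrK.
  rewrite [in X in `|X|]yE opprD addrACA subrr add0r -mulrBr -mulrBl.
  rewrite normrM gtr0_norm// normrM [X in _ * (_ * X)]gtr0_norm ?invr_gt0//.
  rewrite (le_trans _ je)// mulrCA ger0_norm ?subr_ge0//.
  by rewrite ler_piMl ?divr_ge0//; rewrite -natr1 in t2; lra.
have [i ij Hi] := ap _ _ a1 a2; have [l lj Hl] := ap _ _ b1 b2.
by exists i, j, l; split => //; rewrite ge_max Hi.
Qed.

Let grid_box c s i j l : 0 <= s -> (i <= j.+1)%N -> (l <= j.+1)%N ->
  box c s (grid c s i j l).
Proof.
move=> s0 ij lj; apply/boxP; rewrite /grid/= !lerDl !mulr_ge0//; split => //.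
  by rewrite lerD2l ler_piMr// ler_pdivrMr// mul1r ler_nat.
by rewrite lerD2l ler_piMr// ler_pdivrMr// mul1r ler_nat.
Qed.

(** A zero exists in the closed box if and only if the values at grid points come below every
    [1 / (k + 1)]: one direction uses the Lipschitz bound, the other the positive minimum on a
    compact box. The latter condition involves only countably many points. *)
Lemma box_zero_measurable (c : R * R) (s : R) : 0 <= s ->
  (forall w, exists L, forall p q, box c s p -> box c s q ->
     `|phi w p - phi w q| <= L * `|p - q|) ->
  measurable [set w | exists2 p, box c s p & phi w p = 0].
Proof.
move=> s0 HL.
rewrite (_ : [set w | _] = \bigcap_k \bigcup_j \bigcup_(i in [set i | (i <= j.+1)%N])
   \bigcup_(l in [set l | (l <= j.+1)%N]) [set w | phi w (grid c s i j l) < k.+1%:R^-1]).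
  apply: bigcap_measurableType => k _; apply: bigcup_measurable => j _.
  apply: bigcup_measurable => i _; apply: bigcup_measurable => l _.
  rewrite -(setTI [set w | _]) -[X in _ `&` X]/(phi ^~ (grid c s i j l) @^-1` [set x | x < k.+1%:R^-1]).
  apply: mphi => //.
  rewrite (_ : [set x | _] = `]-oo, k.+1%:R^-1[%classic)//.
apply/seteqP; split => w /=.
  move=> [p pb p0] k _.
  have [L HLw] := HL w.
  pose L' := Num.max L 1.
  have L'0 : 0 < L' by rewrite lt_max ltr01 orbT.
  have e0 : 0 < (L' * (k.+2)%:R)^-1 by rewrite invr_gt0 mulr_gt0.
  have [i [j [l [ij lj pg]]]] := grid_approx s0 e0 pb.
  exists j => //; exists i => //; exists l => //=.
  have := HLw _ _ pb (grid_box c s0 ij lj).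
  rewrite p0 sub0r normrN ger0_norm// => /le_lt_trans; apply.
  apply: (@le_lt_trans _ _ (k.+2%:R^-1)).
    apply: (@le_trans _ _ (L' * `|p - grid c s i j l|)).
      by rewrite ler_wpM2r// le_max lexx.
    by rewrite -ler_pdivlMl// -invfM.
  by rewrite ltf_pV2 ?posrE// ltr_nat.
move=> H.
have [L HLw] := HL w.
have cb : compact (box c s) by apply: compact_setX; exact: segment_compact.
have b0 : box c s !=set0.
  by exists c; apply/boxP; rewrite !lerDl.
have cf : {within box c s, continuous (phi w)}.
  apply/subspace_continuousP => x bx.
  apply/cvgrPdist_le => e e0; rewrite near_withinE.
  pose L' := Num.max L 1.
  have L'0 : 0 < L' by rewrite lt_max ltr01 orbT.
  near=> y => yb.
  apply: (le_trans (HLw _ _ bx yb)).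
  apply: (@le_trans _ _ (L' * `|x - y|)).
    by rewrite ler_wpM2r// le_max lexx.
  rewrite -ler_pdivlMl// mulrC.
  near: y; apply: cvgr_dist_le; first exact: cvg_id.
  by rewrite divr_gt0.
have [p pb pmin] := compact_EVT_min b0 cb cf.
exists p; first by move: pb; rewrite inE.
apply/eqP; rewrite eq_le phi0 andbT leNgt; apply/negP => pp.
pose k := Num.truncn (phi w p)^-1.
have kp : k.+1%:R^-1 < phi w p.
  by rewrite invf_plt ?posrE// truncnS_gt.
have [j _ [i /= ij [l /= lj]]] := H k I.
apply/negP; rewrite -leNgt (le_trans (ltW kp))// pmin// inE.
exact: grid_box.
Unshelve. all: by end_near. Qed.

(** The half-open square is the union of the closed boxes of side [s * (1 - 1 / (j + 1))] with the
    same corner. *)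
Lemma hsq_zero_measurable (c : R * R) (s : R) : 0 < s ->
  (forall w, exists L, forall p q, box c s p -> box c s q ->
     `|phi w p - phi w q| <= L * `|p - q|) ->
  measurable [set w | exists2 p, hsq c s p & phi w p = 0].
Proof.
move=> s0 HL.
have sj j : 0 <= s * (1 - j.+1%:R^-1).
  by rewrite mulr_ge0 ?(ltW s0)// subr_ge0 invf_le1// ler1n.
have sj1 j : s * (1 - j.+1%:R^-1) < s.
  by rewrite -subr_gt0 mulrBr mulr1 opprB addrC subrK divr_gt0.
rewrite (_ : [set w | _] = \bigcup_j [set w | exists2 p, box c (s * (1 - j.+1%:R^-1)) p & phi w p = 0]).
  apply: bigcup_measurable => j _; apply: box_zero_measurable => // w.
  have [L HLw] := HL w; exists L => p q /boxP[p1 p2 p3 p4] /boxP[q1 q2 q3 q4].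
  have := sj1 j => sj1j.
  by apply: HLw; apply/boxP; split => //; move: sj1j; set u := s * _ => ?; move: p2 p4 q2 q4; rewrite -/u; lra.
apply/seteqP; split => w /=.
  move=> [p /hsqP[p1 p2 p3 p4] p0].
  pose e := Num.min (c.1 + s - p.1) (c.2 + s - p.2) / s.
  have e0 : 0 < e by rewrite divr_gt0// lt_min !subr_gt0 p2.
  pose j := Num.truncn e^-1.
  have je : j.+1%:R^-1 < e by rewrite invf_plt ?posrE// truncnS_gt.
  have jes : s * j.+1%:R^-1 < Num.min (c.1 + s - p.1) (c.2 + s - p.2).
    by move: je; rewrite /e ltr_pdivlMr// mulrC.
  move: jes; rewrite lt_min => /andP[j1 j2].
  by exists j => //; exists p => //; apply/boxP; rewrite mulrBr mulr1; split => //; move: j1 j2; set u := s * _ => *; lra.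
move=> [j _ [p /boxP[p1 p2 p3 p4] p0]]; exists p => //; apply/hsqP.
by have := sj1 j; move: p2 p4; set u := s * _ => *; split => //; lra.
Qed.

End zero_set_measurable.

Section square_integral.
Variable R : realType.
Local Notation l2 := (@leb2 R).

Lemma integral_le_cst (S : set (R * R)%type) (g : R * R -> R) (b v : R) :
  measurable S -> measurable_fun setT g -> (forall p, 0 <= g p) -> 0 <= b ->
  (forall p, S p -> g p <= b) -> (l2 S <= v%:E)%E ->
  (\int[l2]_(p in S) (g p)%:E <= (b * v)%:E)%E.
Proof.
move=> mS mg g0 b0 gb Sv.
apply: (@le_trans _ _ (\int[l2]_(p in S) (cst b%:E p))%E).
  apply: ge0_le_integral => //.
  - by move=> p _; rewrite lee_fin.
  - by apply/measurable_EFinP; exact: measurable_funTS.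
by rewrite (integral_cst l2 mS) EFinM lee_wpmul2l// lee_fin.
Qed.

Lemma integral_ge_cst (S : set (R * R)%type) (g : R * R -> R) (a v : R) :
  measurable S -> measurable_fun setT g -> (forall p, 0 <= g p) ->
  (forall p, S p -> a <= g p) -> 0 <= v -> (v%:E <= l2 S)%E ->
  ((a * v)%:E <= \int[l2]_(p in S) (g p)%:E)%E.
Proof.
move=> mS mg g0 ga v0 Sv.
have i0 : (0 <= \int[l2]_(p in S) (g p)%:E)%E.
  by apply: integral_ge0 => p _; rewrite lee_fin.
have [a0|a0] := leP a 0.
  by apply: le_trans i0; rewrite lee_fin mulr_le0_ge0.
apply: (@le_trans _ _ (\int[l2]_(p in S) (cst a%:E p))%E).
  by rewrite (integral_cst l2 mS) EFinM lee_wpmul2l// lee_fin ltW.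
apply: ge0_le_integral => //.
- by move=> p _; rewrite lee_fin ltW.
- by apply/measurable_EFinP; exact: measurable_funTS.
Qed.

Variables (r M : R) (Phi D1 D2 : R[i] -> R[i]).
Hypothesis HPhi : RC11_with r M Phi D1 D2.
Hypothesis M1 : 1 <= M.
Variables (f : R * R -> R) (K : R).
Hypotheses (mf : measurable_fun setT f) (f0 : forall u, 0 <= f u)
  (f1 : forall u, f u <= 1) (K0 : 0 <= K)
  (fL : forall u v, `|f u - f v| <= K * nc (cx u - cx v)).

Definition jacf (p : R * R) : R := `|jac D1 D2 (cx p)| * f (cpair (Phi (cx p))).
Hypothesis mjacf : measurable_fun setT jacf.

Let M0 : 0 <= M. Proof. by move: M1; lra. Qed.

Let jacf_ge0 p : 0 <= jacf p. Proof. by rewrite mulr_ge0. Qed.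

(** On a small square, [|jac|] and [f] along [Phi] are nearly constant, so both integrals are close
    to [Jm * fm * s ^+ 2]. The errors are proportional to the area [s ^+ 2], which lets them be
    summed over a tiling. *)
Lemma square_integral (e : R) : 0 < e -> exists2 d : R, 0 < d &
  forall c s, 0 < s -> s <= d -> in_disc r c s -> measurable (imsq Phi c s) ->
   ((\int[l2]_(u in imsq Phi c s) (f u)%:E <=
       \int[l2]_(p in hsq c s) (jacf p)%:E + (e * s ^+ 2)%:E)%E /\
    (\int[l2]_(p in hsq c s) (jacf p)%:E <=
       \int[l2]_(u in imsq Phi c s) (f u)%:E + (e * s ^+ 2)%:E)%E).
Proof.
move=> e0.
pose B := M ^+ 2.
have B1 : 1 <= B by rewrite expr_ge1.
pose e1 := Num.min 1 (e / 2).
have e10 : 0 < e1 by rewrite lt_min ltr01/= divr_gt0.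
have e11 : e1 <= 1 by rewrite ge_min lexx.
have e1e : e1 <= e / 2 by rewrite ge_min lexx orbT.
(* [e2] bounds the oscillation of [f] along [Phi] and of [|jac|], and [e1] the relative error of the
   image area; the losses add up to at most [e1 + e2 * (2 * B + 2) <= e]. *)
pose e2 := e / (2 * (2 * B + 2)).
have e20 : 0 < e2 by rewrite divr_gt0//; lra.
have e2e : e2 * (2 * B + 2) = e / 2 by rewrite /e2; field; lra.
have [d d0 Hd] := square_area HPhi M1 e10.
pose A := (K * (3 * M) + 4 * B + 1).
have KM : 0 <= K * (3 * M) by rewrite mulr_ge0// mulr_ge0.
have A0 : 0 < A by rewrite /A; lra.
exists (Num.min (Num.min 1 d) (e2 / A)).
  by rewrite !lt_min ltr01 d0 divr_gt0.
move=> c s s0; rewrite !le_min => /andP[/andP[s1 sd] sA] hc mU.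
have {}sA : A * s <= e2 by rewrite mulrC -ler_pdivlMr.
have [areal areau] := Hd c s s0 sd hc mU.
set m := mid c s in areal areau.
have m_r : nc (cx m) <= r by have := hc 0; rewrite addr0 normr0; apply; lra.
have s2 : 0 < s ^+ 2 by rewrite exprn_gt0.
have ptQ p : hsq c s p -> nc (cx p) <= r /\ nc (cx p - cx m) <= s.
  move=> Qp; split; first by have := hc _ (hsq_mid Qp); rewrite addrC subrK.
  by rewrite -cxB (le_trans (nc_cx _))//; have := hsq_mid Qp; rewrite -/m; lra.
have PhiL p : hsq c s p -> nc (Phi (cx p) - Phi (cx m)) <= 3 * M * s.
  move=> /ptQ[pr ps]; have [H _ _ h1 h2] := HPhi pr m_r.
  have -> : Phi (cx p) - Phi (cx m) = (Phi (cx p) - Phi (cx m) -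
     (D1 (cx m) * (cx p - cx m) + D2 (cx m) * cj (cx p - cx m))) +
     (D1 (cx m) * (cx p - cx m) + D2 (cx m) * cj (cx p - cx m)) by ring.
  rewrite (le_trans (ncD _ _))// (le_trans (lerD H (ncD _ _)))// !ncM ncJ.
  have n0 := nc_ge0 (cx p - cx m).
  have q1 : nc (cx p - cx m) ^+ 2 <= s.
    have : nc (cx p - cx m) ^+ 2 <= 1 * s by rewrite expr2 ler_pM//; lra.
    lra.
  have := ler_wpM2l M0 q1.
  have := ler_pM (nc_ge0 _) n0 h1 ps; have := ler_pM (nc_ge0 _) n0 h2 ps.
  lra.
pose Jm := `|jac D1 D2 (cx m)|; pose fm := f (cpair (Phi (cx m))).
have Jm0 : 0 <= Jm by exact: normr_ge0.
have JmB : Jm <= B by exact: (jac_le HPhi M1).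
have fm0 : 0 <= fm by exact: f0.
have fm1 : fm <= 1 by exact: f1.
have As1 : K * (3 * M) * s <= e2.
  by apply: le_trans sA; rewrite ler_pM2r// /A; lra.
have As2 : 4 * B * s <= e2.
  by apply: le_trans sA; rewrite ler_pM2r// /A; lra.
have fQ p : hsq c s p -> `|f (cpair (Phi (cx p))) - fm| <= e2.
  move=> Qp; rewrite (le_trans (fL _ _))// !cpairK.
  by have := ler_wpM2l K0 (PhiL _ Qp); lra.
have JQ p : hsq c s p -> `| `|jac D1 D2 (cx p)| - Jm | <= e2.
  move=> Qp; have [pr ps] := ptQ _ Qp.
  apply: le_trans (ler_dist_dist _ _) _.
  have [_ h1 h2 h3 h4] := HPhi pr m_r; have [_ _ _ h5 h6] := HPhi m_r pr.
  have sqd (x y : R[i]) : nc x <= M -> nc y <= M -> nc (x - y) <= M * nc (cx p - cx m) ->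
      `|nc x ^+ 2 - nc y ^+ 2| <= 2 * B * s.
    move=> xM yM xy; rewrite subr_sqr normrM [X in _ * X]ger0_norm ?addr_ge0 ?nc_ge0//.
    have nd : `|nc x - nc y| <= M * s.
      apply: (@le_trans _ _ (nc (x - y))); last first.
        by rewrite (le_trans xy)// ler_wpM2l.
      have xE : x = (x - y) + y by ring.
      have yE : y = (y - x) + x by ring.
      have := ncD (x - y) y; rewrite -xE; have := ncD (y - x) x; rewrite -yE (ncC y x).
      by move=> *; rewrite ler_norml; apply/andP; split; lra.
    have := ler_pM (normr_ge0 _) (addr_ge0 (nc_ge0 x) (nc_ge0 y)) nd (lerD xM yM).
    by rewrite /B; lra.
  have a1 := sqd _ _ h5 h3 h1; have a2 := sqd _ _ h6 h4 h2.
  rewrite /jac.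
  set x1 := nc _ ^+ 2 in a1 *; set x2 := nc _ ^+ 2 in a1 *.
  set y1 := nc _ ^+ 2 in a2 *; set y2 := nc _ ^+ 2 in a2 *.
  have -> : x1 - y1 - (x2 - y2) = (x1 - x2) - (y1 - y2) by ring.
  by apply: le_trans (ler_normB _ _) _; lra.
have FQ p : hsq c s p -> `|jacf p - Jm * fm| <= e2 * (1 + B).
  move=> Qp; rewrite /jacf.
  set J := `|jac D1 D2 (cx p)|; set g := f (cpair (Phi (cx p))).
  have -> : J * g - Jm * fm = (J - Jm) * g + Jm * (g - fm) by ring.
  rewrite (le_trans (ler_normD _ _))// !normrM.
  have g0 : `|g| <= 1 by rewrite ger0_norm ?f1 ?f0.
  have JJ : `|Jm| <= B by rewrite ger0_norm.
  have := ler_pM (normr_ge0 _) (normr_ge0 _) (JQ _ Qp) g0.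
  have := ler_pM (normr_ge0 _) (normr_ge0 _) JJ (fQ _ Qp).
  lra.
have fU u : imsq Phi c s u -> `|f u - fm| <= e2 by move=> [p Qp <-]; exact: fQ.
have hs : l2 (hsq c s) = (s ^+ 2)%:E by rewrite leb2_hsq// ltW.
have mQ : measurable (hsq c s) by exact: measurable_hsq.
have Jf0 : 0 <= Jm * fm by rewrite mulr_ge0.
have eB : 0 <= e2 * (1 + B) by rewrite mulr_ge0// ?ltW//; lra.
have up1 : (\int[l2]_(u in imsq Phi c s) (f u)%:E <= ((fm + e2) * ((Jm + e1) * s ^+ 2))%:E)%E.
  apply: integral_le_cst => //; first lra.
  by move=> u /fU; rewrite ler_norml => /andP[_]; lra.
have lo1 : (((Jm * fm - e2 * (1 + B)) * s ^+ 2)%:E <= \int[l2]_(p in hsq c s) (jacf p)%:E)%E.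
  apply: integral_ge_cst => //; rewrite ?hs ?(ltW s2)//.
  by move=> p /FQ; rewrite ler_norml => /andP[+ _]; lra.
have up2 : (\int[l2]_(p in hsq c s) (jacf p)%:E <= ((Jm * fm + e2 * (1 + B)) * s ^+ 2)%:E)%E.
  apply: integral_le_cst => //; rewrite ?hs//; first lra.
  by move=> p /FQ; rewrite ler_norml => /andP[_]; lra.
have fe1 : fm * e1 <= e1 by rewrite ler_piMl// ltW.
have eJ : e2 * Jm <= e2 * B by rewrite ler_pM2l.
have ee : e2 * e1 <= e2 by rewrite ler_piMr// ltW.
split.
  apply: le_trans up1 _; apply: (@le_trans _ _ (((Jm * fm - e2 * (1 + B)) * s ^+ 2)%:E + (e * s ^+ 2)%:E)%E).
    by rewrite -EFinD lee_fin -mulrDl mulrA ler_pM2r//; lra.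
  by rewrite leeD2r.
apply: le_trans up2 _.
have i0 : (0 <= \int[l2]_(u in imsq Phi c s) (f u)%:E)%E.
  by apply: integral_ge0 => u _; rewrite lee_fin.
(* When [fm <= e2] or [Jm <= e1], the product [(fm - e2) * (Jm - e1)] is useless as a lower bound,
   but then the integral of [jacf] is itself below [e * s ^+ 2]. *)
have [fe|fe] := leP fm e2.
  apply: (@le_trans _ _ (0 + (e * s ^+ 2)%:E)%E); last by rewrite leeD2r.
  rewrite add0e lee_fin ler_pM2r//.
  have : Jm * fm <= B * e2 by rewrite ler_pM.
  lra.
have [Je|Je] := leP Jm e1.
  apply: (@le_trans _ _ (0 + (e * s ^+ 2)%:E)%E); last by rewrite leeD2r.
  rewrite add0e lee_fin ler_pM2r//.
  have : Jm * fm <= e1 * 1 by rewrite ler_pM.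
  have : 0 <= e2 * B by rewrite mulr_ge0 ?ltW//; lra.
  lra.
have lo2 : (((fm - e2) * ((Jm - e1) * s ^+ 2))%:E <= \int[l2]_(u in imsq Phi c s) (f u)%:E)%E.
  apply: integral_ge_cst => //.
    by move=> u /fU; rewrite ler_norml => /andP[+ _]; lra.
  by rewrite mulr_ge0 ?(ltW s2)//; lra.
apply: (@le_trans _ _ (((fm - e2) * ((Jm - e1) * s ^+ 2))%:E + (e * s ^+ 2)%:E)%E); last by rewrite leeD2r.
rewrite -EFinD lee_fin [X in _ <= X + _]mulrA -mulrDl ler_pM2r//.
have : 0 <= e1 * e2 by rewrite mulr_ge0// ltW.
lra.
Qed.

End square_integral.

(** * Counting points by occupied dyadic squares *)

Section dyadic.
Variable R : realType.

Local Notation cE c s := ((c.1 + s / 2)%R, c.2).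
Local Notation cN c s := (c.1, (c.2 + s / 2)%R).
Local Notation cNE c s := ((c.1 + s / 2)%R, (c.2 + s / 2)%R).
Implicit Types (c p q : R * R) (s : R).

(* Sum of [g] over the [4 ^ k] squares of side [s / 2 ^ k] tiling [hsq c s]. *)
Fixpoint sumsq (A : nmodType) (g : R * R -> R -> A) (k : nat) (c : R * R) (s : R) : A :=
  if k is k'.+1 then
    sumsq g k' c (s / 2)%R + sumsq g k' (cE c s) (s / 2)%R +
    (sumsq g k' (cN c s) (s / 2)%R +
     sumsq g k' (cNE c s) (s / 2)%R)
  else g c s.

Lemma hsq4 c s p : 0 < s -> hsq c s p <->
  [\/ hsq c (s / 2)%R p, hsq (cE c s) (s / 2)%R p,
      hsq (cN c s) (s / 2)%R p | hsq (cNE c s) (s / 2)%R p].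
Proof.
move=> s0; split.
  move=> /hsqP[p1 p2 p3 p4].
  have [h1|h1] := ltP p.1 (c.1 + s / 2); have [h2|h2] := ltP p.2 (c.2 + s / 2).
  - by apply: Or41; apply/hsqP; split.
  - by apply: Or43; apply/hsqP; split => //=; lra.
  - by apply: Or42; apply/hsqP; split => //=; lra.
  - by apply: Or44; apply/hsqP; split => //=; lra.
by case=> /hsqP/= [p1 p2 p3 p4]; apply/hsqP; split; lra.
Qed.

Section count.
Variable Z : set (R * R)%type.

Definition occ (c : R * R) (s : R) : nat := `[< exists2 p, hsq c s p & Z p >].

Lemma occ4 c s : 0 < s ->
  (occ c s <= occ c (s / 2)%R + occ (cE c s) (s / 2)%R +
    (occ (cN c s) (s / 2)%R + occ (cNE c s) (s / 2)%R))%N.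
Proof.
move=> s0; rewrite {1}/occ; case: asboolP => // -[p /(hsq4 _ _ s0) ps Zp].
have F (c' : R * R) (s' : R) : hsq c' s' p -> occ c' s' = 1%N.
  by move=> h; rewrite /occ; case: asboolP => // H; exfalso; apply: H; exists p.
by case: ps => /F ->; lia.
Qed.

Lemma sumsq_occ_nd c s k : 0 < s ->
  (sumsq occ k c s <= sumsq occ k.+1 c s)%N.
Proof.
elim: k c s => [|k IH] c s s0; first exact: occ4.
have s20 : 0 < s / 2 by rewrite divr_gt0.
rewrite [leqLHS]/= [leqRHS]/=.
by rewrite !leq_add//; exact: IH.
Qed.

Definition cnt (X : seq (R * R)) (c : R * R) (s : R) : nat :=
  count (fun p => `[< hsq c s p >]) X.

Lemma cnt4 X c s : 0 < s -> cnt X c s = (cnt X c (s / 2)%R + cnt X (cE c s) (s / 2)%R +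
    (cnt X (cN c s) (s / 2)%R + cnt X (cNE c s) (s / 2)%R))%N.
Proof.
move=> s0; rewrite /cnt; elim: X => [//|p X IH]; rewrite /= IH {IH}.
set n1 := count _ X; set n2 := count _ X; set n3 := count _ X; set n4 := count _ X.
suff -> : (`[< hsq c s p >] = `[< hsq c (s / 2)%R p >] + `[< hsq (cE c s) (s / 2)%R p >] +
   (`[< hsq (cN c s) (s / 2)%R p >] + `[< hsq (cNE c s) (s / 2)%R p >]) :> nat)%N.
  by ring.
have [ps|ps] := pselect (hsq c s p); last first.
  have F c' s' : (hsq c' s' p -> hsq c s p) -> `[< hsq c' s' p >] = false.
    by move=> h; apply/asboolP => /h.
  rewrite (asboolF ps) !F//= => h; apply/(hsq4 _ _ s0).
  - exact: Or44. - exact: Or43. - exact: Or42. - exact: Or41.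
rewrite (asboolT ps).
have E c' s' : `[< hsq c' s' p >] =
  [&& c'.1 <= p.1, p.1 < c'.1 + s', c'.2 <= p.2 & p.2 < c'.2 + s'].
  by apply/asboolP/and4P => /hsqP.
move/hsqP : ps => [p1 p2 p3 p4].
have k1 : c.1 + s / 2 + s / 2 = c.1 + s by rewrite -addrA -splitr.
have k2 : c.2 + s / 2 + s / 2 = c.2 + s by rewrite -addrA -splitr.
rewrite !E /= k1 k2 p1 p2 p3 p4 /= !andbT.
have [h1|h1] := ltP p.1 (c.1 + s / 2); have [h2|h2] := ltP p.2 (c.2 + s / 2);
rewrite ?andbF//=.
all: rewrite ?(le_trans p3)// ?(le_trans p1)//.
Qed.

Lemma sumsq_cnt X k c s : 0 < s -> sumsq (cnt X) k c s = cnt X c s.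
Proof.
elim: k c s => [//|k IH] c s s0; rewrite /= !IH ?divr_gt0//.
exact/esym/cnt4.
Qed.

Lemma sumsq_le (g g' : R * R -> R -> nat) k c s :
  (forall c', g c' (s / 2 ^+ k) <= g' c' (s / 2 ^+ k))%N ->
  (sumsq g k c s <= sumsq g' k c s)%N.
Proof.
elim: k c s => [|k IH] c s H /=; first by have := H c; rewrite expr0 divr1.
have IH' c' : (sumsq g k c' (s / 2)%R <= sumsq g' k c' (s / 2)%R)%N.
  by apply: IH => c''; rewrite -mulrA -invfM -exprS.
by rewrite !leq_add.
Qed.

Lemma occ_le_cnt X c s : (forall p, Z p -> p \in X) -> (occ c s <= cnt X c s)%N.
Proof.
move=> ZX; rewrite /occ; case: asboolP => // -[p ps /ZX pX].
by rewrite -has_count; apply/hasP; exists p => //; exact/asboolP.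
Qed.

Lemma cnt_le_occ X c s : uniq X -> (forall p, p \in X -> Z p) ->
  (forall p q, p \in X -> q \in X -> `|p - q| < s -> p = q) ->
  (cnt X c s <= occ c s)%N.
Proof.
move=> uX XZ sep; rewrite /cnt -size_filter.
set Y := [seq x <- X | _].
have YP p : p \in Y -> p \in X /\ hsq c s p.
  by rewrite mem_filter => /andP[/asboolP ? ?].
have Yu : uniq Y by exact: filter_uniq.
have Y1 p q : p \in Y -> q \in Y -> p = q.
  move=> /YP[pX /hsqP[p1 p2 p3 p4]] /YP[qX /hsqP[q1 q2 q3 q4]]; apply: sep => //.
  by rewrite gt_max/= !ltr_norml; apply/andP; split; apply/andP; split; lra.
case: Y Yu YP Y1 => [//|p Y] Yu YP Y1.
have -> : Y = [::].
  case: Y Yu YP Y1 => // q Y; rewrite /= inE negb_or => /andP[/andP[/eqP pq _] _] _ Y1.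
  by case: pq; apply: Y1; rewrite !inE eqxx ?orbT.
have [pX ps] := YP p (mem_head _ _).
by rewrite /occ; case: asboolP => // H; exfalso; apply: H; exists p => //; exact: XZ.
Qed.

Let sep_dist (X : seq (R * R)) : exists2 e : R, 0 < e &
  forall p q, p \in X -> q \in X -> `|p - q| < e -> p = q.
Proof.
pose Y := [seq `|pq.1 - pq.2| | pq <- [seq (p, q) | p <- X, q <- X] & pq.1 != pq.2].
pose e := \big[Num.min/1]_(x <- Y) x.
exists e.
  rewrite /e big_seq; elim/big_ind : _ => //.
    by move=> x y x0 y0; rewrite lt_min x0.
  move=> x /mapP[[p q]]; rewrite mem_filter => /andP[/= pq _] ->.
  by rewrite normr_gt0 subr_eq0.
move=> p q pX qX pqe; apply/eqP; apply/negP => /negP pq.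
have : e <= `|p - q|.
  apply: (@ge_bigmin_seq _ _ _ _ _ `|p - q| xpredT id) => //.
  apply/mapP; exists (p, q) => //; rewrite mem_filter/= pq/=.
  by apply/allpairsP; exists (p, q).
by rewrite leNgt pqe.
Qed.

(** The number of occupied squares increases under subdivision. It never exceeds the number of
    points, and any finite subset of [Z] is separated once the side is below its least mutual
    distance. Comparing with finite subsets also gives the limit [+oo] for infinite [Z]. *)
Lemma cvg_sumsq_occ c s : 0 < s -> (forall p, Z p -> hsq c s p) ->
  (sumsq occ k c s)%:R%:E @[k --> \oo] --> (counting Z : \bar R).
Proof.
move=> s0 Zs.
have nd : nondecreasing_seq (fun k => ((sumsq occ k c s)%:R%:E : \bar R)).
  by apply/nondecreasing_seqP => k; rewrite lee_fin ler_nat; exact: sumsq_occ_nd.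
suff <- : ereal_sup (range (fun k => ((sumsq occ k c s)%:R%:E : \bar R))) = counting Z.
  exact: ereal_nondecreasing_cvgn.
have lower (X : seq (R * R)) : uniq X -> (forall p, p \in X -> Z p) ->
    ((size X)%:R%:E <= ereal_sup (range (fun k => ((sumsq occ k c s)%:R%:E : \bar R))))%E.
  move=> uX XZ; have [e e0 sep] := sep_dist X.
  have [k ke] : exists k, s / 2 ^+ k < e.
    exists (Num.truncn (s / e)).
    rewrite ltr_pdivrMr ?exprn_gt0// mulrC -ltr_pdivrMr//.
    apply: (lt_le_trans (truncnS_gt _)).
    by rewrite -natrX ler_nat ltn_expl.
  apply: le_trans (ereal_sup_ubound _); last by exists k.
  rewrite lee_fin ler_nat.
  have <- : cnt X c s = size X.
    rewrite /cnt; apply/eqP; rewrite -all_count; apply/allP => p pX.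
    by apply/asboolP/Zs/XZ.
  rewrite -(sumsq_cnt _ k)//; apply: sumsq_le => c'; apply: cnt_le_occ => //.
  by move=> p q pX qX pq; apply: sep => //; exact: lt_trans ke.
have memF p : finite_set Z -> Z p <-> p \in enum_fset (fset_set Z).
  move=> Zf; have E : (p \in enum_fset (fset_set Z)) = (p \in Z) by exact: in_fset_set.
  by rewrite E; split => [/mem_set|/set_mem].
apply/eqP; rewrite eq_le; apply/andP; split; rewrite /counting; case: asboolP => Zf.
- apply: ge_ereal_sup => _ [k _ <-]; rewrite lee_fin ler_nat.
  apply: leq_trans (_ : cnt (enum_fset (fset_set Z)) c s <= _)%N; last exact: count_size.
  rewrite -(sumsq_cnt _ k)//; apply: sumsq_le => c'; apply: occ_le_cnt => p Zp.
  exact/(memF _ Zf).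
- exact: leey.
- apply: lower; first exact: fset_uniq.
  by move=> p /(memF _ Zf).
- rewrite leye_eq; apply/eqP/eqyP => A A0.
  have [X XZ nX] := infinite_set_fset (Num.truncn A).+1 Zf.
  apply: le_trans (lower (enum_fset X) (fset_uniq _) _) => //.
  rewrite lee_fin.
  by rewrite (le_trans (ltW (truncnS_gt A)))// ler_nat.
Qed.

End count.

End dyadic.

(** * The area formula on one square *)

Section area_square.
Variable R : realType.
Local Notation l2 := (@leb2 R).
Local Notation cE c s := ((c.1 + s / 2)%R, c.2).
Local Notation cN c s := (c.1, (c.2 + s / 2)%R).
Local Notation cNE c s := ((c.1 + s / 2)%R, (c.2 + s / 2)%R).
Implicit Types (c p q : R * R) (s : R).

Lemma nc_dist (a b : R[i]) : `|nc a - nc b| <= nc (a - b).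
Proof.
have := ncD (a - b) b; rewrite subrK; have := ncD (b - a) a; rewrite subrK (ncC b a).
by move=> *; rewrite ler_norml; apply/andP; split; lra.
Qed.

Lemma ReB (a b : R[i]) : complex.Re (a - b) = complex.Re a - complex.Re b.
Proof. by case: a; case: b. Qed.

Lemma ImB (a b : R[i]) : complex.Im (a - b) = complex.Im a - complex.Im b.
Proof. by case: a; case: b. Qed.

Lemma measurable_nc d (W : measurableType d) (g : W -> R[i]) :
  measurable_fun setT (fun w => complex.Re (g w)) ->
  measurable_fun setT (fun w => complex.Im (g w)) ->
  measurable_fun setT (fun w => nc (g w)).
Proof.
move=> mr mi; apply: measurableT_comp.
  by apply: continuous_measurable_fun; exact: sqrt_continuous.
by apply: measurable_funD; exact: measurable_funX.
Qed.

Lemma hsq_halves c s : 0 < s -> hsq c s =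
  (hsq c (s / 2) `|` hsq (cE c s) (s / 2)) `|`
  (hsq (cN c s) (s / 2) `|` hsq (cNE c s) (s / 2)).
Proof.
move=> s0; apply/seteqP; split => p.
  by move=> /(hsq4 _ _ s0)[]; [left; left|left; right|right; left|right; right].
by move=> H; apply/(hsq4 _ _ s0); case: H => [[]|[]]; [apply: Or41|apply: Or42|apply: Or43|apply: Or44].
Qed.

Lemma integral_hsq4 (g : R * R -> \bar R) c s : 0 < s ->
  measurable_fun setT g -> (forall p, 0 <= g p)%E ->
  (\int[l2]_(p in hsq c s) g p =
   \int[l2]_(p in hsq c (s / 2)) g p + \int[l2]_(p in hsq (cE c s) (s / 2)) g p +
   (\int[l2]_(p in hsq (cN c s) (s / 2)) g p +
    \int[l2]_(p in hsq (cNE c s) (s / 2)) g p))%E.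
Proof.
move=> s0 mg g0; rewrite hsq_halves//.
have m4 c' s' := measurable_hsq c' s'.
rewrite !ge0_integral_setU//; try exact: measurable_funTS; try exact: measurableU.
- apply/disj_set2P/seteqP; split => // p [/hsqP/= [? ? ? ?] /hsqP/= [? ? ? ?]]; lra.
- apply/disj_set2P/seteqP; split => // p [/hsqP/= [? ? ? ?] /hsqP/= [? ? ? ?]]; lra.
- apply/disj_set2P/seteqP; split => // p [[] /hsqP/= [? ? ? ?] [] /hsqP/= [? ? ? ?]]; lra.
Qed.

Lemma box_sub c s : 0 < s -> [/\ box c (s / 2) `<=` box c s,
   box (cE c s) (s / 2) `<=` box c s, box (cN c s) (s / 2) `<=` box c s &
   box (cNE c s) (s / 2) `<=` box c s].
Proof.
by move=> s0; split => p /boxP/= [? ? ? ?]; apply/boxP; split; lra.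
Qed.

Lemma sumsqD (g h : R * R -> R -> \bar R) k c s :
  (sumsq (fun c s => g c s + h c s) k c s = sumsq g k c s + sumsq h k c s)%E.
Proof.
elim: k c s => [//|k IH] c s /=; rewrite !IH.
have ac (a b c' d e f i j : \bar R) :
    (a + b + (c' + d) + (e + f + (i + j)) = a + c' + (e + i) + (b + d + (f + j)))%E.
  by rewrite (addeACA a) (addeACA e) [LHS]addeACA.
exact: ac.
Qed.

Section ineq.
Variable D : set (R * R)%type.

Lemma lee_sumsq (d : R) (g h : R * R -> R -> \bar R) k c s : 0 < s ->
  s / 2 ^+ k <= d -> box c s `<=` D ->
  (forall c s, 0 < s -> s <= d -> box c s `<=` D -> (g c s <= h c s)%E) ->
  (sumsq g k c s <= sumsq h k c s)%E.
Proof.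
move=> + + + gh; elim: k c s => [|k IH] c s s0.
  by rewrite expr0 divr1 => sd bD /=; exact: gh.
move=> sd bD; have [b1 b2 b3 b4] := box_sub c s0.
have s20 : 0 < s / 2 by rewrite divr_gt0.
have s2d : s / 2 / 2 ^+ k <= d by rewrite -mulrA -invfM -exprS.
by rewrite /= !leeD//; apply: IH => //; exact: subset_trans bD.
Qed.

End ineq.

Lemma eq_sumsq (A : nmodType) (g : R * R -> R -> A) k c s : 0 < s ->
  (forall c s, 0 < s -> g c s = g c (s / 2) + g (cE c s) (s / 2) +
    (g (cN c s) (s / 2) + g (cNE c s) (s / 2))) ->
  sumsq g k c s = g c s.
Proof.
by move=> + H; elim: k c s => [//|k IH] c s s0 /=; rewrite !IH ?divr_gt0// -H.
Qed.

Lemma sumsq_occI (Z Q : set (R * R)%type) k c s : 0 < s -> hsq c s `<=` Q ->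
  sumsq (occ (Z `&` Q)) k c s = sumsq (occ Z) k c s.
Proof.
elim: k c s => [|k IH] c s s0 sQ /=.
  rewrite /occ; congr nat_of_bool; apply: asbool_equiv_eq; split.
    by move=> [p ps [Zp _]]; exists p.
  by move=> [p ps Zp]; exists p => //; split => //; exact: sQ.
have s20 : 0 < s / 2 by rewrite divr_gt0.
by rewrite !IH// => p ps; apply: sQ; apply/(hsq4 _ _ s0);
  [apply: Or44|apply: Or43|apply: Or42|apply: Or41].
Qed.

Variables (r M : R) (Phi D1 D2 : R[i] -> R[i]).
Hypothesis HPhi : RC11_with r M Phi D1 D2.
Hypothesis M1 : 1 <= M.
Let M0 : 0 <= M. Proof. by move: M1; lra. Qed.

Let D : set (R * R)%type := [set p | nc (cx p) <= r].

Lemma RC11_Lip z w : nc z <= r -> nc w <= r ->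
  nc (Phi z - Phi w) <= M * (2 * r + 2) * nc (z - w).
Proof.
move=> zr wr; have [H _ _ h1 h2] := HPhi zr wr.
have -> : Phi z - Phi w = (Phi z - Phi w - (D1 w * (z - w) + D2 w * cj (z - w))) +
  (D1 w * (z - w) + D2 w * cj (z - w)) by ring.
rewrite (le_trans (ncD _ _))// (le_trans (lerD H (ncD _ _)))// !ncM ncJ.
have n0 := nc_ge0 (z - w).
have n2 : nc (z - w) <= 2 * r by rewrite (le_trans (ncB _ _))//; lra.
have : nc (z - w) ^+ 2 <= 2 * r * nc (z - w) by rewrite expr2 ler_wpM2r.
move=> /(ler_wpM2l M0).
have := ler_wpM2r n0 h1; have := ler_wpM2r n0 h2; lra.
Qed.

(** A point [w] lies in the image exactly when [nc (Phi z - w)] vanishes somewhere on the square, so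
    the measurability of zero events applies with [w] as parameter. *)
Lemma measurable_imsq c s : 0 < s -> box c s `<=` D -> measurable (imsq Phi c s).
Proof.
move=> s0 bD.
have -> : imsq Phi c s = [set w | exists2 p, hsq c s p & nc (Phi (cx p) - cx w) = 0].
  apply/seteqP; split => w [p ps].
    by move=> <-; exists p => //; rewrite cpairK subrr nc0.
  by move=> /eqP; rewrite nc_eq0 subr_eq0 => /eqP E; exists p => //; rewrite E cxK.
apply: hsq_zero_measurable => //.
- move=> p; apply: measurable_nc.
    under eq_fun do rewrite ReB.
    by apply: measurable_funB => //; exact: measurable_fst.
  under eq_fun do rewrite ImB.
  by apply: measurable_funB => //; exact: measurable_snd.
- by move=> w p; exact: nc_ge0.
move=> w; exists (M * (2 * r + 2) * 2) => p q pb qb.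
apply: le_trans (nc_dist _ _) _.
have -> : Phi (cx p) - cx w - (Phi (cx q) - cx w) = Phi (cx p) - Phi (cx q) by ring.
apply: le_trans (RC11_Lip (bD _ pb) (bD _ qb)) _.
have r0 : 0 <= r := le_trans (nc_ge0 _) (bD _ pb).
rewrite -[leRHS]mulrA; apply: ler_wpM2l; last by rewrite -cxB nc_cx.
by rewrite mulr_ge0//; lra.
Qed.

Lemma box_in_disc c s : box c s `<=` D -> in_disc r c s.
Proof.
move=> bD x; rewrite ge_max/= !ler_norml => /andP[/andP[? ?] /andP[? ?]].
by apply: bD; apply/boxP; rewrite /mid/=; split; lra.
Qed.

Variables (f : R * R -> R) (K : R).
Hypotheses (mf : measurable_fun setT f) (f0 : forall u, 0 <= f u)
  (f1 : forall u, f u <= 1) (K0 : 0 <= K)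
  (fL : forall u v, `|f u - f v| <= K * nc (cx u - cx v)).
Hypothesis mjacf : measurable_fun setT (jacf Phi D1 D2 f).

Let Z w : set (R * R)%type := [set p | cpair (Phi (cx p)) = w].

Let occE c s w : (occ (Z w) c s)%:R = \1_(imsq Phi c s) w :> R.
Proof.
by rewrite /occ indicE; congr (nat_of_bool _)%:R.
Qed.

Lemma sumsq_int k c s : 0 < s -> box c s `<=` D ->
  measurable_fun setT (fun w => ((sumsq (occ (Z w)) k c s)%:R : R)) /\
  (\int[l2]_w (((sumsq (occ (Z w)) k c s)%:R * f w)%:E) =
   sumsq (fun c s => \int[l2]_(w in imsq Phi c s) (f w)%:E) k c s)%E.
Proof.
elim: k c s => [|k IH] c s s0 bD.
  have mI := measurable_imsq s0 bD.
  have E w : ((sumsq (occ (Z w)) 0 c s)%:R : R) = \1_(imsq Phi c s) w.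
    exact: occE.
  split; first by under eq_fun do rewrite E; exact: measurable_indic.
  rewrite [RHS]integral_mkcond; apply: eq_integral => w _.
  by rewrite E patchE indicE; case: ifPn; rewrite ?mul1r ?mul0r.
have [b1 b2 b3 b4] := box_sub c s0.
have s20 : 0 < s / 2 by rewrite divr_gt0.
have [m1 i1] := IH _ _ s20 (subset_trans b1 bD).
have [m2 i2] := IH _ _ s20 (subset_trans b2 bD).
have [m3 i3] := IH _ _ s20 (subset_trans b3 bD).
have [m4 i4] := IH _ _ s20 (subset_trans b4 bD).
split; first by rewrite /=; under eq_fun do rewrite !natrD; do !apply: measurable_funD.
rewrite [RHS]/= -i1 -i2 -i3 -i4.
have mm (g : R * R -> R) : measurable_fun setT g -> measurable_fun setT (fun w => (g w * f w)%:E).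
  by move=> mg; apply/measurable_EFinP; exact: measurable_funM.
rewrite -!ge0_integralD//; do ?[by apply: mm]; do ?[by move=> w _; rewrite ?adde_ge0 ?lee_fin ?mulr_ge0];
  do ?[by apply: emeasurable_funD; exact: mm].
by apply: eq_integral => w _; rewrite /= !natrD !mulrDl !EFinD.
Qed.

(** At depth [k] the number of occupied squares integrates to the sum over the tiling of the
    integrals of [f] over image squares. By [square_integral] that sum differs from the right-hand
    side by at most [e * s ^+ 2]; monotone convergence in [k] and arbitrary [e] conclude. *)
Lemma area_square c s : 0 < s -> box c s `<=` D ->
  (\int[l2]_w (counting [set p | hsq c s p /\ cpair (Phi (cx p)) = w] * (f w)%:E) =
   \int[l2]_(p in hsq c s) (jacf Phi D1 D2 f p)%:E)%E.
Proof.
move=> s0 bD.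
pose N k w : \bar R := ((sumsq (occ (Z w)) k c s)%:R * f w)%:E.
have NE k w : N k w = ((sumsq (occ (Z w `&` hsq c s)) k c s)%:R%:E * (f w)%:E)%E.
  by rewrite sumsq_occI// EFinM.
have Zset w : [set p | hsq c s p /\ cpair (Phi (cx p)) = w] = Z w `&` hsq c s.
  by apply/seteqP; split=> p [].
have cvgN w : N ^~ w @ \oo --> (counting [set p | hsq c s p /\ cpair (Phi (cx p)) = w] * (f w)%:E)%E.
  rewrite Zset; under eq_fun do rewrite NE.
  by apply: cvgeZr => //; apply: cvg_sumsq_occ => // p [].
have mN k : measurable_fun setT (N k).
  apply/measurable_EFinP; apply: measurable_funM => //.
  by have [] := sumsq_int k s0 bD.
have N0 k w : (0 <= N k w)%E by rewrite lee_fin mulr_ge0.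
have ndN w : nondecreasing_seq (N ^~ w).
  apply/nondecreasing_seqP => k; rewrite lee_fin ler_wpM2r// ler_nat.
  exact: sumsq_occ_nd.
have cvgI : (\int[l2]_w N k w)%E @[k --> \oo] -->
    (\int[l2]_w (counting [set p | hsq c s p /\ cpair (Phi (cx p)) = w] * (f w)%:E))%E.
  rewrite (eq_integral (fun w => limn (N ^~ w))); last first.
    by move=> w _; apply/esym/cvg_lim => //; exact: cvgN.
  by apply: cvg_monotone_convergence => // w _; exact: ndN.
set I := (\int[l2]_w (counting _ * _))%E in cvgI *.
set J := (\int[l2]_(p in _) _)%E.
have JE c' s' k : 0 < s' -> (sumsq (fun c s => \int[l2]_(p in hsq c s) (jacf Phi D1 D2 f p)%:E) k c' s' =
    \int[l2]_(p in hsq c' s') (jacf Phi D1 D2 f p)%:E)%E.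
  move=> s'0; apply: (eq_sumsq _ _ s'0) => c'' s'' s''0; apply: integral_hsq4 => //.
    exact/measurable_EFinP.
  by move=> p; rewrite lee_fin mulr_ge0.
have near_est (e : R) : 0 < e -> \forall k \near \oo,
    (\int[l2]_w N k w <= J + (e * s ^+ 2)%:E)%E /\ (J <= \int[l2]_w N k w + (e * s ^+ 2)%:E)%E.
  move=> e0; have [d d0 Hd] := square_integral HPhi M1 mf f0 f1 K0 fL mjacf e0.
  exists (Num.truncn (s / d)).+1 => // k /= kd.
  have skd : s / 2 ^+ k <= d.
    rewrite ler_pdivrMr ?exprn_gt0// mulrC -ler_pdivrMr//.
    rewrite (le_trans (ltW (truncnS_gt _)))// -natrX ler_nat.
    by rewrite (leq_trans kd)// ltnW// ltn_expl.
  (* Errors proportional to area do not accumulate with the depth. *)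
  have EE c' s' : 0 < s' -> sumsq (fun c s => (e * s ^+ 2)%:E) k c' s' = (e * s' ^+ 2)%:E.
    move=> s'0; apply: eq_sumsq => // c'' s'' _ /=.
    by rewrite -!EFinD; congr EFin; field.
  have [_ iN] := sumsq_int k s0 bD.
  rewrite /N iN /J -(JE c s k)// -(EE c s)// -!sumsqD.
  split; apply: (lee_sumsq s0 skd bD) => c' s' s'0 s'd b'D;
  have [||H1 H2] // := Hd c' s' s'0 s'd; do ?[exact: box_in_disc|exact: measurable_imsq].
have s2 : 0 < s ^+ 2 by rewrite exprn_gt0.
apply/eqP; rewrite eq_le; apply/andP; split; apply/lee_addgt0Pr => e e0.
  have e's : 0 < e / s ^+ 2 by rewrite divr_gt0.
  have [m _ Hm] := near_est _ e's.
  rewrite -(cvg_lim _ cvgI)//; apply: lime_le; first by apply/cvg_ex; exists I.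
  by exists m => // k /Hm[+ _]; rewrite divfK// gt_eqF.
have e's : 0 < e / s ^+ 2 by rewrite divr_gt0.
have [m _ Hm] := near_est _ e's.
have := Hm m (leqnn m) => -[_]; rewrite divfK ?gt_eqF// => /le_trans; apply.
rewrite leeD2r//.
rewrite -(cvg_lim _ cvgI)//; apply: lime_ge; first by apply/cvg_ex; exists I.
by exists m => // k /= mk; apply: ge0_le_integral => // w _; exact: ndN.
Qed.

End area_square.

Section counting_lemmas.
Variables (R : realType) (T : choiceType).
Implicit Types Z : set T.

Let memF Z p : finite_set Z -> Z p <-> p \in enum_fset (fset_set Z).
Proof.
move=> Zf; have E : (p \in enum_fset (fset_set Z)) = (p \in Z) by exact: in_fset_set.
by rewrite E; split => [/mem_set|/set_mem].
Qed.

(** Together with [counting_ge] this describes [counting] as the supremum of the sizes of finite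
    sublists, which treats finite and infinite sets alike. *)
Lemma counting_le Z (a : \bar R) :
  (forall X : seq T, uniq X -> (forall p, p \in X -> Z p) -> ((size X)%:R%:E <= a)%E) ->
  (counting Z <= a)%E.
Proof.
move=> H; rewrite /counting; case: asboolP => Zf.
  by apply: H; [exact: fset_uniq|move=> p /(memF _ Zf)].
rewrite leye_eq; apply/eqP/eqyP => A A0.
have [X XZ nX] := infinite_set_fset (Num.truncn A).+1 Zf.
apply: le_trans (H (enum_fset X) (fset_uniq _) _) => //.
by rewrite lee_fin (le_trans (ltW (truncnS_gt A)))// ler_nat.
Qed.

Lemma counting_ge Z (X : seq T) : uniq X -> (forall p, p \in X -> Z p) ->
  ((size X)%:R%:E <= (counting Z : \bar R))%E.
Proof.
move=> uX XZ; rewrite /counting; case: asboolP => [Zf|_]; last exact: leey.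
rewrite lee_fin ler_nat; apply: (uniq_leq_size uX) => p /XZ Zp.
exact/(memF _ Zf).
Qed.

Lemma le_counting Z Z' : Z `<=` Z' -> ((counting Z : \bar R) <= counting Z')%E.
Proof.
by move=> ZZ; apply: counting_le => X uX XZ; apply: counting_ge => // p /XZ /ZZ.
Qed.

Lemma counting_ge0 Z : (0 <= (counting Z : \bar R))%E.
Proof. exact: (@counting_ge Z [::]). Qed.

Lemma cvg_counting_cover (Q : nat -> set T) Z :
  {homo Q : i j / (i <= j)%N >-> i `<=` j} -> (forall p, exists j, Q j p) ->
  (counting (Z `&` Q j) : \bar R) @[j --> \oo] --> (counting Z : \bar R).
Proof.
move=> ndQ cQ.
have nd : nondecreasing_seq (fun j => (counting (Z `&` Q j) : \bar R)).
  by move=> i j ij; apply: le_counting; apply: setIS; exact: ndQ.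
suff <- : ereal_sup (range (fun j => (counting (Z `&` Q j) : \bar R))) = counting Z.
  exact: ereal_nondecreasing_cvgn.
apply/eqP; rewrite eq_le; apply/andP; split.
  by apply: ge_ereal_sup => _ [j _ <-]; apply: le_counting.
apply: counting_le => X uX XZ.
have [j Hj] : exists j, forall p, p \in X -> Q j p.
  elim: X {uX XZ} => [|p X [j Hj]]; first by exists 0%N.
  have [i Qi] := cQ p; exists (maxn i j) => q; rewrite inE => /orP[/eqP ->|/Hj].
    by apply: ndQ Qi; exact: leq_maxl.
  by apply: ndQ; exact: leq_maxr.
apply: (@le_trans _ _ (counting (Z `&` Q j))).
  by apply: counting_ge => // p pX; split; [exact: XZ|exact: Hj].
by apply: ereal_sup_ubound; exists j.
Qed.

End counting_lemmas.

Lemma counting_bij (R : realType) (T U : choiceType) (g : T -> U) (h : U -> T) (Z : set U) :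
  cancel g h -> cancel h g -> (counting (g @^-1` Z) : \bar R) = counting Z.
Proof.
move=> gh hg; apply/eqP; rewrite eq_le; apply/andP; split.
  apply: counting_le => X uX XZ; rewrite -(size_map g).
  apply: counting_ge; first by rewrite (map_inj_uniq (can_inj gh)).
  by move=> _ /mapP[p pX ->]; exact: XZ.
apply: counting_le => X uX XZ; rewrite -(size_map h).
apply: counting_ge; first by rewrite (map_inj_uniq (can_inj hg)).
by move=> _ /mapP[p pX ->]; rewrite /preimage/= hg; exact: XZ.
Qed.

Section plane_area.
Variable R : realType.
Local Notation l2 := (@leb2 R).

Definition bigsq (j : nat) : set (R * R)%type :=
  hsq (- j.+1%:R, - j.+1%:R) (2 * j.+1%:R).

Lemma bigsqP j p : bigsq j p <-> [/\ - j.+1%:R <= p.1, p.1 < j.+1%:R,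
   - j.+1%:R <= p.2 & p.2 < j.+1%:R].
Proof.
have E : - j.+1%:R + 2 * j.+1%:R = j.+1%:R :> R by ring.
by rewrite /bigsq; split => [/hsqP|H]; [|apply/hsqP]; rewrite /= E.
Qed.

Lemma bigsq_homo : {homo bigsq : i j / (i <= j)%N >-> i `<=` j}.
Proof.
move=> i j ij p /bigsqP[p1 p2 p3 p4]; apply/bigsqP.
have : (i.+1%:R <= j.+1%:R :> R) by rewrite ler_nat ltnS.
by split; lra.
Qed.

Lemma bigsq_cover p : exists j, bigsq j p.
Proof.
exists (Num.truncn `|p|); apply/bigsqP.
have := truncnS_gt `|p|; rewrite gt_max !ltr_norml => /andP[/andP[? ?] /andP[? ?]].
by split => //; exact: ltW.
Qed.

Let rad (j : nat) : R := 2 * j.+1%:R.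

Let bigbox j : box (- j.+1%:R, - j.+1%:R) (2 * j.+1%:R) `<=` [set p | nc (cx p) <= rad j].
Proof.
move=> p /boxP/= [p1 p2 p3 p4] /=.
rewrite (le_trans (nc_cx _))// /rad ler_pM2l// ge_max !ler_norml.
by apply/andP; split; apply/andP; split; lra.
Qed.

Let rad0 j : 0 < 2 * j.+1%:R :> R. Proof. by rewrite mulr_gt0. Qed.

(** A double limit, in the exhausting square and in the dyadic depth, of finite sums of indicators
    of events that a square contains a zero. *)
Lemma measurable_counting_zeros d (W : measurableType d) (H : W -> R[i] -> R[i]) :
  (forall z, measurable_fun setT (fun w => nc (H w z))) ->
  (forall w (r : R), exists L, forall z z', nc z <= r -> nc z' <= r ->
      nc (H w z - H w z') <= L * nc (z - z')) ->
  measurable_fun setT (fun w => (counting [set p : R * R | H w (cx p) = 0] : \bar R)).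
Proof.
move=> mH LH.
pose Z w := [set p : R * R | H w (cx p) = 0].
apply: (emeasurable_fun_cvg (fun j w => (counting (Z w `&` bigsq j) : \bar R))); last first.
  by move=> w _; apply: cvg_counting_cover; [exact: bigsq_homo|exact: bigsq_cover].
move=> j.
apply: (emeasurable_fun_cvg (fun k w => ((sumsq (occ (Z w `&` bigsq j)) k
   (- j.+1%:R, - j.+1%:R) (2 * j.+1%:R))%:R%:E : \bar R))); last first.
  by move=> w _; apply: cvg_sumsq_occ => // p [].
move=> k; apply/measurable_EFinP.
have : hsq (- j.+1%:R, - j.+1%:R) (2 * j.+1%:R) `<=` bigsq j by [].
have := @bigbox j; have := rad0 j.
elim: k (- j.+1%:R, - j.+1%:R) (2 * j.+1%:R) => [|k IH] c s s0 bD hD.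
  rewrite [X in measurable_fun _ X](_ : _ = \1_[set w | exists2 p, hsq c s p & nc (H w (cx p)) = 0]).
    apply: measurable_indic; apply: hsq_zero_measurable => //.
    - by move=> w p; exact: nc_ge0.
    - move=> w; have [L HL] := LH w (rad j); exists (Num.max L 0 * 2) => p q pb qb.
      apply: le_trans (nc_dist _ _) _.
      apply: le_trans (HL _ _ (bD _ pb) (bD _ qb)) _.
      apply: (@le_trans _ _ (Num.max L 0 * nc (cx p - cx q))).
        by rewrite ler_wpM2r ?nc_ge0// le_max lexx.
      by rewrite -mulrA ler_wpM2l ?le_max ?lexx ?orbT// -cxB nc_cx.
  apply/funext => w; rewrite /= /occ indicE; congr (nat_of_bool _)%:R.
  apply/asboolP/idP => [[p ps [Zp _]]|/set_mem[p ps /eqP]].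
    by apply/mem_set; exists p => //; rewrite Zp nc0.
  by rewrite nc_eq0 => /eqP Zp; exists p => //; split => //; exact: hD.
have [b1 b2 b3 b4] := box_sub c s0.
have s20 : 0 < s / 2 by rewrite divr_gt0.
rewrite /=; under eq_fun do rewrite !natrD.
by do !apply: measurable_funD; apply: IH => //;
  do ?[by apply: subset_trans bD]; move=> p ps; apply: hD; apply/(hsq4 _ _ s0);
  [apply: Or41|apply: Or42|apply: Or43|apply: Or44].
Qed.

Variables (Phi D1 D2 : R[i] -> R[i]).
Hypothesis HPhi : forall r, exists2 M, 1 <= M & RC11_with r M Phi D1 D2.
Variables (f : R * R -> R) (K : R).
Hypotheses (mf : measurable_fun setT f) (f0 : forall u, 0 <= f u)
  (f1 : forall u, f u <= 1) (K0 : 0 <= K)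
  (fL : forall u v, `|f u - f v| <= K * nc (cx u - cx v)).
Hypothesis mjacf : measurable_fun setT (jacf Phi D1 D2 f).

(** Exhaustion by the squares [bigsq j], each inside a disc on which [HPhi] supplies its own
    constant, and monotone convergence on both sides. *)
Theorem area_plane :
  (\int[l2]_w (counting [set p | cpair (Phi (cx p)) = w] * (f w)%:E) =
   \int[l2]_p (jacf Phi D1 D2 f p)%:E)%E.
Proof.
have A j : (\int[l2]_w (counting ([set p | cpair (Phi (cx p)) = w] `&` bigsq j) * (f w)%:E) =
    \int[l2]_(p in bigsq j) (jacf Phi D1 D2 f p)%:E)%E.
  have [M M1 HM] := HPhi (rad j).
  rewrite -(area_square HM M1 mf f0 f1 K0 fL mjacf (rad0 j) (@bigbox j)).
  apply: eq_integral => w _; congr (counting _ * _)%E.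
  by apply/seteqP; split => p [].
have L1 : (\int[l2]_(p in bigsq j) (jacf Phi D1 D2 f p)%:E)%E @[j --> \oo] -->
   (\int[l2]_p (jacf Phi D1 D2 f p)%:E)%E.
  have -> : [set: R * R] = \bigcup_j bigsq j.
    by apply/seteqP; split => // p _; have [j jp] := bigsq_cover p; exists j.
  apply: ge0_nondecreasing_set_cvg_integral.
  - by move=> i j ij; apply/subsetPset; exact: bigsq_homo.
  - by move=> i; exact: measurable_hsq.
  - by move=> i; apply: measurable_funTS; exact/measurable_EFinP.
  - by move=> i p _; rewrite lee_fin mulr_ge0.
have cvgC w : (counting ([set p | cpair (Phi (cx p)) = w] `&` bigsq j) * (f w)%:E)%E @[j --> \oo]
   --> (counting [set p | cpair (Phi (cx p)) = w] * (f w)%:E)%E.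
  by apply: cvgeZr => //; apply: cvg_counting_cover; [exact: bigsq_homo|exact: bigsq_cover].
have mC j : measurable_fun setT (fun w => counting ([set p | cpair (Phi (cx p)) = w] `&` bigsq j) * (f w)%:E)%E.
  apply: emeasurable_funM; last exact/measurable_EFinP.
  apply: (emeasurable_fun_cvg (fun k w => ((sumsq (occ ([set p | cpair (Phi (cx p)) = w] `&` bigsq j)) k
   (- j.+1%:R, - j.+1%:R) (2 * j.+1%:R))%:R%:E : \bar R))); last first.
    by move=> w _; apply: cvg_sumsq_occ => // p [].
  move=> k; apply/measurable_EFinP.
  have [M M1 HM] := HPhi (rad j).
  have [+ _] := sumsq_int HM M1 mf f0 k (rad0 j) (@bigbox j).
  by under eq_fun do rewrite -(sumsq_occI _ _ (rad0 j) (@subset_refl _ (bigsq j))).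
have L2 : (\int[l2]_w (counting ([set p | cpair (Phi (cx p)) = w] `&` bigsq j) * (f w)%:E))%E
    @[j --> \oo] --> (\int[l2]_w (counting [set p | cpair (Phi (cx p)) = w] * (f w)%:E))%E.
  rewrite [X in _ --> X](eq_integral (fun w => limn (fun j =>
    counting ([set p | cpair (Phi (cx p)) = w] `&` bigsq j) * (f w)%:E)%E)); last first.
    by move=> w _; apply/esym/cvg_lim => //; exact: cvgC.
  apply: cvg_monotone_convergence => //.
  - by move=> j w _; rewrite mule_ge0 ?lee_fin ?counting_ge0.
  - move=> w _ i j ij; rewrite lee_wpmul2r ?lee_fin//; apply: le_counting.
    by apply: setIS; exact: bigsq_homo.
rewrite -(cvg_lim _ L2)// -(cvg_lim _ L1)//.
by apply: congr_lim; apply/funext => j; exact: A.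
Qed.

End plane_area.

(** * Independent complex Gaussians *)

Section measure_rect_unique.
Context d1 d2 (T1 : measurableType d1) (T2 : measurableType d2) (R : realType).

Lemma measure_rect_unique (m m' : {measure set (T1 * T2)%type -> \bar R}) :
  (m setT < +oo)%E ->
  (forall A B, measurable A -> measurable B -> m (A `*` B) = m' (A `*` B)) ->
  forall X, measurable X -> m X = m' X.
Proof.
move=> moo mm' X mX.
pose C : set (set (T1 * T2)%type) :=
  [set C | exists A, measurable A /\ exists B, measurable B /\ C = A `*` B].
apply: (measure_unique C (fun=> setT)) => //.
- rewrite measurable_prod_measurableType //; congr (<<s _ >>).
  rewrite predeqE; split => [[A mA [B mB <-]]|[A [mA [B [mB ->]]]]].
    by exists A; split => //; exists B.
  by exists A => //; exists B.
- move=> /= _ _ [X1 [mX1 [X2 [mX2 ->]]]] [Y1 [mY1 [Y2 [mY2 ->]]]].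
  rewrite -setXI; exists (X1 `&` Y1); split; first exact: measurableI.
  by exists (X2 `&` Y2); split => //; exact: measurableI.
- by move=> n; exists setT; split => //; exists setT; split => //; rewrite setXTT.
- by rewrite bigcup_const.
- by move=> _ [A [mA [B [mB ->]]]]; exact: mm'.
Qed.

End measure_rect_unique.

Section gaussian_invariance.
Variable R : realType.
Local Notation l2 := (@leb2 R).
Local Notation gam := (@gam R).
Local Notation rho := (@rho R).
Local Notation V := (R * R)%type.

Lemma rho_nc (w : V) : rho w = expR (- nc (cx w) ^+ 2) / pi.
Proof. by rewrite nc_sqr. Qed.

Lemma measurable_fun_lin (d : measure_display) (W : measurableType d) (c s : R) (f g : W -> V) :
  measurable_fun setT f -> measurable_fun setT g ->
  measurable_fun setT (fun w => c *: f w + s *: g w).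
Proof.
move=> mf mg.
rewrite (_ : (fun w => _) = fun w => (c * (f w).1 + s * (g w).1, c * (f w).2 + s * (g w).2)).
  by apply: measurable_fun_pair; apply: measurable_funD; apply: measurable_funM => //;
    apply: measurableT_comp => //.
by apply/funext => w; case: (f w); case: (g w).
Qed.

Lemma leb2_translate (a : V) (F : V -> \bar R) : measurable_fun setT F ->
  (forall p, 0 <= F p)%E -> (\int[l2]_p F (p + a)%R = \int[l2]_p F p)%E.
Proof.
move=> mF F0.
have := @lebesgue2_linear R 1 0 0 1 a F; rewrite mulr1 mulr0 subr0 normr1 invr1 mul1e.
move=> /(_ (oner_neq0 _) mF F0) <-; apply: eq_integral => p _.
by congr F; case: p => x y; case: a => u v; congr pair => /=; ring.
Qed.

Lemma leb4_shear (t : R) (F : V * V -> \bar R) : measurable_fun setT F ->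
  (forall p, 0 <= F p)%E ->
  (\int[l2 \x l2]_p F (p.1 + t *: p.2, p.2)%R = \int[l2 \x l2]_p F p)%E.
Proof.
move=> mF F0.
rewrite (@ge0_integral_shear _ _ _ _ _ l2 l2 (fun p => p.1 + t *: p.2) 1%E) ?mul1e//.
  by have := @measurable_fun_lin _ (V * V)%type 1 t fst snd measurable_fst measurable_snd;
    under eq_fun do rewrite scale1r.
by move=> y f mf f0; rewrite mul1e; exact: (leb2_translate (t *: y) mf f0).
Qed.

Lemma leb4_shear2 (t : R) (F : V * V -> \bar R) : measurable_fun setT F ->
  (forall p, 0 <= F p)%E ->
  (\int[l2 \x l2]_p F (p.1, p.2 + t *: p.1)%R = \int[l2 \x l2]_p F p)%E.
Proof.
move=> mF F0.
have mS : measurable_fun setT (fun p : V * V => F (p.2, p.1)).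
  by apply: measurableT_comp => //; exact: measurable_fun_pair.
rewrite -(@ge0_integral_swap _ _ _ _ _ l2 l2 F)// -(leb4_shear t mS)//=.
rewrite -(@ge0_integral_swap _ _ _ _ _ l2 l2 (fun p => F (p.1, p.2 + t *: p.1)))//.
apply: measurableT_comp => //; apply: measurable_fun_pair => //=.
by have := @measurable_fun_lin _ (V * V)%type 1 t snd fst measurable_snd measurable_fst;
  under eq_fun do rewrite scale1r.
Qed.

(** A rotation is a product of three shears, with parameters [t], [- s], [t] for [t = s / (1 + c)],
    the tangent of half the angle; hence the exclusion of [c = -1]. *)
Lemma leb4_rotation (c s : R) (F : V * V -> \bar R) : c ^+ 2 + s ^+ 2 = 1 -> c != -1 ->
  measurable_fun setT F -> (forall p, 0 <= F p)%E ->
  (\int[l2 \x l2]_p F (c *: p.1 + s *: p.2, - s *: p.1 + c *: p.2)%R =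
   \int[l2 \x l2]_p F p)%E.
Proof.
move=> cs c1 mF F0.
have c10 : 1 + c != 0 by rewrite addrC -(opprK 1) subr_eq0.
pose t := s / (1 + c).
have st : s * t = 1 - c.
  apply: (mulIf c10); rewrite /t -mulrA divfK// -expr2.
  by rewrite (_ : s ^+ 2 = 1 - c ^+ 2); [ring|rewrite -cs; ring].
have tc : t * (1 + c) = s by rewrite divfK.
have m1 (u : R) : measurable_fun setT (fun p : V * V => (p.1 + u *: p.2, p.2)).
  apply: measurable_fun_pair => //=.
  by have := @measurable_fun_lin _ (V * V)%type 1 u fst snd measurable_fst measurable_snd;
    under eq_fun do rewrite scale1r.
have m2 (u : R) : measurable_fun setT (fun p : V * V => (p.1, p.2 + u *: p.1)).
  apply: measurable_fun_pair => //=.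
  by have := @measurable_fun_lin _ (V * V)%type 1 u snd fst measurable_snd measurable_fst;
    under eq_fun do rewrite scale1r.
have mF1 : measurable_fun setT (fun p : V * V => F (p.1 + t *: p.2, p.2)).
  exact: (measurableT_comp mF (m1 t)).
have mF2 : measurable_fun setT (fun p : V * V =>
    F (p.1 + t *: (p.2 + - s *: p.1), p.2 + - s *: p.1)).
  exact: (measurableT_comp mF1 (m2 (- s))).
rewrite -[RHS](leb4_shear t)// -[RHS](leb4_shear2 (- s))// -[RHS](leb4_shear t)//=.
apply: eq_integral => -[[u1 u2] [v1 v2]] _ /=; congr F.
have E (x y : R) : c * x + s * y = x + t * y + t * (y + - s * (x + t * y)) /\
    - s * x + c * y = y + - s * (x + t * y).
  have -> : - s * (x + t * y) = - s * x - (s * t) * y by ring.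
  rewrite st; split; last by ring.
  have -> : x + t * y + t * (y + (- s * x - (1 - c) * y)) = x - (s * t) * x + (t * (1 + c)) * y by ring.
  by rewrite st tc; ring.
congr pair; congr pair => /=.
- exact: (E u1 v1).1.
- exact: (E u2 v2).1.
- exact: (E u1 v1).2.
- exact: (E u2 v2).2.
Qed.

Lemma gam2_integral (F : V * V -> \bar R) : measurable_fun setT F ->
  (forall p, 0 <= F p)%E ->
  (\int[gam \x gam]_p F p = \int[l2 \x l2]_p (F p * ((rho p.1)%:E * (rho p.2)%:E)))%E.
Proof.
move=> mF F0.
have mr := @measurable_rho R.
have r0 w : (0 <= (rho w)%:E)%E by rewrite lee_fin rho_ge0.
rewrite fubini_tonelli1// fubini_tonelli1; last 2 first.
- apply: emeasurable_funM => //; apply: emeasurable_funM; apply/measurable_EFinP;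
  exact: measurableT_comp.
- by move=> p; rewrite !mule_ge0.
rewrite ge0_integral_gam; last 2 first.
- exact: measurable_fun_fubini_tonelli_F.
- by move=> x; apply: integral_ge0.
apply: eq_integral => x _; rewrite /fubini_F ge0_integral_gam//; last first.
  exact: measurableT_comp.
rewrite -ge0_integralZr//.
- by apply: eq_integral => y _; rewrite /= -muleA; congr (_ * _)%E; rewrite muleC.
- by apply: emeasurable_funM; [exact: measurableT_comp|exact/measurable_EFinP].
- by move=> y _; rewrite mule_ge0.
Qed.

(** The joint density depends only on the sum of the four squared coordinates, which the rotation
    preserves together with Lebesgue measure. *)
Lemma gam2_rotation (c s : R) (A B : set V) : c ^+ 2 + s ^+ 2 = 1 -> c != -1 ->
  measurable A -> measurable B ->
  ((gam \x gam) [set p : V * V | A (c *: p.1 + s *: p.2)%R /\ B (- s *: p.1 + c *: p.2)%R] =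
   gam A * gam B)%E.
Proof.
move=> cs c1 mA mB.
rewrite -product_measure1E//.
set S := [set p | _].
pose rot (p : V * V) := (c *: p.1 + s *: p.2, - s *: p.1 + c *: p.2).
have mrot : measurable_fun setT rot.
  by apply: measurable_fun_pair; apply: measurable_fun_lin.
have mS : measurable S by rewrite -[S]setTI; exact: (mrot measurableT _ (measurableX mA mB)).
have mAB := measurableX mA mB.
rewrite -(setIT S) -(setIT (A `*` B)) -!integral_indic//.
rewrite !gam2_integral//; do ?[by move=> p; rewrite lee_fin];
  do ?[by apply/measurable_EFinP; exact: measurable_indic].
have mr := @measurable_rho R.
rewrite -[RHS](leb4_rotation cs c1)/=; last 2 first.
- apply: emeasurable_funM; first by apply/measurable_EFinP; exact: measurable_indic.
  by apply: emeasurable_funM; apply/measurable_EFinP; exact: measurableT_comp.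
- by move=> p; rewrite !mule_ge0 ?lee_fin ?rho_ge0.
apply: eq_integral => p _; congr (_ * _)%E.
rewrite -!EFinM; congr EFin.
rewrite /rho ![expR _ / _ * _]mulrACA -!expRD; congr (expR _ * _).
case: p => -[u1 u2] [v1 v2] /=.
rewrite -!opprD; congr (- _).
rewrite /=.
have -> : (c *: u1 + s *: v1) ^+ 2 + (c *: u2 + s *: v2) ^+ 2 +
  ((- s *: u1 + c *: v1) ^+ 2 + (- s *: u2 + c *: v2) ^+ 2) =
  (c ^+ 2 + s ^+ 2) * (u1 ^+ 2 + u2 ^+ 2 + (v1 ^+ 2 + v2 ^+ 2)).
  by rewrite /GRing.scale/=; ring.
by rewrite cs mul1r.
Qed.

Definition phase (u : R[i]) (p : V) : V := cpair (u * cx p).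

Lemma measurable_phase u : measurable_fun setT (phase u).
Proof.
have := @measurable_clinear R u 0 0.
by under eq_fun do rewrite mul0r !addr0.
Qed.

Lemma gam_phase (u : R[i]) (A : set V) : nc u = 1 -> measurable A ->
  gam (phase u @^-1` A) = gam A.
Proof.
move=> u1 mA.
have mp := measurable_phase u.
have mP : measurable (phase u @^-1` A) by rewrite -[X in measurable X]setTI; exact: mp.
rewrite -(setIT A) -[X in gam X]setIT -!integral_indic//.
have mi (B : set V) : measurable B -> measurable_fun setT (fun p => (\1_B p : R)%:E).
  by move=> mB; apply/measurable_EFinP; exact: measurable_indic.
rewrite !ge0_integral_gam ?setTI ?setIT//; do ?exact: mi;
  do ?[by move=> p; rewrite lee_fin].
pose a := complex.Re u; pose b := complex.Im u.
have ab : a * a - (- b) * b = 1.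
  by have := nc_sqr u; rewrite u1 expr1n -/a -/b => ->; ring.
have := @lebesgue2_linear R a (- b) b a (0, 0) (fun p => (\1_A p)%:E * (rho p)%:E)%E.
rewrite ab normr1 invr1 mul1e => <-.
- apply: eq_integral => p _ /=.
  have E : phase u p = (a * p.1 + - b * p.2 + 0, b * p.1 + a * p.2 + 0).
    by rewrite /phase /a /b; case: u {u1 a b ab mp mP} => x y; case: p => z w; rewrite /cpair/=; congr pair; ring.
  rewrite -E; congr (_ * _)%E.
  by rewrite !rho_nc /phase cpairK ncM u1 mul1r.
- exact: oner_neq0.
- apply: emeasurable_funM; first exact: mi.
  by apply/measurable_EFinP; exact: measurable_rho.
- by move=> p; rewrite mule_ge0 ?lee_fin ?rho_ge0.
by rewrite setIT.
Qed.

End gaussian_invariance.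

Section iid_gaussian.
Variables (R : realType) (d : measure_display) (T : measurableType d)
  (P : probability T R) (I : finType).
Local Notation l2 := (@leb2 R).
Local Notation gam := (@gam R).
Local Notation V := (R * R)%type.
Implicit Types (Z : I -> T -> V) (B : I -> set V).

Definition iid_gauss Z : Prop :=
  (forall i, measurable_fun setT (Z i)) /\
  forall B, (forall i, measurable (B i)) ->
    P [set w | forall i, B i (Z i w)] = (\prod_i gam (B i))%E.

Lemma iid_phase (u : I -> R[i]) Z : (forall i, nc (u i) = 1) -> iid_gauss Z ->
  iid_gauss (fun i w => phase (u i) (Z i w)).
Proof.
move=> u1 [mZ Zlaw]; split.
  by move=> i; exact: (measurableT_comp (measurable_phase (u i)) (mZ i)).
move=> B mB.
have mB' i : measurable (phase (u i) @^-1` B i).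
  by rewrite -[X in measurable X]setTI; exact: measurable_phase.
transitivity (\prod_i gam (phase (u i) @^-1` B i))%E; first exact: (Zlaw _ mB').
by apply: eq_bigr => i _; rewrite gam_phase.
Qed.

Lemma measurable_family Z (mZ : forall i, measurable_fun setT (Z i)) (Q : pred I) B :
  (forall i, measurable (B i)) -> measurable [set w | forall i, Q i -> B i (Z i w)].
Proof.
move=> mB.
rewrite (_ : [set w | _] = \bigcap_(i in [set i | Q i]) (Z i @^-1` B i)); last first.
  by apply/seteqP; split => w H i /= Qi; exact: H.
apply: fin_bigcap_measurable; first exact: finite_finset.
by move=> i _; rewrite -[X in measurable X]setTI; exact: mZ.
Qed.

Lemma gam_fine (A : set V) : measurable A -> gam A = (fine (gam A))%:E.
Proof. by move=> mA; rewrite fineK// fin_num_measure. Qed.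

(** On the event [E] that the other coordinates lie in their sets, the law of [(Z i, Z j)] is [kap]
    times the product Gaussian, as rectangles show; rotation invariance of the latter then
    applies. *)
Lemma iid_givens Z (i j : I) (c s : R) : i != j -> c ^+ 2 + s ^+ 2 = 1 -> c != -1 ->
  iid_gauss Z ->
  iid_gauss (fun k w => if k == i then c *: Z i w + s *: Z j w
                        else if k == j then - s *: Z i w + c *: Z j w else Z k w).
Proof.
move=> ij cs c1 [mZ Zlaw]; split.
  move=> k; have [ki|ki] := eqVneq k i; first exact: measurable_fun_lin.
  by have [kj|kj] := eqVneq k j; [exact: measurable_fun_lin|exact: mZ].
move=> B mB.
have ji : j != i by rewrite eq_sym.
pose Q k := (k != i) && (k != j).
have mE := measurable_family mZ Q mB.
set E := [set w | _] in mE.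
have mpair : measurable_fun setT (fun w => (Z i w, Z j w)) by exact: measurable_fun_pair.
have prod3 B' : (\prod_k gam (B' k) = gam (B' i) * (gam (B' j) * \prod_(k | Q k) gam (B' k)))%E.
  by rewrite (bigD1 i)//= (bigD1 j).
pose kap : R := \prod_(k | Q k) fine (gam (B k)).
have kapE : (\prod_(k | Q k) gam (B k))%E = kap%:E.
  rewrite /kap; elim/big_rec2 : _ => // k x y _ ->.
  by rewrite EFinM -gam_fine.
have kap0 : 0 <= kap by apply: prodr_ge0 => k _; exact: fine_ge0.
pose m := image_measure (mrestr P mE) mpair.
pose m' : {measure set (V * V)%type -> \bar R} := mscale (NngNum kap0) (gam \x gam)%E.
have mm' : forall X, measurable X -> m X = m' X.
  apply: measure_rect_unique.
    rewrite /m (image_measureE (mrestr P mE) mpair) /mrestr.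
    apply: (@le_lt_trans _ _ 1%E); last exact: ltry.
    by apply: probability_le1; apply: measurableI; [exact: measurableT|exact: mE].
  move=> A A' mA mA'.
  rewrite /m (image_measureE (mrestr P mE) mpair) /mrestr.
  have -> : (m' (A `*` A') = kap%:E * (gam A * gam A'))%E by rewrite -product_measure1E.
  pose B' k := if k == i then A else if k == j then A' else B k.
  have mB' k : measurable (B' k).
    by rewrite /B'; case: ifP => // _; case: ifP.
  transitivity (P [set w | forall k, B' k (Z k w)]).
    congr (P _).
    apply/seteqP; split => w /=.
      move=> [[wA wA'] wE] k; rewrite /B'; case: eqVneq => [->//|ki].
      by case: eqVneq => [->//|kj]; apply: wE; rewrite /Q ki.
    move=> H; split; first by split; [have := H i|have := H j]; rewrite /B' eqxx// (negbTE ji).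
    by move=> k /andP[ki kj]; have := H k; rewrite /B' (negbTE ki) (negbTE kj).
  rewrite Zlaw// prod3 {1 2}/B' !eqxx (negbTE ji).
  have -> : (\prod_(k | Q k) gam (B' k) = kap%:E)%E.
    rewrite -kapE; apply: eq_bigr => k /andP[ki kj].
    by rewrite /B' (negbTE ki) (negbTE kj).
  by rewrite [LHS]muleA [LHS]muleC.
pose S := [set p : V * V | B i (c *: p.1 + s *: p.2) /\ B j (- s *: p.1 + c *: p.2)].
have mS : measurable S.
  pose rot (p : V * V) := (c *: p.1 + s *: p.2, - s *: p.1 + c *: p.2).
  have mrot : measurable_fun setT rot.
    by apply: measurable_fun_pair; exact: measurable_fun_lin.
  by rewrite -[S]setTI; exact: (mrot measurableT _ (measurableX (mB i) (mB j))).
transitivity (m S).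
  congr (P _).
  apply/seteqP; split => w /=.
    move=> H; split.
      by split; [have := H i|have := H j]; rewrite eqxx// (negbTE ji).
    by move=> k /andP[ki kj]; have := H k; rewrite (negbTE ki) (negbTE kj).
  move=> [[H1 H2] H3] k; case: eqVneq => [->//|ki].
  by case: eqVneq => [->//|kj]; apply: H3; rewrite /Q ki.
rewrite mm'//.
have -> : (m' S = kap%:E * (gam (B i) * gam (B j)))%E by rewrite -(gam2_rotation cs c1).
by rewrite prod3 kapE [RHS]muleA [RHS]muleC.
Qed.

End iid_gaussian.

(** * Orthogonal reduction of linear forms in independent Gaussians *)

Section elimination.
Variables (R : realType) (d : measure_display) (T : measurableType d)
  (P : probability T R) (I : finType).
Local Notation V := (R * R)%type.
Implicit Types (Z : I -> T -> V) (v g : I -> R).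

Definition lincomb v Z (w : T) : V := \sum_i v i *: Z i w.

(* An orthogonal change of Gaussian coordinates [Z -> Z'] together with the
   induced map [L] on coefficient vectors. *)
Definition iso_change Z Z' (L : (I -> R) -> I -> R) : Prop :=
  (forall v w, lincomb v Z w = lincomb (L v) Z' w) /\
  (forall v v', \sum_i v i * v' i = \sum_i L v i * L v' i).

Lemma iso_change_comp Z Z1 Z2 L1 L2 : iso_change Z Z1 L1 -> iso_change Z1 Z2 L2 ->
  iso_change Z Z2 (L2 \o L1).
Proof.
move=> [h1 k1] [h2 k2]; split=> [v w|v v']; first by rewrite h1 h2.
by rewrite k1 k2.
Qed.

Lemma iso_givens Z (i j : I) (c s : R) : i != j -> c ^+ 2 + s ^+ 2 = 1 ->
  iso_change Z
    (fun k w => if k == i then c *: Z i w + s *: Z j w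
                else if k == j then - s *: Z i w + c *: Z j w else Z k w)
    (fun v k => if k == i then c * v i + s * v j
                else if k == j then - s * v i + c * v j else v k).
Proof.
move=> ij cs; have ji : j != i by rewrite eq_sym.
split=> [v w|v v'].
  rewrite /lincomb (bigD1 i)//= (bigD1 j)//= [RHS](bigD1 i)//= [X in _ = _ + X](bigD1 j)//=.
  rewrite !eqxx (negbTE ji) !addrA; congr (_ + _).
    case: (Z i w) => a b; case: (Z j w) => a' b'.
    have E (x y : R) : v i * x + v j * y =
      (c * v i + s * v j) * (c * x + s * y) + (- s * v i + c * v j) * (- s * x + c * y).
      have -> : (c * v i + s * v j) * (c * x + s * y) + (- s * v i + c * v j) * (- s * x + c * y)
        = (c ^+ 2 + s ^+ 2) * (v i * x + v j * y) by ring.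
      by rewrite cs mul1r.
    by congr pair; exact: E.
  by apply: eq_bigr => k /andP[ki kj]; rewrite (negbTE ki) (negbTE kj).
rewrite (bigD1 i)//= (bigD1 j)//= [RHS](bigD1 i)//= [X in _ = _ + X](bigD1 j)//=.
rewrite !eqxx (negbTE ji) !addrA; congr (_ + _).
  have -> : (c * v i + s * v j) * (c * v' i + s * v' j) + (- s * v i + c * v j) * (- s * v' i + c * v' j)
    = (c ^+ 2 + s ^+ 2) * (v i * v' i + v j * v' j) by ring.
  by rewrite cs mul1r.
by apply: eq_bigr => k /andP[ki kj]; rewrite (negbTE ki) (negbTE kj).
Qed.

(** Successive Givens rotations in the planes [(p, j)] for [j] in [l] move the weight of [g] onto
    [p]. The last two conclusions say that a vector supported off [p :: l] is left alone, which a
    second elimination relies on. *)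
Lemma eliminate (p : I) (l : seq I) Z g : p \notin l -> uniq l -> iid_gauss P Z ->
  exists Z' L, [/\ iid_gauss P Z', iso_change Z Z' L,
    (forall k, k \in l -> L g k = 0),
    (forall v k, k \notin p :: l -> L v k = v k) &
    (forall v, (forall k, k \in p :: l -> v k = 0) -> forall k, k \in p :: l -> L v k = 0)].
Proof.
elim: l Z g => [|j l IH] Z g pl ul iZ.
  by exists Z, id; split => //; split.
move: pl; rewrite inE negb_or => /andP[pj pl].
move: ul => /= /andP[jl ul].
have [Z1 [L1 [iZ1 c1 z1 f1 n1]]] : exists Z1 L1, [/\ iid_gauss P Z1, iso_change Z Z1 L1,
    L1 g j = 0, (forall v k, k != p -> k != j -> L1 v k = v k) &
    (forall v, v p = 0 -> v j = 0 -> L1 v p = 0 /\ L1 v j = 0)].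
  have [gj0|gj0] := eqVneq (g j) 0.
    by exists Z, id; split => //; split.
  pose n := Num.sqrt (g p ^+ 2 + g j ^+ 2).
  have n2 : n ^+ 2 = g p ^+ 2 + g j ^+ 2 by rewrite sqr_sqrtr// addr_ge0 ?sqr_ge0.
  have gj2 : 0 < g j ^+ 2 by rewrite lt_def sqrf_eq0 gj0 sqr_ge0.
  have n0 : n != 0 by rewrite -sqrf_eq0 n2 gt_eqF// ltr_wpDl ?sqr_ge0.
  pose c := g p / n; pose s := g j / n.
  have cs : c ^+ 2 + s ^+ 2 = 1.
    by rewrite !exprMn -mulrDl -n2 exprVn divff// sqrf_eq0.
  (* Since [g j != 0], the sine [s] is nonzero. *)
  have c1 : c != -1.
    apply/eqP => cE; move: cs; rewrite cE sqrrN expr1n => /eqP.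
    rewrite -subr_eq0 addrAC subrr add0r sqrf_eq0 mulf_eq0 (negbTE gj0) invr_eq0.
    by rewrite (negbTE n0).
  have jp : j != p by rewrite eq_sym.
  do 2 eexists; split; [exact: (iid_givens pj cs c1 iZ)|exact: (iso_givens Z pj cs)| | |].
  - by rewrite /= (negbTE jp) eqxx /c /s; field.
  - by move=> v k kp kj; rewrite /= (negbTE kp) (negbTE kj).
  - by move=> v vp vj; rewrite /= eqxx (negbTE jp) eqxx vp vj !mulr0 addr0.
have [Z2 [L2 [iZ2 c2 z2 f2 n2]]] := IH Z1 (L1 g) pl ul iZ1.
exists Z2, (L2 \o L1); split => //.
- exact: iso_change_comp c1 c2.
- move=> k; rewrite inE => /orP[/eqP ->|kl] /=; last exact: z2.
  by rewrite f2 ?z1// inE negb_or jl andbT eq_sym.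
- move=> v k; rewrite !inE !negb_or => /and3P[kp kj kl] /=.
  by rewrite f2 ?inE ?negb_or ?kp// f1.
- move=> v v0 k.
  have vp : v p = 0 by apply: v0; rewrite inE eqxx.
  have vj : v j = 0 by apply: v0; rewrite !inE eqxx orbT.
  have [L1p L1j] := n1 v vp vj.
  have vl i : i \in l -> L1 v i = 0.
    move=> il; rewrite f1; first by apply: v0; rewrite !inE il !orbT.
      by apply: contraNneq pl => <-.
    by apply: contraNneq jl => <-.
  have H := n2 (L1 v).
  rewrite !inE => /or3P[/eqP ->|/eqP ->|kl] /=.
  - by apply: H; rewrite ?inE ?eqxx// => i; rewrite inE => /orP[/eqP ->//|/vl].
  - by rewrite f2 ?L1j// inE negb_or jl andbT eq_sym.
  - apply: H; rewrite ?inE ?kl ?orbT// => i; rewrite inE => /orP[/eqP ->//|/vl//].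
Qed.

Lemma lincomb1 v Z (p : I) w : (forall k, k != p -> v k = 0) -> lincomb v Z w = v p *: Z p w.
Proof.
move=> v0; rewrite /lincomb (bigD1 p)//= big1 ?addr0// => k kp.
by rewrite v0// scale0r.
Qed.

Lemma lincomb2 v Z (p q : I) w : p != q -> (forall k, k != p -> k != q -> v k = 0) ->
  lincomb v Z w = v p *: Z p w + v q *: Z q w.
Proof.
move=> pq v0; rewrite /lincomb (bigD1 p)//= (bigD1 q)//=; last by rewrite eq_sym.
by rewrite big1 ?addr0// => k /andP[kp kq]; rewrite v0// scale0r.
Qed.

(** A QR decomposition of two vectors: the first elimination brings [x] onto [p], the second, with
    pivot [q] and away from [p], brings [y] onto [p] and [q] without disturbing [x]. The
    coefficients are then read off the Gram matrix. *)
Lemma reduce2 (p q : I) Z x y : p != q -> iid_gauss P Z ->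
  exists Z', iid_gauss P Z' /\ exists a b c, [/\
    forall w, lincomb x Z w = a *: Z' p w,
    forall w, lincomb y Z w = b *: Z' p w + c *: Z' q w,
    a ^+ 2 = \sum_i x i ^+ 2, a * b = \sum_i x i * y i & b ^+ 2 + c ^+ 2 = \sum_i y i ^+ 2].
Proof.
move=> pq iZ; have qp : q != p by rewrite eq_sym.
pose l1 := [seq k <- enum I | k != p].
pose l2 := [seq k <- enum I | (k != p) && (k != q)].
have pl1 : p \notin l1 by rewrite mem_filter eqxx.
have ql2 : q \notin l2 by rewrite mem_filter eqxx andbF.
have [Z1 [L1 [i1 [s1 g1] z1 _ _]]] := eliminate x pl1 (filter_uniq _ (enum_uniq I)) iZ.
have [Z2 [L2 [i2 [s2 g2] z2 f2 n2]]] := eliminate (L1 y) ql2 (filter_uniq _ (enum_uniq I)) i1.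
have x1 k : k != p -> L1 x k = 0 by move=> kp; apply: z1; rewrite mem_filter kp mem_enum.
have pnl : p \notin q :: l2 by rewrite inE negb_or pq mem_filter eqxx.
have x2 k : k != p -> L2 (L1 x) k = 0.
  move=> kp; apply: n2.
    move=> i; rewrite inE => /orP[/eqP ->|]; first exact: x1.
    by rewrite mem_filter => /andP[/andP[ip _] _]; exact: x1.
  by rewrite inE; case: eqVneq => //= kq; rewrite mem_filter kp kq mem_enum.
have y2 k : k != p -> k != q -> L2 (L1 y) k = 0.
  by move=> kp kq; apply: z2; rewrite mem_filter kp kq mem_enum.
exists Z2; split => //; exists (L2 (L1 x) p), (L2 (L1 y) p), (L2 (L1 y) q).
have sum1 (F : I -> R) : (forall k, k != p -> F k = 0) -> \sum_k F k = F p.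
  by move=> F0; rewrite (bigD1 p)//= big1 ?addr0// => k kp; exact: F0.
split.
- by move=> w; rewrite s1 s2 (lincomb1 _ _ x2).
- by move=> w; rewrite s1 s2 (lincomb2 _ _ pq y2).
- have -> : \sum_i x i ^+ 2 = \sum_i L2 (L1 x) i * L2 (L1 x) i by rewrite -g2 -g1; apply: eq_bigr => i _; rewrite expr2.
  by rewrite sum1// => k kp; rewrite x2// mul0r.
- by rewrite g1 g2 sum1// => k kp; rewrite x2// mul0r.
- have -> : \sum_i y i ^+ 2 = \sum_i L2 (L1 y) i * L2 (L1 y) i by rewrite -g2 -g1; apply: eq_bigr => i _; rewrite expr2.
  rewrite (bigD1 p)//= (bigD1 q)//= big1 ?addr0 -?expr2// => k /andP[kp kq].
  by rewrite y2// mul0r.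
Qed.

Lemma reduce_form (p : I) Z h : iid_gauss P Z ->
  exists Z' L, [/\ iid_gauss P Z', iso_change Z Z' L & forall k, k != p -> L h k = 0].
Proof.
move=> iZ; pose l := [seq k <- enum I | k != p].
have pl : p \notin l by rewrite mem_filter eqxx.
have [Z1 [L1 [i1 s1 z1 _ _]]] := eliminate h pl (filter_uniq _ (enum_uniq I)) iZ.
by exists Z1, L1; split => // k kp; apply: z1; rewrite mem_filter kp mem_enum.
Qed.

End elimination.

(** * Separating one Gaussian coordinate from the others *)

Section law.
Context d d' (T : measurableType d) (U : measurableType d') (R : realType).
Variables (P : probability T R) (f : T -> U) (mf : measurable_fun setT f).

Definition law (A : set U) : \bar R := image_measure P mf A.

HB.instance Definition _ := isMeasure.Build _ _ _ law
  (measure0 (image_measure P mf)) (measure_ge0 (image_measure P mf))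
  (@measure_semi_sigma_additive _ _ _ (image_measure P mf)).

Lemma law_setT : law setT = 1%E.
Proof. by rewrite /law (image_measureE P mf) preimage_setT; exact: probability_setT. Qed.

HB.instance Definition _ := Measure_isProbability.Build _ _ R law law_setT.

End law.

Section peel.
Variables (R : realType) (I : finType).
Local Notation V := (R * R)%type.

(** A pi-system containing the whole space; measures on [VI] are compared on it. *)
Definition rects : set (set (I -> V)) :=
  [set X | exists B : I -> set V, (forall i, measurable (B i)) /\
     X = [set v | forall i, B i (v i)]].

Definition VI := g_sigma_algebraType rects.

Lemma measurable_coord (i : I) : measurable_fun setT (fun v : VI => v i).
Proof.
move=> _ A mA; rewrite setTI; apply: sub_sigma_algebra.
exists (fun k => if k == i then A else setT); split.
  by move=> k; case: ifP.
apply/seteqP; split => v /=; last by move=> /(_ i); rewrite eqxx.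
by move=> Av k; case: eqVneq => // ->.
Qed.

Lemma measurable_toVI (d : measure_display) (W : measurableType d) (f : W -> I -> V) :
  (forall i, measurable_fun setT (fun w => f w i)) ->
  measurable_fun setT (f : W -> VI).
Proof.
move=> mf; apply: (@measurability _ _ _ VI setT f rects) => //.
move=> _ [X [B [mB ->]] <-]; rewrite setTI.
rewrite (_ : _ @^-1` _ = \bigcap_(i in [set: I]) ((fun w => f w i) @^-1` B i)); last first.
  by apply/seteqP; split => w H i; [move=> _|]; exact: H.
apply: fin_bigcap_measurable; first exact: finite_finset.
by move=> i _; rewrite -[X in measurable X]setTI; exact: mf.
Qed.

Variables (d : measure_display) (T : measurableType d) (P : probability T R).
Implicit Types (Z : I -> T -> V).

(** Zeroing a coordinate keeps the index type; for the constant coefficient it turns [H] into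
    [H - A 0]. *)
Definition drop_coord Z (i : I) (w : T) : VI := fun k => if k == i then 0 else Z k w.

Lemma measurable_drop_coord Z i : (forall k, measurable_fun setT (Z k)) ->
  measurable_fun setT (drop_coord Z i).
Proof.
move=> mZ; apply: measurable_toVI => k; rewrite /drop_coord.
by case: eqVneq => // _; exact: mZ.
Qed.

(** The coordinate [Z i] is Gaussian and independent of the rest, so their joint law is a product,
    as is checked on rectangles; Tonelli then integrates [Z i] first. *)
Lemma peel Z (i : I) (Psi : V * VI -> \bar R) : iid_gauss P Z ->
  measurable_fun setT Psi -> (forall x, 0 <= Psi x)%E ->
  (\int[P]_w Psi (Z i w, drop_coord Z i w) =
   \int[P]_w \int[@gam R]_a Psi (a, drop_coord Z i w))%E.
Proof.
move=> [mZ Zlaw] mPsi Psi0.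
have md := measurable_drop_coord i mZ.
have mp : measurable_fun setT (fun w => (Z i w, drop_coord Z i w)) by exact: measurable_fun_pair.
pose nu : probability VI R := law P md.
have rectI : setI_closed rects.
  move=> _ _ [B [mB ->]] [C [mC ->]]; exists (fun k => B k `&` C k); split.
    by move=> k; exact: measurableI.
  apply/seteqP; split => v /=; first by move=> [h1 h2] k; split.
  by move=> h; split => k; have [] := h k.
have rectT : rects setT by exists (fun=> setT); split => //; apply/seteqP; split.
have claw A S : measurable A -> measurable S ->
    P [set w | A (Z i w) /\ S (drop_coord Z i w)] = (@gam R A * nu S)%E.
  move=> mA mS.
  have mE : measurable (Z i @^-1` A) by rewrite -[X in measurable X]setTI; exact: mZ.
  have g0 : 0 <= fine (@gam R A) by exact: fine_ge0.
  pose m := image_measure (mrestr P mE) md.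
  pose m' : {measure set VI -> \bar R} := mscale (NngNum g0) nu.
  have m'E X : m' X = (@gam R A * nu X)%E by rewrite (gam_fine mA).
  transitivity (m S).
    by congr (P _); apply/seteqP; split => w /= [].
  rewrite -m'E; apply: (@measure_unique _ R VI rects (fun=> setT) erefl rectI (fun=> rectT) _ m m') => //.
  - by rewrite bigcup_const.
  - move=> _ [B [mB ->]]; rewrite m'E.
    pose B1 k := if k == i then A else B k.
    (* The dropped coordinate is constantly 0, so the condition [B i] holds for it always or
       never. *)
    pose B2 k := if k == i then (if `[< B i 0 >] then setT else set0 : set V) else B k.
    have mB1 k : measurable (B1 k) by rewrite /B1; case: ifP.
    have mB2 k : measurable (B2 k) by rewrite /B2; case: ifP => // _; case: ifP.
    have nuE : nu [set v | forall k, B k (v k)] = P [set w | forall k, B2 k (Z k w)].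
      congr (P _); apply/seteqP; split => w /= H k.
        rewrite /B2; have := H k; rewrite /drop_coord; case: eqVneq => // -> Bi.
        by rewrite asboolT.
      have := H k; rewrite /B2 /drop_coord; case: eqVneq => // ->.
      by case: asboolP.
    rewrite nuE Zlaw//.
    have [Bi0|Bi0] := pselect (B i 0).
      have -> : m [set v | forall k, B k (v k)] = P [set w | forall k, B1 k (Z k w)].
        congr (P _); apply/seteqP; split => w /=.
          by move=> [H Aw] k; have := H k; rewrite /B1 /drop_coord; case: eqVneq => // ->.
        move=> H; split; last by have := H i; rewrite /B1 eqxx.
        by move=> k; have := H k; rewrite /B1 /drop_coord; case: eqVneq => // ->.
      rewrite Zlaw// (bigD1 i)//= [in RHS](bigD1 i)//= {1}/B1 eqxx {1}/B2 eqxx asboolT//.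
      rewrite probability_setT mul1e; congr (_ * _)%E.
      by apply: eq_bigr => k ki; rewrite /B1 /B2 (negbTE ki).
    have -> : m [set v | forall k, B k (v k)] = 0%E.
      rewrite -[RHS](measure0 P); congr (P _); apply/seteqP; split => w //= [H _].
      by have := H i; rewrite /drop_coord eqxx.
    by rewrite (bigD1 i)//= {1}/B2 eqxx asboolF// measure0 mul0e mule0.
  - move=> _; rewrite /m (image_measureE (mrestr P mE) md) /mrestr.
    apply: (@le_lt_trans _ _ 1%E); last exact: ltry.
    by apply: probability_le1; apply: measurableI; [exact: measurableT|exact: mE].
have E X : measurable X -> image_measure P mp X = ((@gam R) \x nu)%E X.
  apply: measure_rect_unique.
    apply: (@le_lt_trans _ _ 1%E); last exact: ltry.
    by rewrite (image_measureE P mp) preimage_setT; apply: probability_le1; exact: measurableT.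
  move=> A S mA mS; transitivity (@gam R A * nu S)%E; last by rewrite -product_measure1E.
  by rewrite -claw.
rewrite -(ge0_integral_image P mp mPsi Psi0).
rewrite (eq_measure_integral ((@gam R) \x nu)%E); last by move=> A mA _; exact: E.
rewrite fubini_tonelli2//.
transitivity (\int[image_measure P md]_v \int[@gam R]_a Psi (a, v))%E; first by [].
rewrite (ge0_integral_image P md)//.
- exact: measurable_fun_fubini_tonelli_G.
- by move=> v; apply: integral_ge0.
Qed.

End peel.

(** * Expectations of Gaussian quadratic forms in absolute value *)

Section quadratic_gaussian.
Variable R : realType.
Local Notation V := (R * R)%type.
Local Notation l2 := (@leb2 R).
Local Notation gam := (@gam R).
Local Notation rho := (@rho R).

Definition sq (p : V) : R := p.1 ^+ 2 + p.2 ^+ 2.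
Definition dotp (p q : V) : R := p.1 * q.1 + p.2 * q.2.

(** By [sq_lin], this is [| |X|^2 - |Y|^2 |] for [X = a p], [Y = b p + c q], with [A1 = a^2 - b^2],
    [A2 = c^2], [A3 = 2 b c]. *)
Definition qabs (A1 A2 A3 : R) (w : V * V) : R :=
  `|A1 * sq w.1 - A2 * sq w.2 - A3 * dotp w.1 w.2|.
Definition phi (A1 A2 A3 : R) : \bar R := (\int[gam \x gam]_w (qabs A1 A2 A3 w)%:E)%E.

(* The expectation of [| |X|^2 - |Y|^2 |] for a circular Gaussian pair with real
   covariances [s11 > 0], [s12], [s22]. *)
Definition Phi (s11 s12 s22 : R) : \bar R :=
  let b := s12 ^+ 2 / s11 in phi (s11 - b) (s22 - b) (2 * Num.sqrt (b * (s22 - b))).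

Lemma sq_ge0 p : 0 <= sq p. Proof. by rewrite addr_ge0 ?sqr_ge0. Qed.

Lemma sqZ a p : sq (a *: p) = a ^+ 2 * sq p.
Proof. by case: p => x y; rewrite /sq /= /GRing.scale/=; ring. Qed.

Lemma sq_lin a b c p q : sq (a *: p) - sq (b *: p + c *: q) =
  (a ^+ 2 - b ^+ 2) * sq p - c ^+ 2 * sq q - (2 * (b * c)) * dotp p q.
Proof. by case: p => x y; case: q => z t; rewrite /sq /dotp /= /GRing.scale/=; ring. Qed.

Lemma sq_nc p : sq p = nc (cx p) ^+ 2. Proof. by rewrite nc_sqr. Qed.

Lemma measurable_sq d (W : measurableType d) (f : W -> V) :
  measurable_fun setT f -> measurable_fun setT (fun w => sq (f w)).
Proof.
move=> mf; apply: measurable_funD; apply: measurable_funX; exact: measurableT_comp.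
Qed.

Lemma measurable_dotp d (W : measurableType d) (f g : W -> V) :
  measurable_fun setT f -> measurable_fun setT g ->
  measurable_fun setT (fun w => dotp (f w) (g w)).
Proof.
by move=> mf mg; apply: measurable_funD; apply: measurable_funM; exact: measurableT_comp.
Qed.

Lemma measurable_qabs A1 A2 A3 : measurable_fun setT (qabs A1 A2 A3).
Proof.
apply: measurableT_comp => //; apply: measurable_funB; first apply: measurable_funB.
- by apply: measurable_funM => //; exact: measurable_sq.
- by apply: measurable_funM => //; exact: measurable_sq.
- by apply: measurable_funM => //; exact: measurable_dotp.
Qed.

Lemma gam_scale (k : R) (F : V -> \bar R) : k != 0 -> measurable_fun setT F ->
  (forall p, 0 <= F p)%E ->
  (\int[l2]_p F (k *: p) = ((k ^+ 2)^-1)%:E * \int[l2]_p F p)%E.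
Proof.
move=> k0 mF F0; have := @lebesgue2_linear R k 0 0 k (0, 0) F.
rewrite mul0r subr0 -expr2 ger0_norm ?sqr_ge0// => <- //; last by rewrite sqrf_eq0.
apply: eq_integral => -[x y] _; congr F.
by congr pair => /=; rewrite /GRing.scale/=; ring.
Qed.

Lemma measurable_scale (k : R) : measurable_fun setT (fun p : V => k *: p).
Proof.
have mi : measurable_fun [set: V] id by exact: measurable_id.
have := @measurable_fun_lin R _ V k 0 id id mi mi.
by under eq_fun do rewrite scale0r addr0.
Qed.

Lemma gam_opp (F : V -> \bar R) : measurable_fun setT F -> (forall p, 0 <= F p)%E ->
  (\int[gam]_p F (-1 *: p) = \int[gam]_p F p)%E.
Proof.
move=> mF F0; have mF1 := measurableT_comp mF (measurable_scale (-1)).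
rewrite !ge0_integral_gam//.
have mr : measurable_fun setT (fun p => F p * (rho p)%:E)%E.
  by apply: emeasurable_funM => //; apply/measurable_EFinP; exact: measurable_rho.
have n1 : -1 != 0 :> R by rewrite oppr_eq0 oner_eq0.
have r0 p : (0 <= F p * (rho p)%:E)%E by rewrite mule_ge0// lee_fin rho_ge0.
have := gam_scale n1 mr r0; rewrite sqrrN expr1n invr1 mul1e => <-.
apply: eq_integral => p _; congr (_ * _%:E)%E.
by rewrite /rho -/(sq p) -/(sq (-1 *: p)) sqZ sqrrN expr1n mul1r.
Qed.

(** Replace the second Gaussian by its opposite. Covariances determine [b c] only up to sign, and
    this symmetry makes [Phi] well defined from them. *)
Lemma phi_even A1 A2 A3 : phi A1 A2 (- A3) = phi A1 A2 A3.
Proof.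
have mq A : measurable_fun setT (fun w : V * V => (qabs A1 A2 A w)%:E).
  by apply/measurable_EFinP; exact: measurable_qabs.
rewrite /phi !fubini_tonelli1//; do ?[by move=> w; rewrite lee_fin normr_ge0].
apply: eq_integral => p _; rewrite /fubini_F.
rewrite -[RHS](@gam_opp (fun q => (qabs A1 A2 A3 (p, q))%:E)).
- apply: eq_integral => q _; congr (`|_|%:E); rewrite /= sqZ sqrrN expr1n mul1r.
  congr (_ - _); case: p => a b; case: q => c e; rewrite /dotp/= /GRing.scale/=; ring.
- by apply: measurableT_comp (mq _) _; exact: measurable_pair1.
- by move=> q; rewrite lee_fin normr_ge0.
Qed.

Lemma phiZ (k A1 A2 A3 : R) : 0 <= k ->
  phi (k * A1) (k * A2) (k * A3) = (k%:E * phi A1 A2 A3)%E.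
Proof.
move=> k0; rewrite /phi -ge0_integralZl//.
- apply: eq_integral => w _; rewrite -EFinM; congr EFin.
  by rewrite /qabs -{4}(ger0_norm k0) -normrM; congr (`|_|); ring.
- by apply/measurable_EFinP; exact: measurable_qabs.
- by move=> w _; rewrite lee_fin normr_ge0.
Qed.

(** [rho p * rho (h p)] equals [rho (sqrt (1 + h^2) p) / pi]; undoing the dilation of the plane
    costs the factor [1 + h^2]. *)
Lemma gauss_tilt (h : R) (F : V -> \bar R) : measurable_fun setT F ->
  (forall p, 0 <= F p)%E ->
  (\int[gam]_p (F p * (rho (h *: p : V))%:E) =
   ((pi * (1 + h ^+ 2))^-1)%:E * \int[gam]_p F ((Num.sqrt (1 + h ^+ 2))^-1 *: p))%E.
Proof.
move=> mF F0; set K := 1 + h ^+ 2.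
have K0 : 0 < K by rewrite ltr_pwDl ?sqr_ge0.
pose k := Num.sqrt K; have k0 : 0 < k by rewrite sqrtr_gt0.
have kK : k ^+ 2 = K by rewrite sqr_sqrtr// ltW.
have mr (c : R) : measurable_fun setT (fun p : V => (rho (c *: p))%:E).
  apply/measurable_EFinP; exact: measurableT_comp (@measurable_rho R) (measurable_scale c).
have r0 p : (0 <= (rho p)%:E)%E by rewrite lee_fin rho_ge0.
pose G (p : V) := (F p * (rho (k *: p))%:E)%E.
have mG : measurable_fun setT G by exact: emeasurable_funM.
have G0 p : (0 <= G p)%E by rewrite mule_ge0.
rewrite !ge0_integral_gam; last 4 first.
- exact: measurableT_comp mF (measurable_scale _).
- by move=> p; exact: F0.
- exact: emeasurable_funM.
- by move=> p; rewrite mule_ge0.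
transitivity (\int[l2]_p ((pi^-1)%:E * G p))%E.
  apply: eq_integral => p _; rewrite /G -muleA [RHS]muleCA; congr (_ * _)%E.
  rewrite -!EFinM; congr EFin; rewrite /rho -/(sq p) -/(sq (h *: p)) -/(sq (k *: p)).
  rewrite !sqZ kK mulrACA -expRD -opprD [RHS]mulrCA mulrA [RHS]mulrA.
  by congr (expR (- _) / _ / _); rewrite /K; ring.
rewrite ge0_integralZl//; last by rewrite lee_fin invr_ge0 pi_ge0.
rewrite -[X in _ = (_ * X)%E](_ : (\int[l2]_p G (k^-1 *: p))%E = _); last first.
  apply: eq_integral => p _; rewrite /G scalerA divff ?gt_eqF// scale1r//.
rewrite gam_scale// ?invr_eq0 ?gt_eqF// muleA -EFinM; congr (_%:E * _)%E.
by rewrite exprVn invrK kK invfM -mulrA mulVf ?mulr1// gt_eqF.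
Qed.

End quadratic_gaussian.

Section gaussian_kernel.
Variables (R : realType) (d : measure_display) (T : measurableType d)
  (P : probability T R) (I : finType).
Local Notation V := (R * R)%type.
Local Notation gam := (@gam R).
Local Notation rho := (@rho R).
Implicit Types (Z : I -> T -> V) (x y h : I -> R).

Lemma iid_one Z (p : I) (g : V -> \bar R) : iid_gauss P Z -> measurable_fun setT g ->
  (forall v, 0 <= g v)%E -> (\int[P]_w g (Z p w) = \int[gam]_a g a)%E.
Proof.
move=> iZ mg g0.
have mg1 : measurable_fun setT (fun u : V * VI R I => g u.1) by exact: measurableT_comp.
rewrite (@peel R I _ _ P Z p (fun u => g u.1) iZ mg1 (fun u => g0 u.1))/=.
rewrite integral_cst//.
by rewrite [X in (_ * X)%E](@probability_setT _ _ _ P) mule1.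
Qed.

Lemma iid_pair Z (p q : I) (g : V * V -> \bar R) : p != q -> iid_gauss P Z ->
  measurable_fun setT g -> (forall v, 0 <= g v)%E ->
  (\int[P]_w g (Z p w, Z q w) = \int[gam \x gam]_a g a)%E.
Proof.
move=> pq iZ mg g0; rewrite fubini_tonelli2//.
have mG : measurable_fun setT (fun b : V => \int[gam]_a g (a, b))%E.
  exact: measurable_fun_fubini_tonelli_G.
rewrite -(iid_one q iZ mG); last by move=> v; apply: integral_ge0.
have dq w : drop_coord Z p w q = Z q w by rewrite /drop_coord eq_sym (negbTE pq).
have := @peel R I _ _ P Z p (fun u => g (u.1, u.2 q)) iZ.
under [X in _ -> _ -> X = _]eq_integral do rewrite /= dq.
under [X in _ -> _ -> _ = X]eq_integral do rewrite /= dq.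
apply=> //; apply: measurableT_comp => //; apply: measurable_fun_pair => //.
exact: (measurableT_comp (@measurable_coord R I q)).
Qed.

Lemma lincomb_peel x Z (p : I) w :
  lincomb x Z w = x p *: Z p w + lincomb x (fun i w' => drop_coord Z p w' i) w.
Proof.
rewrite /lincomb (bigD1 p)//= [in RHS](bigD1 p)//= {1}/drop_coord eqxx scaler0 add0r.
by congr (_ + _); apply: eq_bigr => i ip; rewrite /drop_coord (negbTE ip).
Qed.

Lemma measurable_sumV d' (W : measurableType d') (J : Type) (r : seq J) (X : J -> W -> V) :
  (forall i, measurable_fun setT (X i)) ->
  measurable_fun setT (fun w => \sum_(i <- r) X i w).
Proof.
move=> mX; elim: r => [|i r IH].
  by under eq_fun do rewrite big_nil; exact: measurable_cst.
under eq_fun do rewrite big_cons.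
have := measurable_fun_lin 1 1 (mX i) IH.
by under eq_fun do rewrite !scale1r.
Qed.

Lemma measurable_lincomb d' (W : measurableType d') (X : I -> W -> V) x :
  (forall i, measurable_fun setT (X i)) ->
  measurable_fun setT (fun w => \sum_i x i *: X i w).
Proof.
move=> mX; apply: measurable_sumV => i.
exact: measurableT_comp (measurable_scale (x i)) (mX i).
Qed.

Lemma kernel_phi (p q : I) Z x y : p != q -> iid_gauss P Z -> 0 < \sum_i x i ^+ 2 ->
  (\int[P]_w (`|sq (lincomb x Z w) - sq (lincomb y Z w)|)%:E =
   Phi (\sum_i x i ^+ 2) (\sum_i x i * y i) (\sum_i y i ^+ 2))%E.
Proof.
move=> pq iZ x0; have [Z' [iZ' [a [b [c [Ex Ey aa ab bc]]]]]] := reduce2 x y pq iZ.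
transitivity (phi (a ^+ 2 - b ^+ 2) (c ^+ 2) (2 * (b * c))).
  rewrite /phi -(iid_pair pq iZ').
  - by apply: eq_integral => w _; rewrite Ex Ey sq_lin.
  - by apply/measurable_EFinP; exact: measurable_qabs.
  - by move=> w; rewrite lee_fin normr_ge0.
rewrite -aa -ab -bc /Phi.
have a0 : a ^+ 2 != 0 by rewrite aa gt_eqF.
have -> : (a * b) ^+ 2 / a ^+ 2 = b ^+ 2 by rewrite exprMn mulrAC divff ?mul1r.
have -> : b ^+ 2 + c ^+ 2 - b ^+ 2 = c ^+ 2 by ring.
rewrite -exprMn sqrtr_sqr.
have [bc0|bc0] := leP 0 (b * c); first by rewrite ger0_norm.
by rewrite ltr0_norm// mulrN phi_even.
Qed.

(** [s11], [s12], [s22] are the Schur complements that describe conditioning on a vanishing sum of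
    [lincomb h Z] and one further standard Gaussian, whose density is [rho] and whose variance is
    the [1] in [K]. *)
Lemma kernel_gauss (p q : I) Z h x y : p != q -> iid_gauss P Z ->
  let K := 1 + \sum_i h i ^+ 2 in
  let s11 := \sum_i x i ^+ 2 - (\sum_i x i * h i) ^+ 2 / K in
  let s12 := \sum_i x i * y i - (\sum_i x i * h i) * (\sum_i y i * h i) / K in
  let s22 := \sum_i y i ^+ 2 - (\sum_i y i * h i) ^+ 2 / K in
  0 < s11 ->
  (\int[P]_w ((`|sq (lincomb x Z w) - sq (lincomb y Z w)|)%:E * (rho (lincomb h Z w))%:E) =
   ((pi * K)^-1)%:E * Phi s11 s12 s22)%E.
Proof.
move=> pq iZ; have [Z' [L [iZ' [c1 c2] h0]]] := reduce_form p h iZ.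
move=> K s11 s12 s22 s0.
have hK : 1 + L h p ^+ 2 = K.
  rewrite /K; congr (_ + _); transitivity (\sum_i L h i * L h i).
    by rewrite (bigD1 p)//= big1 ?addr0 -?expr2// => k kp; rewrite h0// mul0r.
  by rewrite -c2; apply: eq_bigr => i _; rewrite expr2.
have K0 : 0 < K by rewrite -hK ltr_pwDl ?sqr_ge0.
pose k := (Num.sqrt K)^-1.
have k2 : k ^+ 2 = K^-1 by rewrite exprVn sqr_sqrtr// ltW.
(* Now [h] is carried by the coordinate [p] alone. Since [1 - k ^+ 2 = L h p ^+ 2 / K], shrinking
   this coordinate by [k] subtracts exactly the rank-one correction from the Gram matrix. *)
pose tw v i := if i == p then k * L v i else L v i.
have tw2 v v' : \sum_i tw v i * tw v' i =
    \sum_i v i * v' i - (\sum_i v i * h i) * (\sum_i v' i * h i) / K.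
  have vh u : \sum_i u i * h i = L u p * L h p.
    by rewrite c2 (bigD1 p)//= big1 ?addr0// => i ip; rewrite h0// mulr0.
  rewrite !vh c2 (bigD1 p)//= [in RHS](bigD1 p)//= {1 2}/tw eqxx.
  rewrite (eq_bigr (fun i => L v i * L v' i)); last first.
    by move=> i ip; rewrite /tw (negbTE ip).
  rewrite [RHS]addrAC; congr (_ + _).
  have -> : k * L v p * (k * L v' p) = k ^+ 2 * (L v p * L v' p) by ring.
  have -> : L v p * L h p * (L v' p * L h p) = L v p * L v' p * L h p ^+ 2 by ring.
  have -> : L h p ^+ 2 = K - 1 by rewrite -hK; ring.
  by rewrite k2; field; rewrite gt_eqF.
have twE (v : I -> R) (Y : I -> T -> V) w : lincomb (tw v) Y w =
    L v p *: (k *: Y p w) + lincomb (L v) (fun i w' => drop_coord Y p w' i) w.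
  rewrite (lincomb_peel _ _ p) /tw eqxx scalerA mulrC; congr (_ + _).
  rewrite /lincomb; apply: eq_bigr => i _; rewrite /drop_coord.
  by case: eqVneq => // _; rewrite !scaler0.
pose F (v : VI R I) (a : V) : \bar R := (`|sq (L x p *: a + \sum_i L x i *: v i)
  - sq (L y p *: a + \sum_i L y i *: v i)|)%:E.
have mV (u : I -> R) d' (W : measurableType d') (f : W -> VI R I) (g : W -> V) :
    measurable_fun setT f -> measurable_fun setT g ->
    measurable_fun setT (fun w => u p *: g w + \sum_i u i *: f w i).
  move=> mf mg.
  have ms : measurable_fun setT (fun w => \sum_i u i *: f w i).
    by apply: measurable_lincomb => i; exact: (measurableT_comp (@measurable_coord R I i) mf).
  by have := measurable_fun_lin (u p) 1 mg ms; under eq_fun do rewrite scale1r.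
have mF d' (W : measurableType d') (f : W -> VI R I) (g : W -> V) :
    measurable_fun setT f -> measurable_fun setT g ->
    measurable_fun setT (fun w => F (f w) (g w)).
  move=> mf mg; apply/measurable_EFinP; apply: measurableT_comp => //.
  by apply: measurable_funB; apply: measurable_sq; exact: mV.
have F0 v a : (0 <= F v a)%E by rewrite lee_fin.
have r0 a : (0 <= (rho a)%:E)%E by rewrite lee_fin rho_ge0.
have mr : measurable_fun setT (fun a : V => (rho (L h p *: a))%:E).
  apply/measurable_EFinP; exact: measurableT_comp (@measurable_rho R) (measurable_scale _).
transitivity (\int[P]_w \int[gam]_a
    (F (drop_coord Z' p w) a * (rho (L h p *: a))%:E))%E.
  rewrite -(@peel R I _ _ P Z' p (fun u => F u.2 u.1 * (rho (L h p *: u.1))%:E)%E)//=.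
  - apply: eq_integral => w _; rewrite !c1 (lincomb1 _ _ h0); congr (_ * _)%E.
    by rewrite !(lincomb_peel _ Z' p).
  - apply: emeasurable_funM; first exact: mF.
    exact: (measurableT_comp mr).
  - by move=> u; rewrite mule_ge0.
have mFk : measurable_fun setT (fun u : V * VI R I => F u.2 (k *: u.1)).
  by apply: mF => //; exact: measurableT_comp (measurable_scale k) _.
transitivity (\int[P]_w (((pi * K)^-1)%:E * \int[gam]_a F (drop_coord Z' p w) (k *: a)))%E.
  by apply: eq_integral => w _; rewrite gauss_tilt ?hK//; exact: mF.
rewrite ge0_integralZl//; last 3 first.
- have mG : measurable_fun setT (fun v : VI R I => \int[gam]_a F v (k *: a))%E.
    exact: (@measurable_fun_fubini_tonelli_G _ _ _ _ _ gam _ mFk).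
  exact: measurableT_comp mG (measurable_drop_coord p iZ'.1).
- by move=> w _; apply: integral_ge0.
- by rewrite lee_fin invr_ge0 mulr_ge0 ?pi_ge0// ltW.
congr (_ * _)%E; rewrite -(@peel R I _ _ P Z' p (fun u => F u.2 (k *: u.1)))//.
have E v v' : \sum_i tw v i * tw v' i = \sum_i v i * v' i - (\sum_i v i * h i) * (\sum_i v' i * h i) / K.
  exact: tw2.
have E2 v : \sum_i tw v i ^+ 2 = \sum_i v i ^+ 2 - (\sum_i v i * h i) ^+ 2 / K.
  transitivity (\sum_i tw v i * tw v i); first by apply: eq_bigr => i _; rewrite expr2.
  by rewrite E; congr (_ - _); apply: eq_bigr => i _; rewrite expr2.
rewrite /s11 /s12 /s22 -!E2 -E -(kernel_phi _ pq iZ') ?E2//.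
by apply: eq_integral => w _; rewrite !twE.
Qed.

End gaussian_kernel.

Section measurable_inverse.
Variable R : realType.

Lemma measurable_inv d (W : measurableType d) (f : W -> R) :
  measurable_fun setT f -> measurable_fun setT (fun w => (f w)^-1).
Proof.
move=> mf; suff mi : measurable_fun [set: R] (fun x : R => x^-1) by exact: measurableT_comp.
have posE (x : R) : 0 < x -> x^-1 = expR (- ln x).
  by move=> x0; rewrite expRN lnK// posrE.
rewrite (_ : (fun x : R => x^-1) = fun x => if 0 < x then expR (- ln x)
    else if x < 0 then - expR (- ln (- x)) else 0); last first.
  apply/funext => x; case: ltgtP => [x0|x0|<-]; last by rewrite invr0.
  - exact: posE.
  - by rewrite -posE ?oppr_gt0// invrN opprK.
apply: measurable_fun_ifT.
- exact: measurable_fun_ltr.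
- by apply: measurableT_comp => //; apply: measurableT_comp.
apply: measurable_fun_ifT => //.
- exact: measurable_fun_ltr.
- by do !apply: measurableT_comp => //.
Qed.

Lemma measurable_sqrt d (W : measurableType d) (f : W -> R) :
  measurable_fun setT f -> measurable_fun setT (fun w => Num.sqrt (f w)).
Proof.
move=> mf; apply: measurableT_comp => //.
by apply: continuous_measurable_fun => x; exact: sqrt_continuous.
Qed.

End measurable_inverse.

Section Phi_properties.
Variable R : realType.
Local Notation V := (R * R)%type.
Local Notation l2 := (@leb2 R).
Local Notation gam := (@gam R).
Local Notation rho := (@rho R).

(** The parameter joins the two Gaussian variables on [W * V * V], and measurability of partial
    integrals is applied twice. *)
Lemma measurable_Phi d (W : measurableType d) (s11 s12 s22 : W -> R) :
  measurable_fun setT s11 -> measurable_fun setT s12 -> measurable_fun setT s22 ->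
  measurable_fun setT (fun w => Phi (s11 w) (s12 w) (s22 w)).
Proof.
move=> m11 m12 m22; rewrite /Phi.
have mb : measurable_fun setT (fun w => s12 w ^+ 2 / s11 w).
  by apply: measurable_funM; [exact: measurable_funX|exact: measurable_inv].
pose F (u : W * V * V) : \bar R := (qabs (s11 u.1.1 - s12 u.1.1 ^+ 2 / s11 u.1.1)
  (s22 u.1.1 - s12 u.1.1 ^+ 2 / s11 u.1.1)
  (2 * Num.sqrt (s12 u.1.1 ^+ 2 / s11 u.1.1 * (s22 u.1.1 - s12 u.1.1 ^+ 2 / s11 u.1.1)))
  (u.1.2, u.2))%:E.
have F0 u : (0 <= F u)%E by rewrite lee_fin normr_ge0.
have mF : measurable_fun setT F.
  apply/measurable_EFinP; apply: measurableT_comp => //.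
  have m1 (f : W -> R) : measurable_fun setT f ->
      measurable_fun setT (fun u : W * V * V => f u.1.1).
    move=> mf; apply: (measurableT_comp mf).
    exact: (measurableT_comp measurable_fst measurable_fst).
  have mp : measurable_fun setT (fun u : W * V * V => u.1.2).
    exact: (measurableT_comp measurable_snd measurable_fst).
  have mq : measurable_fun setT (fun u : W * V * V => u.2) by exact: measurable_snd.
  apply: measurable_funB; first apply: measurable_funB.
  - apply: measurable_funM; last exact: measurable_sq.
    by apply: (m1 (fun w => s11 w - s12 w ^+ 2 / s11 w)); exact: measurable_funB.
  - apply: measurable_funM; last exact: measurable_sq.
    by apply: (m1 (fun w => s22 w - s12 w ^+ 2 / s11 w)); exact: measurable_funB.
  - apply: measurable_funM; last exact: measurable_dotp.
    apply: (m1 (fun w => 2 * Num.sqrt (s12 w ^+ 2 / s11 w * (s22 w - s12 w ^+ 2 / s11 w)))).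
    apply: measurable_funM => //; apply: measurable_sqrt; apply: measurable_funM => //.
    exact: measurable_funB.
have mG := @measurable_fun_fubini_tonelli_F _ _ _ _ R gam F mF F0.
have G0 u : (0 <= fubini_F gam F u)%E by apply: integral_ge0 => ? _; exact: F0.
have := @measurable_fun_fubini_tonelli_F _ _ _ _ R gam _ mG G0.
apply: eq_measurable_fun => w _; rewrite /phi fubini_tonelli1//.
  by apply/measurable_EFinP; exact: measurable_qabs.
by move=> x; rewrite lee_fin normr_ge0.
Qed.

(** The second moment of a standard complex Gaussian; it enters through its finiteness and
    positivity. *)
Definition g2 : \bar R := (\int[gam]_p (sq p)%:E)%E.

Lemma measurable_EsqT : measurable_fun setT (fun p : V => (sq p)%:E).
Proof. by apply/measurable_EFinP; exact: measurable_sq. Qed.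

Lemma g2_ge0 : (0 <= g2)%E.
Proof. by apply: integral_ge0 => p _; rewrite lee_fin sq_ge0. Qed.

(** From [u <= exp u] at [u = sq p / 2], the integrand is at most twice a dilated Gaussian
    density. *)
Lemma g2_lty : (g2 < +oo)%E.
Proof.
have mr : measurable_fun setT (fun p : V => (rho p)%:E).
  by apply/measurable_EFinP; exact: measurable_rho.
have r0 p : (0 <= (rho p)%:E)%E by rewrite lee_fin rho_ge0.
pose k : R := Num.sqrt 2^-1; have k0 : k != 0 by rewrite gt_eqF// sqrtr_gt0 invr_gt0.
have k2 : k ^+ 2 = 2^-1 by rewrite sqr_sqrtr// invr_ge0.
have I1 : (\int[l2]_p (rho p)%:E = 1)%E.
  have gT : gam setT = 1%E by exact: (@probability_setT _ _ _ gam).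
  transitivity (\int[gam]_p (1%:E : \bar R))%E; last by rewrite integral_cst// mul1e; exact: gT.
  by rewrite ge0_integral_gam//; apply: eq_integral => p _; rewrite mul1e.
have := gam_scale k0 mr r0; rewrite I1 mule1 k2 invrK => I2.
apply: (@le_lt_trans _ _ (2%:E * \int[l2]_p (rho (k *: p))%:E)%E); last by rewrite I2 -EFinM ltry.
rewrite -ge0_integralZl//; last first.
  exact: measurableT_comp mr (measurable_scale k).
rewrite /g2 (ge0_integral_gam measurable_EsqT); last by move=> p; rewrite lee_fin sq_ge0.
apply: ge0_le_integral => //.
- by move=> p _; rewrite mule_ge0// lee_fin sq_ge0.
- by apply: emeasurable_funM => //; exact: measurable_EsqT.
- by apply: emeasurable_funM => //; exact: measurableT_comp mr (measurable_scale k).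
move=> p _; rewrite -!EFinM lee_fin /rho -/(sq p) -/(sq (k *: p)) sqZ k2 !mulrA.
rewrite ler_wpM2r ?invr_ge0 ?pi_ge0//.
have -> : - sq p = - (2^-1 * sq p) + - (2^-1 * sq p) by field.
rewrite expRD mulrA ler_wpM2r ?expR_ge0// expRN ler_pdivrMr ?expR_gt0//.
have := expR_ge1Dx (2^-1 * sq p); lra.
Qed.

Lemma g2_gt0 : (0 < g2)%E.
Proof.
pose c : V := (1, 0); have mh := @measurable_hsq R c 1.
apply: (@lt_le_trans _ _ (\int[l2]_(p in hsq c 1) (expR (- 5) / pi)%:E)%E).
  by rewrite integral_cst// [X in (_ * X)%E](@leb2_hsq R c 1 ler01) expr1n mule1 lte_fin divr_gt0 ?expR_gt0 ?pi_gt0.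
have mF : measurable_fun setT (fun p : V => (sq p)%:E * (rho p)%:E)%E.
  apply: emeasurable_funM; first exact: measurable_EsqT.
  by apply/measurable_EFinP; exact: measurable_rho.
have F0 (p : V) : (0 <= (sq p)%:E * (rho p)%:E)%E.
  by rewrite mule_ge0// lee_fin ?sq_ge0 ?rho_ge0.
rewrite /g2 (ge0_integral_gam measurable_EsqT); last by move=> p; rewrite lee_fin sq_ge0.
apply: (@le_trans _ _ (\int[l2]_(p in hsq c 1) ((sq p)%:E * (rho p)%:E))%E); last first.
  by apply: ge0_subset_integral.
apply: ge0_le_integral => //.
- by move=> p _; rewrite lee_fin divr_ge0 ?expR_ge0 ?pi_ge0.
- exact: measurable_funTS.
move=> [x y] [] /=; rewrite !in_itv/= => /andP[x1 x2] /andP[y1 y2].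
rewrite -EFinM lee_fin /rho -/(sq (x, y)) mulrA ler_wpM2r ?invr_ge0 ?pi_ge0//.
have s1 : 1 <= sq (x, y) by rewrite /sq /=; nra.
have s5 : sq (x, y) <= 5 by rewrite /sq /=; nra.
rewrite -[leLHS]mul1r ler_pM ?expR_ge0//.
by rewrite ler_expR lerN2.
Qed.

Definition G2 : R := fine g2.

Lemma g2E : g2 = G2%:E.
Proof. by rewrite /G2 fineK// ge0_fin_numE ?g2_ge0// g2_lty. Qed.

Lemma G2_gt0 : 0 < G2.
Proof. by rewrite -lte_fin -g2E g2_gt0. Qed.

Lemma int_sq2 (a b : R) : 0 <= a -> 0 <= b ->
  (\int[gam \x gam]_w (a * sq w.1 + b * sq w.2)%:E)%E = ((a + b) * G2)%:E.
Proof.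
move=> a0 b0.
have m1 : measurable_fun setT (fun w : V * V => (sq w.1)%:E).
  by apply/measurable_EFinP; exact: measurable_sq.
have m2 : measurable_fun setT (fun w : V * V => (sq w.2)%:E).
  by apply/measurable_EFinP; exact: measurable_sq.
have s0 p : (0 <= (sq p : R)%:E)%E by rewrite lee_fin sq_ge0.
have gT : gam setT = 1%E by exact: (@probability_setT _ _ _ gam).
have I1 : (\int[gam \x gam]_w (sq w.1)%:E)%E = G2%:E.
  rewrite fubini_tonelli1// -g2E; apply: eq_integral => p _.
  by rewrite /fubini_F /= integral_cst// [X in (_ * X)%E]gT mule1.
have I2 : (\int[gam \x gam]_w (sq w.2)%:E)%E = G2%:E.
  rewrite fubini_tonelli2// -g2E; apply: eq_integral => p _.
  by rewrite /fubini_G /= integral_cst// [X in (_ * X)%E]gT mule1.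
under eq_integral do rewrite EFinD !EFinM.
rewrite ge0_integralD//.
- by rewrite !ge0_integralZl// I1 I2 -!EFinM -EFinD mulrDl.
- by move=> w _; rewrite mule_ge0.
- exact: measurable_funeM.
- by move=> w _; rewrite mule_ge0.
- exact: measurable_funeM.
Qed.

Lemma dotp_le p q : `|dotp p q : R| <= sq p + sq q.
Proof.
case: p => a b; case: q => c e; rewrite /dotp /sq /= ler_norml; apply/andP; split.
  have := sqr_ge0 (a + c); have := sqr_ge0 (b + e).
  have := sqr_ge0 a; have := sqr_ge0 b; have := sqr_ge0 c; have := sqr_ge0 e; lra.
have := sqr_ge0 (a - c); have := sqr_ge0 (b - e).
have := sqr_ge0 a; have := sqr_ge0 b; have := sqr_ge0 c; have := sqr_ge0 e; lra.
Qed.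

Lemma qabs_le A1 A2 A3 (w : V * V) :
  qabs A1 A2 A3 w <= (`|A1| + `|A3|) * sq w.1 + (`|A2| + `|A3|) * sq w.2.
Proof.
have h1 := ler_normB (A1 * sq w.1 - A2 * sq w.2) (A3 * dotp w.1 w.2).
have h2 := ler_normB (A1 * sq w.1) (A2 * sq w.2).
apply: (le_trans h1); move: h2; rewrite !normrM.
rewrite (ger0_norm (sq_ge0 w.1)) (ger0_norm (sq_ge0 w.2)).
have := dotp_le w.1 w.2; have := normr_ge0 A3.
have : 0 <= `|A3| * (sq w.1 + sq w.2 - `|dotp w.1 w.2|).
  by rewrite mulr_ge0// subr_ge0 dotp_le.
lra.
Qed.

Lemma phi_le A1 A2 A3 : (phi A1 A2 A3 <= ((`|A1| + `|A2| + 2 * `|A3|) * G2)%:E)%E.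
Proof.
have -> : (`|A1| + `|A2| + 2 * `|A3|) = (`|A1| + `|A3|) + (`|A2| + `|A3|) :> R by ring.
rewrite -int_sq2 ?addr_ge0//; apply: ge0_le_integral => //.
- by move=> w _; rewrite lee_fin normr_ge0.
- by apply/measurable_EFinP; exact: measurable_qabs.
- apply/measurable_EFinP; apply: measurable_funD; apply: measurable_funM => //;
  exact: measurable_sq.
- by move=> w _; rewrite lee_fin qabs_le.
Qed.

(** Averaging over the two signs of [A3] removes the cross term:
    [|u - v - w| + |u - v + w| >= 2 (u - v)]. The term in [A2] is moved to the other side so that
    all integrands are nonnegative. *)
Lemma phi_ge A1 A2 A3 : 0 <= A1 -> 0 <= A2 -> (((A1 - A2) * G2)%:E <= phi A1 A2 A3)%E.
Proof.
move=> A10 A20.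
have mq A : measurable_fun setT (fun w : V * V => (qabs A1 A2 A w)%:E).
  by apply/measurable_EFinP; exact: measurable_qabs.
have q0 A (w : V * V) : (0 <= (qabs A1 A2 A w)%:E)%E by rewrite lee_fin normr_ge0.
have ml (a b : R) : measurable_fun setT (fun w : V * V => (a * sq w.1 + b * sq w.2)%:E).
  apply/measurable_EFinP; apply: measurable_funD; apply: measurable_funM => //;
  exact: measurable_sq.
have l0 (a b : R) (w : V * V) : 0 <= a -> 0 <= b -> (0 <= (a * sq w.1 + b * sq w.2)%:E)%E.
  by move=> a0 b0; rewrite lee_fin addr_ge0 ?mulr_ge0 ?sq_ge0.
have : ((2 * A1 * G2)%:E <= phi A1 A2 A3 + phi A1 A2 (- A3) + (2 * A2 * G2)%:E)%E.
  have -> : ((2 * A1 * G2)%:E = \int[gam \x gam]_w (2 * A1 * sq w.1 + 0 * sq w.2)%:E)%E.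
    by rewrite int_sq2 ?addr0// mulr_ge0.
  have -> : ((2 * A2 * G2)%:E = \int[gam \x gam]_w (0 * sq w.1 + 2 * A2 * sq w.2)%:E)%E.
    by rewrite int_sq2 ?add0r// mulr_ge0.
  rewrite /phi -ge0_integralD// -ge0_integralD//; last 3 first.
  - by move=> w _; rewrite adde_ge0.
  - exact: emeasurable_funD.
  - by move=> w _; apply: l0 => //; rewrite mulr_ge0.
  apply: ge0_le_integral => //.
  - by move=> w _; apply: l0 => //; rewrite mulr_ge0.
  - by do !apply: emeasurable_funD => //.
  - move=> w _; rewrite -!EFinD lee_fin /qabs !mul0r addr0 add0r mulNr opprK.
    have := ler_norm (A1 * sq w.1 - A2 * sq w.2 - A3 * dotp w.1 w.2).
    have := ler_norm (A1 * sq w.1 - A2 * sq w.2 + A3 * dotp w.1 w.2).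
    lra.
rewrite phi_even; have := phi_le A1 A2 A3.
have : (0 <= phi A1 A2 A3)%E by apply: integral_ge0.
case: (phi A1 A2 A3) => // r; rewrite -?EFinD ?lee_fin => *; lra.
Qed.

Lemma phi_cvg (A1 A2 A3 : R^nat) (a1 a2 a3 : R) :
  A1 @ \oo --> a1 -> A2 @ \oo --> a2 -> A3 @ \oo --> a3 ->
  (fun k => phi (A1 k) (A2 k) (A3 k)) @ \oo --> phi a1 a2 a3.
Proof.
move=> c1 c2 c3.
have bnd (u : R^nat) (l : R) : u @ \oo --> l -> exists2 M, 0 <= M & forall k, `|u k| <= M.
  move=> ul; have /cvg_seq_bounded[M [_ HM]] : cvgn u by apply/cvg_ex; exists l.
  exists (`|M| + 1); first by rewrite addr_ge0.
  by move=> k; apply: HM => //; rewrite ltr_pwDr// ler_norm.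
have [M1 M10 B1] := bnd _ _ c1; have [M2 M20 B2] := bnd _ _ c2; have [M3 M30 B3] := bnd _ _ c3.
have ml (a b : R) : measurable_fun setT (fun w : V * V => a * sq w.1 + b * sq w.2).
  apply: measurable_funD; apply: measurable_funM => //; exact: measurable_sq.
have cM (A : R^nat) (a s : R) : A @ \oo --> a -> (fun k => A k * s) @ \oo --> a * s.
  by move=> h; apply: cvgM h (cvg_cst _).
have [] := @dominated_convergence _ _ R (gam \x gam)%E setT measurableT
  (fun k w => (qabs (A1 k) (A2 k) (A3 k) w)%:E) (fun w => (qabs a1 a2 a3 w)%:E)
  (fun w => ((M1 + M3) * sq w.1 + (M2 + M3) * sq w.2)%:E) => //.
- by move=> k; apply/measurable_EFinP; exact: measurable_qabs.
- by apply/measurable_EFinP; exact: measurable_qabs.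
- apply: aeW => w _; apply: cvg_EFin; first by near=> k.
  apply: (@cvg_norm _ R^o); exact: cvgB (cvgB (cM _ _ _ c1) (cM _ _ _ c2)) (cM _ _ _ c3).
- apply/integrableP; split; first exact/measurable_EFinP.
  have p0 w : 0 <= (M1 + M3) * sq w.1 + (M2 + M3) * sq w.2.
    by apply: addr_ge0; apply: mulr_ge0; rewrite ?sq_ge0// addr_ge0.
  under eq_integral do rewrite gee0_abs ?lee_fin ?p0//.
  by rewrite int_sq2 ?addr_ge0// ltry.
- apply: aeW => w k _; rewrite gee0_abs ?lee_fin ?normr_ge0//.
  apply: (le_trans (qabs_le _ _ _ _)).
  by rewrite lerD// ler_wpM2r ?sq_ge0// lerD.
Unshelve. all: by end_near. Qed.

(** The Cauchy-Schwarz hypothesis gives [b <= s22], and then [sqrt (b (s22 - b)) <= s22 / 2]; in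
    total [phi_le] yields [s11 + 3 s22]. *)
Lemma Phi_le (s11 s12 s22 : R) : 0 < s11 -> s12 ^+ 2 <= s11 * s22 ->
  (Phi s11 s12 s22 <= (4 * (s11 + s22) * G2)%:E)%E.
Proof.
move=> s0 cs; rewrite /Phi; set b := _ / _.
have b0 : 0 <= b by rewrite divr_ge0 ?sqr_ge0// ltW.
have bs : b <= s22 by rewrite ler_pdivrMr// mulrC.
apply: (le_trans (phi_le _ _ _)); rewrite lee_fin ler_wpM2r ?(ltW G2_gt0)//.
have -> : `|s22 - b| = s22 - b by rewrite ger0_norm// subr_ge0.
have -> : `|2 * Num.sqrt (b * (s22 - b))| = 2 * Num.sqrt (b * (s22 - b)).
  by rewrite ger0_norm// mulr_ge0// sqrtr_ge0.
have h : Num.sqrt (b * (s22 - b)) <= s22 / 2.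
  rewrite -[leRHS]ger0_norm; last lra.
  rewrite -sqrtr_sqr ler_wsqrtr//; have := sqr_ge0 (s22 / 2 - b); nra.
have := ler_normB s11 b; rewrite (ger0_norm b0) (ger0_norm (ltW s0)); lra.
Qed.

Lemma Phi_ge (s11 s12 s22 : R) : 0 < s11 -> s12 ^+ 2 <= s11 * s22 -> s22 <= s11 ->
  (((s11 - s22) * G2)%:E <= Phi s11 s12 s22)%E.
Proof.
move=> s0 cs ss; rewrite /Phi; set b := _ / _.
have bs : b <= s22 by rewrite ler_pdivrMr// mulrC.
have -> : s11 - s22 = (s11 - b) - (s22 - b) by ring.
by apply: phi_ge; rewrite subr_ge0// (le_trans bs).
Qed.

Lemma PhiZ (k s11 s12 s22 : R) : 0 < k -> Phi (k * s11) (k * s12) (k * s22) = (k%:E * Phi s11 s12 s22)%E.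
Proof.
move=> k0; rewrite /Phi -phiZ ?(ltW k0)//.
have [->|s0] := eqVneq s11 0.
  by rewrite !mulr0 !invr0 !mulr0 !subr0 !mul0r sqrtr0 !mulr0.
have -> : (k * s12) ^+ 2 / (k * s11) = k * (s12 ^+ 2 / s11).
  by field; rewrite s0 gt_eqF.
rewrite -!mulrBr; congr phi.
have -> : k * (s12 ^+ 2 / s11) * (k * (s22 - s12 ^+ 2 / s11)) =
  k ^+ 2 * (s12 ^+ 2 / s11 * (s22 - s12 ^+ 2 / s11)) by ring.
by rewrite sqrtrM ?sqr_ge0// sqrtr_sqr (ger0_norm (ltW k0)); ring.
Qed.

Lemma Phi_cvg (s11 s12 s22 : R^nat) (a11 a12 a22 : R) : a11 != 0 ->
  s11 @ \oo --> a11 -> s12 @ \oo --> a12 -> s22 @ \oo --> a22 ->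
  (fun k => Phi (s11 k) (s12 k) (s22 k)) @ \oo --> Phi a11 a12 a22.
Proof.
move=> a0 c11 c12 c22.
have cb : (fun k => s12 k ^+ 2 / s11 k) @ \oo --> a12 ^+ 2 / a11.
  by apply: cvgM; [apply: cvgM|apply: cvgV].
apply: phi_cvg; [exact: cvgB|exact: cvgB|].
apply: cvgM; first exact: cvg_cst.
apply: continuous_cvg; first exact: sqrt_continuous.
by apply: cvgM => //; exact: cvgB.
Qed.

End Phi_properties.

(** * Radial integration in the variable [|z|^2] *)

Section radial.
Variable R : realType.
Local Notation V := (R * R)%type.
Local Notation l2 := (@leb2 R).
Local Notation leb := (@lebR R).

Let disc (a : R) := [set p : V | sq p < a].

Let mdisc a : measurable (disc a).
Proof.
have mq : measurable_fun [set: V] (@sq R) by exact: measurable_sq.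
rewrite (_ : disc a = (@sq R) @^-1` `]-oo, a[).
  by rewrite -[X in measurable X]setTI; exact: mq.
by apply/seteqP; split => p; rewrite /disc /= in_itv.
Qed.

Let disc_scale a : 0 < a -> l2 (disc a) = (a%:E * l2 (disc 1))%E.
Proof.
move=> a0; pose k := (Num.sqrt a)^-1.
have k0 : k != 0 by rewrite invr_eq0 sqrtr_eq0 -ltNge.
have k2 : k ^+ 2 = a^-1 by rewrite exprVn sqr_sqrtr// ltW.
rewrite -(setIT (disc a)) -[X in (_ * l2 X)%E]setIT -!integral_indic//.
have mi : measurable_fun setT (fun p : V => (\1_(disc 1) p : R)%:E).
  by apply/measurable_EFinP; exact: measurable_indic.
have i0 (p : V) : (0 <= (\1_(disc 1) p : R)%:E)%E by rewrite lee_fin.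
rewrite -[a in RHS]invrK -k2 -gam_scale//; apply: eq_integral => p _.
congr EFin; rewrite !indicE; congr ((nat_of_bool _)%:R); rewrite /disc.
by apply/idP/idP => /set_mem h; apply/mem_set; move: h; rewrite /= sqZ k2 ltr_pdivrMl// mulr1.
Qed.

Let disc1_lty : (l2 (disc 1) < +oo)%E.
Proof.
pose c : V := (-1, -1); apply: (@le_lt_trans _ _ (l2 (hsq c 2))).
  apply: (le_measure l2); [apply/mem_set; exact: mdisc|apply/mem_set; exact: measurable_hsq|].
  move=> [x y] /=; rewrite /disc /hsq /sq /= => h.
  have := sqr_ge0 x; have := sqr_ge0 y => y0 x0.
  by split; rewrite /= in_itv /=; apply/andP; split; nra.
by rewrite leb2_hsq// ltry.
Qed.

Let disc1_gt0 : (0 < l2 (disc 1))%E.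
Proof.
pose c : V := (0, 0); apply: (@lt_le_trans _ _ (l2 (hsq c 2^-1))).
  by rewrite leb2_hsq ?invr_ge0// lte_fin exprn_gt0// invr_gt0.
apply: (le_measure l2); [apply/mem_set; exact: measurable_hsq|apply/mem_set; exact: mdisc|].
move=> [x y] [] /=; rewrite !in_itv /= !add0r => /andP[x0 x1] /andP[y0 y1].
rewrite /disc /sq /=; nra.
Qed.

(** The disc [|z|^2 < a] has area [a] times that of the unit disc, so the image of planar measure
    under [sq] is a multiple of Lebesgue measure on the half-line; [c] is the area of the unit
    disc. *)
Lemma radial_integral : exists2 c : R, 0 < c & forall g : R -> \bar R,
  measurable_fun setT g -> (forall t, 0 <= g t)%E ->
  (\int[l2]_p g (sq p) = c%:E * \int[leb]_t (g t * (\1_(`[0%R, +oo[) t : R)%:E))%E.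
Proof.
pose c := fine (l2 (disc 1)).
have cE : l2 (disc 1) = c%:E by rewrite fineK// ge0_fin_numE.
have c0 : 0 < c by rewrite -lte_fin -cE.
exists c => // g mg g0.
have mq : measurable_fun [set: V] (@sq R) by exact: measurable_sq.
have mI : measurable `[0 : R, +oo[ by [].
pose m1 := image_measure l2 mq.
pose m2 : {measure set R -> \bar R} := mscale (NngNum (ltW c0)) (mrestr leb mI).
have m1E (a : R) : m1 `]-oo, a[%classic = (c%:E * (Num.max 0 a)%:E)%E.
  transitivity (l2 (disc a)).
    by congr (l2 _); apply/seteqP; split => p; rewrite /disc /= in_itv.
  have [a0|a0] := leP a 0.
    rewrite mule0 -[RHS](measure0 l2); congr (l2 _); apply/seteqP; split => p //.
    by rewrite /disc /= => h; have := sq_ge0 p; lra.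
  by rewrite disc_scale// cE muleC.
have m2E (a : R) : m2 `]-oo, a[%classic = (c%:E * (Num.max 0 a)%:E)%E.
  rewrite /m2 /= /mscale /= /mrestr; congr (_ * _)%E.
  rewrite (_ : `]-oo, a[%classic `&` `[0, +oo[%classic = `[0, a[%classic); last first.
    apply/seteqP; split => x; rewrite /= !in_itv /= ?andbT.
      by move=> [-> ->].
    by move=> /andP[-> ->].
  rewrite /lebR lebesgue_measure_itv /= lte_fin.
  by case: ltP; rewrite ?oppr0 ?adde0// => ->.
have E A : measurable A -> m1 A = m2 A.
  apply: (@measure_unique _ R R (@RGenInftyO.G R) (fun n => `]-oo, n%:R[%classic) _ _ _ _ m1 m2) => //.
  - exact: (RGenInftyO.measurableE R).
  - move=> _ _ [x ->] [y ->]; exists (Num.min x y); apply/seteqP; split => z /=.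
      by rewrite !in_itv /= => -[h1 h2]; rewrite lt_min h1.
    by rewrite !in_itv /= lt_min => /andP[h1 h2].
  - by move=> n; exists n%:R.
  - apply/seteqP; split => // x _; exists (Num.truncn (`|x|)).+1 => //=.
    rewrite in_itv /=; apply: (le_lt_trans (ler_norm x)).
    by apply: real_truncnS_gt; exact: num_real.
  - by move=> _ [x ->]; rewrite m1E m2E.
  - by move=> n; rewrite m1E -EFinM ltry.
rewrite -(ge0_integral_image l2 mq mg g0) (eq_measure_integral m2); last by move=> A mA _; exact: E.
rewrite /m2 ge0_integral_mscale//; congr (_ * _)%E.
apply: (@ge0_integral_density _ _ _ leb (mrestr leb mI) \1_(`[0%R, +oo[)) => //.
by move=> A mA; rewrite integral_indic// setIC.
Qed.

End radial.

(** * The Kac-Rice formula *)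

Section complex_measurability.
Variable R : realType.
Local Notation V := (R * R)%type.

Definition cmeas d (W : measurableType d) (g : W -> R[i]) : Prop :=
  measurable_fun setT (fun w => complex.Re (g w)) /\
  measurable_fun setT (fun w => complex.Im (g w)).

Lemma cmeas_cx d (W : measurableType d) (f : W -> V) :
  measurable_fun setT f -> cmeas (fun w => cx (f w)).
Proof.
move=> mf; split; first exact: (measurableT_comp measurable_fst mf).
exact: (measurableT_comp measurable_snd mf).
Qed.

Lemma cmeas_cst d (W : measurableType d) (c : R[i]) : cmeas (fun _ : W => c).
Proof. by split; exact: measurable_cst. Qed.

Lemma cmeas_add d (W : measurableType d) (f g : W -> R[i]) :
  cmeas f -> cmeas g -> cmeas (fun w => f w + g w).
Proof.
move=> [f1 f2] [g1 g2]; split.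
  rewrite (_ : (fun w => _) = fun w => complex.Re (f w) + complex.Re (g w)); first exact: measurable_funD.
  by apply/funext => w; case: (f w); case: (g w).
rewrite (_ : (fun w => _) = fun w => complex.Im (f w) + complex.Im (g w)); first exact: measurable_funD.
by apply/funext => w; case: (f w); case: (g w).
Qed.

Lemma cmeas_mul d (W : measurableType d) (f g : W -> R[i]) :
  cmeas f -> cmeas g -> cmeas (fun w => f w * g w).
Proof.
move=> [f1 f2] [g1 g2]; split.
  rewrite (_ : (fun w => _) = fun w => complex.Re (f w) * complex.Re (g w)
    - complex.Im (f w) * complex.Im (g w)).
    by apply: measurable_funB; exact: measurable_funM.
  by apply/funext => w; case: (f w); case: (g w).
rewrite (_ : (fun w => _) = fun w => complex.Re (f w) * complex.Im (g w)
    + complex.Im (f w) * complex.Re (g w)).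
  by apply: measurable_funD; exact: measurable_funM.
by apply/funext => w; case: (f w); case: (g w).
Qed.

Lemma cmeas_cj d (W : measurableType d) (f : W -> R[i]) :
  cmeas f -> cmeas (fun w => cj (f w)).
Proof.
move=> [f1 f2]; split.
  by rewrite (_ : (fun w => _) = fun w => complex.Re (f w))//; apply/funext => w; case: (f w).
rewrite (_ : (fun w => _) = fun w => - complex.Im (f w)); first exact: measurableT_comp.
by apply/funext => w; case: (f w).
Qed.

Lemma cmeas_exp d (W : measurableType d) (f : W -> R[i]) n :
  cmeas f -> cmeas (fun w => f w ^+ n).
Proof.
move=> mf; elim: n => [|n IH]; first exact: cmeas_cst.
by under eq_fun do rewrite exprS; exact: cmeas_mul.
Qed.

Lemma cmeas_sum d (W : measurableType d) (J : Type) (r : seq J) (X : J -> W -> R[i]) :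
  (forall i, cmeas (X i)) -> cmeas (fun w => \sum_(i <- r) X i w).
Proof.
move=> mX; elim: r => [|i r IH].
  by under eq_fun do rewrite big_nil; exact: cmeas_cst.
by under eq_fun do rewrite big_cons; exact: cmeas_add.
Qed.

Lemma cmeas_cpair d (W : measurableType d) (f : W -> R[i]) :
  cmeas f -> measurable_fun setT (fun w => cpair (f w)).
Proof. by move=> [f1 f2]; exact: measurable_fun_pair. Qed.

End complex_measurability.

Section gaussian_density.
Variable R : realType.
Local Notation V := (R * R)%type.

Lemma rho_le1 (w : V) : rho w <= 1.
Proof.
rewrite /rho ler_pdivrMr ?pi_gt0// mul1r (@le_trans _ _ 1)//.
  by rewrite -[leRHS]expR0 ler_expR oppr_le0 addr_ge0 ?sqr_ge0.
by have := pi_ge2 R; lra.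
Qed.

(** For [y - x < 1], use [1 - exp (- v) <= v] with [v = y^2 - x^2] and [exp (- x^2) (1 + x^2) <= 1];
    for larger gaps the bound is trivial. *)
Let expR_sq_le (x y : R) : 0 <= x -> x <= y ->
  `|expR (- x ^+ 2) - expR (- y ^+ 2)| <= 2 * (y - x).
Proof.
move=> x0 xy.
have e1 : expR (- x ^+ 2) <= 1 by rewrite -[leRHS]expR0 ler_expR oppr_le0 sqr_ge0.
have ey : 0 <= expR (- y ^+ 2) by exact: expR_ge0.
have exy : expR (- y ^+ 2) <= expR (- x ^+ 2) by rewrite ler_expR lerN2; nra.
rewrite ger0_norm ?subr_ge0//.
have [h|h] := leP 1 (y - x); first lra.
have -> : expR (- y ^+ 2) = expR (- x ^+ 2) * expR (- (y ^+ 2 - x ^+ 2)).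
  by rewrite -expRD; congr expR; ring.
have E1 := expR_ge1Dx (- (y ^+ 2 - x ^+ 2)).
have E2 : expR (- x ^+ 2) * (1 + x ^+ 2) <= 1.
  rewrite expRN ler_pdivrMl ?expR_gt0// mulr1; exact: expR_ge1Dx.
have ex := expR_ge0 (- x ^+ 2).
have H1 : expR (- x ^+ 2) * (1 - expR (- (y ^+ 2 - x ^+ 2))) <=
    expR (- x ^+ 2) * ((y - x) * (y + x)).
  by rewrite ler_wpM2l//; nra.
have H2 : expR (- x ^+ 2) * (y + x) <= 2.
  have : expR (- x ^+ 2) * (y + x) <= expR (- x ^+ 2) * (1 + (1 + x ^+ 2)).
    by rewrite ler_wpM2l//; have := sqr_ge0 (x - 1); nra.
  by rewrite mulrDr; lra.
have H3 : (y - x) * (expR (- x ^+ 2) * (y + x)) <= (y - x) * 2.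
  by rewrite ler_wpM2l// subr_ge0.
move: H1 H3; rewrite mulrBr mulr1 => H1 H3.
by rewrite (le_trans H1)// mulrCA (le_trans H3)// mulrC.
Qed.

Lemma rho_Lip (u v : V) : `|rho u - rho v| <= 2 * nc (cx u - cx v).
Proof.
rewrite !rho_nc -mulrBl normrM (ger0_norm (x := pi^-1)) ?invr_ge0 ?pi_ge0//.
rewrite ler_pdivrMr ?pi_gt0//.
have H : `|expR (- nc (cx u) ^+ 2) - expR (- nc (cx v) ^+ 2)| <= 2 * nc (cx u - cx v).
  have := nc_dist (cx u) (cx v); rewrite ler_norml => /andP[d1 d2].
  have [h|h] := leP (nc (cx u)) (nc (cx v)).
    by apply: (le_trans (expR_sq_le (nc_ge0 (cx u)) h)); lra.
  by rewrite distrC; apply: (le_trans (expR_sq_le (nc_ge0 (cx v)) (ltW h))); lra.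
apply: (le_trans H); rewrite ler_peMr ?mulr_ge0 ?nc_ge0//.
by have := pi_ge2 R; lra.
Qed.

Lemma rho_opp (z : R[i]) : rho (cpair (- z)) = rho (cpair z).
Proof. by rewrite !rho_nc !cpairK ncN. Qed.

End gaussian_density.

Section harmonic.
Variables (R : realType) (n m : nat).
Local Notation V := (R * R)%type.
Local Notation I := ('I_n.+1 + 'I_m.+1)%type.
Local Notation l2 := (@leb2 R).
Local Notation rho := (@rho R).
Implicit Types v : I -> V.

Definition hpol v (z : R[i]) : R[i] := \sum_(j < n.+1) cx (v (inl j)) * z ^+ j +
  \sum_(j < m.+1) cx (v (inr j)) * cj z ^+ j.
Definition hpol_dz v (z : R[i]) : R[i] :=
  \sum_(j < n.+1) cx (v (inl j)) * (j%:R * z ^+ j.-1).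
Definition hpol_dzbar v (z : R[i]) : R[i] :=
  \sum_(j < m.+1) cx (v (inr j)) * (j%:R * cj z ^+ j.-1).

Definition kernel v (p : V) : R :=
  `|nc (hpol_dz v (cx p)) ^+ 2 - nc (hpol_dzbar v (cx p)) ^+ 2| * rho (cpair (hpol v (cx p))).

Section meas.
Context d (W : measurableType d) (g : W -> I -> V) (p : W -> V).
Hypotheses (mg : forall i, measurable_fun setT (fun w => g w i)) (mp : measurable_fun setT p).

Lemma cmeas_hpol : cmeas (fun w => hpol (g w) (cx (p w))).
Proof.
by apply: cmeas_add; apply: cmeas_sum => j; apply: cmeas_mul; do ?exact: cmeas_cx;
  apply: cmeas_exp; do ?apply: cmeas_cj; exact: cmeas_cx.
Qed.

Lemma measurable_kernel : measurable_fun setT (fun w => kernel (g w) (p w)).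
Proof.
have m1 : cmeas (fun w => hpol_dz (g w) (cx (p w))).
  apply: cmeas_sum => j; apply: cmeas_mul; first exact: cmeas_cx.
  by apply: cmeas_mul; [exact: cmeas_cst|apply: cmeas_exp; exact: cmeas_cx].
have m2 : cmeas (fun w => hpol_dzbar (g w) (cx (p w))).
  apply: cmeas_sum => j; apply: cmeas_mul; first exact: cmeas_cx.
  by apply: cmeas_mul; [exact: cmeas_cst|apply: cmeas_exp; apply: cmeas_cj; exact: cmeas_cx].
apply: measurable_funM; last first.
  exact: measurableT_comp (@measurable_rho R) (cmeas_cpair cmeas_hpol).
apply: measurableT_comp => //; apply: measurable_funB; apply: measurable_funX.
  by case: m1 => a b; exact: measurable_nc.
by case: m2 => a b; exact: measurable_nc.
Qed.

End meas.

Let hp_C11 v (r : R) : exists2 M, 1 <= M &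
  RC11_with r M (fun z => - hpol v z) (fun z => - hpol_dz v z) (fun z => - hpol_dzbar v z).
Proof.
have [r0|r0] := leP 0 r; last first.
  by exists 1 => // z w zr; have := nc_ge0 z; lra.
have [M M1 H] := C11_harmonic (C11_sum r0 (fun j : 'I_n.+1 => - cx (v (inl j))))
  (C11_sum r0 (fun j : 'I_m.+1 => - cx (v (inr j)))).
exists M => //.
have -> : (fun z => - hpol v z) = fun z => \sum_(j < n.+1) - cx (v (inl j)) * z ^+ j +
    \sum_(j < m.+1) - cx (v (inr j)) * cj z ^+ j.
  apply/funext => z; rewrite /hpol opprD -!sumrN.
  by congr (_ + _); apply: eq_bigr => j _; rewrite mulNr.
have -> : (fun z => - hpol_dz v z) =
    fun z => \sum_(j < n.+1) - cx (v (inl j)) * (j%:R * z ^+ j.-1).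
  by apply/funext => z; rewrite -sumrN; apply: eq_bigr => j _; rewrite mulNr.
have -> : (fun z => - hpol_dzbar v z) =
    fun z => \sum_(j < m.+1) - cx (v (inr j)) * (j%:R * cj z ^+ j.-1).
  by apply/funext => z; rewrite -sumrN; apply: eq_bigr => j _; rewrite mulNr.
exact: H.
Qed.

(** The zeros of [a + hpol v] are the points where [- hpol v] takes the value [a]; the sign then
    disappears because the Jacobian and [rho] are even. *)
Lemma area_hpol v :
  (\int[l2]_a ((counting [set p | (cx a + hpol v (cx p) = 0)%R] : \bar R) * (rho a)%:E) =
   \int[l2]_p (kernel v p)%:E)%E.
Proof.
transitivity (\int[l2]_a ((counting [set p | cpair (- hpol v (cx p))%R = a] : \bar R) * (rho a)%:E))%E.
  apply: eq_integral => a _; congr (counting _ * _)%E; apply/seteqP; split => p /=.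
    by move=> /eqP; rewrite addr_eq0 => /eqP E; rewrite -E cxK.
  by move=> <-; rewrite cpairK addNr.
have jE : jacf (fun z => - hpol v z) (fun z => - hpol_dz v z) (fun z => - hpol_dzbar v z) rho
    = kernel v.
  by apply/funext => p; rewrite /jacf /jac !ncN rho_opp.
rewrite (area_plane (hp_C11 v) (@measurable_rho R) (@rho_ge0 R) (@rho_le1 R) _ (@rho_Lip R))// jE//.
exact: (measurable_kernel (g := fun _ : V => v)).
Qed.

Lemma hpol_Lip v (r : R) : exists L, forall z z', nc z <= r -> nc z' <= r ->
  nc (hpol v z - hpol v z') <= L * nc (z - z').
Proof.
have [M M1 H] := hp_C11 v r; exists (M * (2 * r + 2)) => z z' zr zr'.
by have := RC11_Lip H M1 zr zr'; rewrite -opprD ncN.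
Qed.

Variables (d : measure_display) (T : measurableType d) (P : probability T R).
Variable Z : I -> T -> V.
Hypothesis iZ : iid_gauss P Z.

Lemma expected_counting :
  (\int[P]_w (counting [set p | hpol (Z ^~ w) (cx p) = 0%R] : \bar R) =
   \int[l2]_p \int[P]_w (kernel (drop_coord Z (inl ord0) w) p)%:E)%E.
Proof.
pose i0 : I := inl ord0.
have hE w z : hpol (Z ^~ w) z = cx (Z i0 w) + hpol (drop_coord Z i0 w) z.
  rewrite /hpol big_ord_recl [in RHS]big_ord_recl !expr0 !mulr1.
  have -> : cx (drop_coord Z i0 w (inl ord0)) = 0 by rewrite /drop_coord eqxx.
  by rewrite add0r addrA.
pose Psi (u : V * VI R I) : \bar R := counting [set p | cx u.1 + hpol u.2 (cx p) = 0].
have mPsi : measurable_fun setT Psi.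
  apply: (@measurable_counting_zeros R _ (V * VI R I)%type (fun u z => cx u.1 + hpol u.2 z)).
    move=> z.
    have [a b] : cmeas (fun u : V * VI R I => cx u.1 + hpol u.2 (cx (cpair z))).
      apply: cmeas_add; first exact: cmeas_cx.
      apply: (@cmeas_hpol _ _ (fun u : V * VI R I => u.2) (fun=> cpair z)) => //.
      by move=> i; exact: (measurableT_comp (@measurable_coord R I i) measurable_snd).
    by rewrite cpairK in a b; exact: measurable_nc.
  move=> u r; have [L H] := hpol_Lip u.2 r; exists L => z z' zr zr'.
  by rewrite opprD addrACA subrr add0r; exact: H.
have Psi0 u : (0 <= Psi u)%E by exact: counting_ge0.
transitivity (\int[P]_w Psi (Z i0 w, drop_coord Z i0 w))%E.
  by apply: eq_integral => w _; congr counting; apply/seteqP; split => p; rewrite /= hE.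
rewrite peel//.
transitivity (\int[P]_w \int[l2]_p (kernel (drop_coord Z i0 w) p)%:E)%E.
  apply: eq_integral => w _; rewrite ge0_integral_gam//; last first.
    exact: (measurableT_comp mPsi (measurable_pair2 _)).
  exact: area_hpol.
have mk : measurable_fun setT (fun u : T * V => (kernel (drop_coord Z i0 u.1) u.2)%:E).
  apply/measurable_EFinP; apply: measurable_kernel => // i.
  apply: (measurableT_comp (f := fun w => drop_coord Z i0 w i)) => //.
  by rewrite /drop_coord; case: eqVneq => // _; exact: iZ.1.
have k0 (u : T * V) : (0 <= (kernel (drop_coord Z i0 u.1) u.2)%:E)%E.
  by rewrite lee_fin mulr_ge0 ?rho_ge0.
exact: (@fubini_tonelli _ _ _ _ R P l2 _ mk k0).
Qed.

End harmonic.

(** * Power sums and conditional covariances *)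

Section power_sums.
Variable R : realType.
Implicit Types (N : nat) (t : R).

(** At [t = |z|^2], for a polynomial [p] of degree [N] with independent unit-variance coefficients,
    [gsum] is the variance of [p], [ssum] that of [p'], and [psum] is their covariance up to the
    factor [|z|]. The truncated exponent [j.-1] at [j = 0] meets the factor 0. *)
Definition gsum N t : R := \sum_(j < N.+1) t ^+ j.
Definition psum N t : R := \sum_(j < N.+1) j%:R * t ^+ j.-1.
Definition ssum N t : R := \sum_(j < N.+1) j%:R ^+ 2 * t ^+ j.-1.

Lemma gsum0 t : gsum 0 t = 1. Proof. by rewrite /gsum big_ord1 expr0. Qed.
Lemma psum0 t : psum 0 t = 0. Proof. by rewrite /psum big_ord1 mul0r. Qed.
Lemma ssum0 t : ssum 0 t = 0. Proof. by rewrite /ssum big_ord1 expr0n mul0r. Qed.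
Lemma gsumS N t : gsum N.+1 t = gsum N t + t ^+ N.+1.
Proof. by rewrite /gsum big_ord_recr. Qed.
Lemma psumS N t : psum N.+1 t = psum N t + N.+1%:R * t ^+ N.
Proof. by rewrite /psum big_ord_recr. Qed.
Lemma ssumS N t : ssum N.+1 t = ssum N t + N.+1%:R ^+ 2 * t ^+ N.
Proof. by rewrite /ssum big_ord_recr. Qed.

Lemma gsum_ge1 N t : 0 <= t -> 1 <= gsum N t.
Proof.
move=> t0; elim: N => [|N IH]; first by rewrite gsum0.
by rewrite gsumS (le_trans IH)// lerDl exprn_ge0.
Qed.

Lemma ssum_ge0 N t : 0 <= t -> 0 <= ssum N t.
Proof. by move=> t0; apply: sumr_ge0 => j _; rewrite mulr_ge0 ?sqr_ge0// exprn_ge0. Qed.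

Lemma ssum_ge1 N t : (0 < N)%N -> 0 <= t -> 1 <= ssum N t.
Proof.
case: N => // N _ t0; elim: N => [|N IH]; first by rewrite ssumS ssum0 add0r expr1n expr0 mulr1.
by rewrite ssumS (le_trans IH)// lerDl mulr_ge0 ?sqr_ge0// exprn_ge0.
Qed.

(** The variance of [z p' - a p], whose coefficients are those of [p] weighted by [j - a]. *)
Lemma sum_dist2 N t a : \sum_(j < N.+1) (j%:R - a) ^+ 2 * t ^+ j =
  t * ssum N t - 2 * t * a * psum N t + a ^+ 2 * gsum N t.
Proof.
elim: N => [|N IH].
  by rewrite big_ord1 ssum0 psum0 gsum0 expr0 /=; ring.
by rewrite big_ord_recr /= IH ssumS psumS gsumS !exprS; ring.
Qed.

Definition gram N t : R := ssum N t * gsum N t - t * psum N t ^+ 2.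

(* The Lagrange identity [gram N t = \sum_(i < j <= N) (j - i) ^+ 2 * t ^+ (i + j - 1)],
   one row at a time. *)
Lemma gramS N t : gram N.+1 t =
  gram N t + t ^+ N * \sum_(j < N.+1) (j%:R - N.+1%:R) ^+ 2 * t ^+ j.
Proof.
by rewrite sum_dist2 /gram ssumS psumS gsumS !exprS; ring.
Qed.

Lemma gram_homo N M t : 0 <= t -> (N <= M)%N -> gram N t <= gram M t.
Proof.
move=> t0 /subnK <-; elim: (M - N)%N => // k IH.
rewrite (le_trans IH)// addSn gramS lerDl mulr_ge0 ?exprn_ge0//.
by apply: sumr_ge0 => j _; rewrite mulr_ge0 ?sqr_ge0// exprn_ge0.
Qed.

Lemma gram_ge0 N t : 0 <= t -> 0 <= gram N t.
Proof.
move=> t0; apply: (le_trans _ (gram_homo t0 (leq0n N))).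
by rewrite /gram ssum0 psum0 mul0r expr0n mulr0 subrr.
Qed.

End power_sums.

Section covariances.
Variables (R : realType) (n m : nat).
Implicit Types t : R.

Definition Ksum t : R := gsum n t + gsum m t.
Definition cov11 t : R := ssum n t - t * psum n t ^+ 2 / Ksum t.
(** Only the conditioning correction is left: the two derivatives use disjoint sets of
    coefficients. *)
Definition cov12 t : R := - (t * psum n t * psum m t / Ksum t).
Definition cov22 t : R := ssum m t - t * psum m t ^+ 2 / Ksum t.
Definition kap t : \bar R :=
  (((pi * Ksum t)^-1)%:E * Phi (cov11 t) (cov12 t) (cov22 t))%E.

Lemma Ksum_ge2 t : 0 <= t -> 2 <= Ksum t.
Proof. by move=> t0; rewrite /Ksum; have := gsum_ge1 n t0; have := gsum_ge1 m t0; lra. Qed.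

Lemma Ksum_gt0 t : 0 <= t -> 0 < Ksum t.
Proof. by move=> t0; have := Ksum_ge2 t0; lra. Qed.

(** [Ksum * cov11 = ssum n * gsum m + gram n], with a nonnegative Gram determinant. *)
Lemma cov11_ge t : 0 <= t -> ssum n t * gsum m t / Ksum t <= cov11 t.
Proof.
move=> t0; have K0 := Ksum_gt0 t0; rewrite /cov11.
have K1 : Ksum t != 0 by rewrite gt_eqF.
rewrite -[X in X - _](mulfK K1) -mulrBl ler_pM2r ?invr_gt0//.
by rewrite /Ksum mulrDr; have := gram_ge0 n t0; rewrite /gram; lra.
Qed.

Lemma cov11_gt0 t : (0 < n)%N -> 0 <= t -> 0 < cov11 t.
Proof.
move=> n0 t0; apply: (lt_le_trans _ (cov11_ge t0)).
have := ssum_ge1 n0 t0; have := gsum_ge1 m t0; have := Ksum_gt0 t0 => K0 g1 s1.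
by rewrite divr_gt0// mulr_gt0//; lra.
Qed.

Lemma cov_cs t : 0 <= t -> cov12 t ^+ 2 <= cov11 t * cov22 t.
Proof.
move=> t0; have K0 := Ksum_gt0 t0; have K1 : Ksum t != 0 by rewrite gt_eqF.
rewrite -subr_ge0.
have -> : cov11 t * cov22 t - cov12 t ^+ 2 =
  (ssum n t * gram m t + ssum m t * gram n t) / Ksum t.
  rewrite /cov11 /cov12 /cov22 /gram; move: K1; rewrite /Ksum => K1; field; exact: K1.
by rewrite divr_ge0 ?(ltW K0)// addr_ge0// mulr_ge0 ?ssum_ge0 ?gram_ge0.
Qed.

(** The defect is [(gram n - gram m) / Ksum], and the Gram determinant grows with the degree. *)
Lemma cov_diff t : 0 <= t -> (m <= n)%N ->
  (ssum n t * gsum m t - ssum m t * gsum n t) / Ksum t <= cov11 t - cov22 t.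
Proof.
move=> t0 mn; have K0 := Ksum_gt0 t0; have K1 : Ksum t != 0 by rewrite gt_eqF.
rewrite -subr_ge0.
have -> : cov11 t - cov22 t - (ssum n t * gsum m t - ssum m t * gsum n t) / Ksum t =
  (gram n t - gram m t) / Ksum t.
  rewrite /cov11 /cov22 /gram; move: K1; rewrite /Ksum => K1; field; exact: K1.
by rewrite divr_ge0 ?(ltW K0)// subr_ge0 gram_homo.
Qed.

End covariances.

Section kernel_formula.
Variables (R : realType) (n m : nat).
Local Notation V := (R * R)%type.
Local Notation I := ('I_n.+1 + 'I_m.+1)%type.
Local Notation rho := (@rho R).
Variables (d : measure_display) (T : measurableType d) (P : probability T R).
Variable Z : I -> T -> V.
Hypothesis iZ : iid_gauss P Z.

Let polar (z : R[i]) : exists2 u, nc u = 1 & z = (nc z)%:C * u.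
Proof.
have [z0|z0] := eqVneq z 0; first by exists 1; rewrite ?nc1// z0 nc0 mul0r.
have nz : nc z != 0 by rewrite nc_eq0.
have nzC : (nc z)%:C != 0 by rewrite -nc_eq0 ncR normr_eq0.
exists ((nc z)%:C^-1 * z); last by rewrite mulVKf.
by rewrite ncM ncV ncR ger0_norm ?nc_ge0// mulVf.
Qed.

Let cx_lincomb (v : I -> R) (X : I -> T -> V) w :
  cx (lincomb v X w) = \sum_i (v i)%:C * cx (X i w).
Proof.
rewrite /lincomb; elim/big_rec2 : _ => [//|i x y _ <-].
rewrite cxD; congr (_ + _).
by case: (X i w) => a b; rewrite /cx /=; apply/eqP; rewrite eq_complex /= /GRing.scale /=;
  apply/andP; split; apply/eqP; ring.
Qed.

(** Write [z = r u] with [|u| = 1]. Multiplying the coefficients of [z ^ j] by [u ^ j] and those of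
    [cj z ^ j] by [cj u ^ j] keeps them iid and turns the value and, up to unit factors, the
    derivatives into real linear combinations, as [kernel_gauss] requires. *)
Lemma expected_kernel (p : V) : (0 < n)%N ->
  (\int[P]_w (kernel (drop_coord Z (inl ord0) w) p)%:E = kap n m (sq p))%E.
Proof.
move=> n0; set z := cx p; set r := nc z; have r0 : 0 <= r := nc_ge0 z.
have rt : r ^+ 2 = sq p by rewrite sq_nc.
have t0 : 0 <= sq p := sq_ge0 p.
have [u u1 zE] := polar z.
pose ph (i : I) : R[i] := match i with inl j => u ^+ j | inr j => cj u ^+ j end.
have ph1 i : nc (ph i) = 1 by case: i => j; rewrite ncX ?ncJ u1 expr1n.
have iZ1 := iid_phase ph1 iZ; set Z1 := (fun i w => _) in iZ1.
(* The index [ord0] is masked because [A 0] has been integrated out; it reappears as the [1] in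
   [K]. *)
pose h (i : I) : R := match i with inl j => (j != ord0)%:R * r ^+ j | inr j => r ^+ j end.
pose x (i : I) : R := match i with inl j => j%:R * r ^+ j.-1 | inr j => 0 end.
pose y (i : I) : R := match i with inl j => 0 | inr j => j%:R * r ^+ j.-1 end.
have cZ1 i w : cx (Z1 i w) = ph i * cx (Z i w) by rewrite /Z1 /phase cpairK.
have czE : cj z = r%:C * cj u by rewrite {1}zE cjM cjR.
have hE w : cx (lincomb h Z1 w) = hpol (drop_coord Z (inl ord0) w) z.
  rewrite cx_lincomb big_sumType /=; congr (_ + _); apply: eq_bigr => j _; rewrite cZ1 /=.
    rewrite /drop_coord; case: (eqVneq j ord0) => [->|j0] /=.
      by rewrite ?mulr0n !mul0r.
    rewrite (_ : (inl j == inl ord0 :> I) = false); last by apply/negbTE.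
    by rewrite mul1r zE exprMn rmorphXn /=; ring.
  by rewrite /drop_coord /= czE exprMn rmorphXn /=; ring.
have xE w : cx (lincomb x Z1 w) = u * hpol_dz (drop_coord Z (inl ord0) w) z.
  rewrite cx_lincomb big_sumType /= [X in _ + X]big1 ?addr0; last by move=> j _; rewrite mul0r.
  rewrite /hpol_dz mulr_sumr; apply: eq_bigr => j _; rewrite cZ1 /=.
  case: j => -[|j] jn /=; first by rewrite !mul0r !mulr0.
  rewrite /drop_coord (_ : (inl _ == inl ord0 :> I) = false)//.
  by rewrite {1}zE exprMn exprS rmorphM rmorphXn rmorph_nat /=; ring.
have yE w : cx (lincomb y Z1 w) = cj u * hpol_dzbar (drop_coord Z (inl ord0) w) z.
  rewrite cx_lincomb big_sumType /= [X in X + _]big1 ?add0r; last by move=> j _; rewrite mul0r.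
  rewrite /hpol_dzbar mulr_sumr; apply: eq_bigr => j _; rewrite cZ1 /=.
  case: j => -[|j] jn /=; first by rewrite !mul0r !mulr0.
  by rewrite /drop_coord /= czE exprMn exprS rmorphM rmorphXn rmorph_nat /=; ring.
have rj j : (r ^+ j) ^+ 2 = sq p ^+ j by rewrite -rt -!exprM mulnC.
have sh : 1 + \sum_i h i ^+ 2 = Ksum n m (sq p).
  rewrite big_sumType /= addrA; congr (_ + _); last by apply: eq_bigr => j _; rewrite rj.
  rewrite /gsum !big_ord_recl /= mul0r expr0n add0r expr0; congr (_ + _).
  by apply: eq_bigr => j _; rewrite mul1r rj.
have sx : \sum_i x i ^+ 2 = ssum n (sq p).
  rewrite big_sumType /= [X in _ + X]big1 ?addr0; last by move=> j _; rewrite expr0n.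
  by apply: eq_bigr => j _; rewrite exprMn rj.
have sy : \sum_i y i ^+ 2 = ssum m (sq p).
  rewrite big_sumType /= [X in X + _]big1 ?add0r; last by move=> j _; rewrite expr0n.
  by apply: eq_bigr => j _; rewrite exprMn rj.
have sxy : \sum_i x i * y i = 0.
  by rewrite big_sumType /= !big1 ?addr0// => j _; rewrite ?mulr0 ?mul0r.
have rr j : j.+1%:R * r ^+ j * r ^+ j.+1 = r * (j.+1%:R * sq p ^+ j) by rewrite -rj exprS; ring.
have sxh : \sum_i x i * h i = r * psum n (sq p).
  rewrite big_sumType /= [X in _ + X]big1 ?addr0; last by move=> j _; rewrite mul0r.
  rewrite /psum mulr_sumr; apply: eq_bigr => -[[|j] jn] _ /=; first by rewrite !mul0r mulr0.
  by rewrite mul1r rr.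
have syh : \sum_i y i * h i = r * psum m (sq p).
  rewrite big_sumType /= [X in X + _]big1 ?add0r; last by move=> j _; rewrite mul0r.
  rewrite /psum mulr_sumr; apply: eq_bigr => -[[|j] jn] _ /=; first by rewrite !mul0r mulr0.
  by rewrite rr.
have pq : (inl ord0 : I) != inr ord0 by [].
have := @kernel_gauss R d T P I _ _ Z1 h x y pq iZ1; rewrite sh sx sy sxy sxh syh /=.
have -> : ssum n (sq p) - (r * psum n (sq p)) ^+ 2 / Ksum n m (sq p) = cov11 n m (sq p).
  by rewrite exprMn rt.
have -> : ssum m (sq p) - (r * psum m (sq p)) ^+ 2 / Ksum n m (sq p) = cov22 n m (sq p).
  by rewrite exprMn rt.
have -> : 0 - r * psum n (sq p) * (r * psum m (sq p)) / Ksum n m (sq p) = cov12 n m (sq p).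
  by rewrite /cov12 -rt sub0r; congr (- (_ / _)); ring.
rewrite /kap => /(_ (cov11_gt0 m n0 t0)) <-; apply: eq_integral => w _.
rewrite -EFinM; congr EFin; rewrite /kernel !sq_nc xE yE !ncM ncJ u1 !mul1r -/z.
by congr (_ * _); rewrite -hE cxK.
Qed.

End kernel_formula.

Section expected_zeros.
Variables (R : realType) (d : measure_display) (T : measurableType d) (P : probability T R).
Local Notation V := (R * R)%type.
Local Notation l2 := (@leb2 R).

Lemma gaussian_law (Z : T -> R[i]) : std_complex_gaussian P Z ->
  measurable_fun setT (fun w => cpair (Z w)) /\
  forall B : set V, measurable B -> P ((fun w => cpair (Z w)) @^-1` B) = @gam R B.
Proof.
move=> [[mX mY] lX lY ind].
have mZ : measurable_fun setT (fun w => cpair (Z w)) by exact: measurable_fun_pair.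
split => // B mB.
transitivity (image_measure P mZ B); first by [].
apply: measure_rect_unique mB.
  apply: (@le_lt_trans _ _ 1%E); last exact: ltry.
  by rewrite (image_measureE P mZ) preimage_setT; apply: probability_le1; exact: measurableT.
move=> A A' mA mA'; rewrite [RHS]gam_rect// -lX// -lY// -ind//.
Qed.

Variables (n m : nat) (A : 'I_n.+1 -> T -> R[i]) (B : 'I_m.+1 -> T -> R[i]).
Hypothesis kac : kac_coefficients P A B.
Local Notation I := ('I_n.+1 + 'I_m.+1)%type.

Let Zc (i : I) (w : T) : V := cpair (match i with inl j => A j w | inr j => B j w end).

Let iid_coef : iid_gauss P Zc.
Proof.
have [g ind] := kac.
have gZ i : std_complex_gaussian P (fun w => match i : I with inl j => A j w | inr j => B j w end).
  by case: i => j; [exact: (g (inl j))|exact: (g (inr j))].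
split; first by move=> i; have [] := gaussian_law (gZ i).
move=> C mC.
have := ind [set: I]%SET C mC.
rewrite (eq_bigr (fun i => @gam R (C i))); last first.
  move=> i _; have [_ <-//] := gaussian_law (gZ i).
  by congr (P _); apply/seteqP; split => w; case: i => j.
rewrite (eq_bigl (fun=> true)); last by move=> i; rewrite inE.
move=> <-; congr (P _); apply/seteqP; split => w /= H i.
  by move=> _; have := H i; rewrite /Zc; case: i.
by have := H i; rewrite /= inE => /(_ isT); rewrite /Zc; case: i.
Qed.

Lemma expected_zeros_kap : (0 < n)%N ->
  expected_zeros P A B = (\int[l2]_p kap n m (sq p))%E.
Proof.
move=> n0; transitivity (\int[P]_w (counting [set p | hpol (Zc ^~ w) (cx p) = 0%R] : \bar R))%E.
  apply: eq_integral => w _.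
  rewrite -(@counting_bij R _ _ (@cpair R) (@cx R)); last 2 first.
  - exact: cpairK.
  - exact: cxK.
  congr counting; apply/seteqP; split => z /=.
    by move=> [_]; rewrite /harmonic_poly /hpol /preimage /= cpairK => E; rewrite -[RHS]E;
      congr (_ + _); apply: eq_bigr => j _; rewrite /Zc cpairK.
  rewrite /preimage /= cpairK => E; split => //; rewrite -[RHS]E /harmonic_poly /hpol.
  by congr (_ + _); apply: eq_bigr => j _; rewrite /Zc cpairK.
rewrite (expected_counting iid_coef); apply: eq_integral => p _.
exact: (expected_kernel iid_coef).
Qed.

End expected_zeros.

(** * Power sums: estimates and limits *)

Section sum_estimates.
Variable R : realType.
Implicit Types (N n m : nat) (t : R).

(** The closed forms keep the factor [t - 1] on the left, so that they hold at [t = 1] and follow by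
    induction. The chain [gsum], [psum], [ssum] serves the limits, the versions with [(t - 1) ^+ 2]
    the bounds. *)
Lemma gsum_closed N t : (t - 1) * gsum N t = t * t ^+ N - 1.
Proof.
elim: N => [|N IH]; first by rewrite gsum0 expr0; ring.
by rewrite gsumS mulrDr IH (exprS t); ring.
Qed.

Lemma psum_closed N t : (t - 1) * psum N t = (N%:R + 1) * t ^+ N - gsum N t.
Proof.
elim: N => [|N IH]; first by rewrite psum0 gsum0 expr0; ring.
by rewrite psumS gsumS mulrDr IH (exprS t); ring.
Qed.

Lemma ssum_closed N t : (t - 1) * ssum N t =
  (N%:R ^+ 2 - 1) * t ^+ N - 2 * psum N t + gsum N t.
Proof.
elim: N => [|N IH]; first by rewrite ssum0 psum0 gsum0 expr0; ring.
by rewrite ssumS psumS gsumS mulrDr IH (exprS t); ring.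
Qed.

Lemma ssum_closed2 N t : (t - 1) ^+ 2 * ssum N t =
  2 * gsum N t - 1 + t ^+ N * (N%:R ^+ 2 * (t - 1) - 2 * N%:R - 1).
Proof.
elim: N => [|N IH]; first by rewrite ssum0 gsum0 expr0; ring.
by rewrite ssumS gsumS mulrDr IH (exprS t); ring.
Qed.

(** For [t >= 1] every term on the right but the first is nonpositive: the variance of [z p' - N p]
    is at most [2 * t * gsum N t / (t - 1) ^+ 2]. *)
Lemma dist2_closed2 N t :
  (t - 1) ^+ 2 * (t * ssum N t - 2 * t * N%:R * psum N t + N%:R ^+ 2 * gsum N t) =
  2 * t * gsum N t - t * t ^+ N - (2 * N%:R + 1) * t - N%:R ^+ 2 * (t - 1).
Proof.
have E1 := gsum_closed N t; have E2 := psum_closed N t; have E3 := ssum_closed2 N t.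
have -> : (t - 1) ^+ 2 * (t * ssum N t - 2 * t * N%:R * psum N t + N%:R ^+ 2 * gsum N t) =
  t * ((t - 1) ^+ 2 * ssum N t) - 2 * t * N%:R * ((t - 1) * ((t - 1) * psum N t))
   + N%:R ^+ 2 * ((t - 1) * ((t - 1) * gsum N t)) by ring.
have E4 : (t - 1) * ((N%:R + 1) * t ^+ N - gsum N t) =
  (t - 1) * (N%:R + 1) * t ^+ N - (t * t ^+ N - 1) by rewrite mulrBr E1; ring.
by rewrite E3 E2 E4 E1; ring.
Qed.

Lemma gsum_ge_pow N t : 0 <= t -> t ^+ N <= gsum N t.
Proof.
move=> t0; case: N => [|N]; first by rewrite gsum0 expr0.
by rewrite gsumS lerDr; have := gsum_ge1 N t0; lra.
Qed.

Lemma ssum_le N t : 0 <= t -> t * ssum N t <= N%:R ^+ 2 * gsum N t.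
Proof.
move=> t0; rewrite /ssum /gsum !mulr_sumr.
apply: ler_sum => -[[|j] jN] _ /=.
  by rewrite expr0n mul0r mulr0 expr0 mulr1 sqr_ge0.
rewrite mulrCA -exprS ler_wpM2r ?exprn_ge0// ler_pXn2r ?nnegrE//.
by rewrite ler_nat -ltnS.
Qed.

Lemma ssum_le_below N t : 0 <= t -> t <= 1 -> (t - 1) ^+ 2 * ssum N t <= 2 * gsum N t.
Proof.
move=> t0 t1; rewrite ssum_closed2; have T0 := exprn_ge0 N t0.
have N0 : 0 <= N%:R :> R by [].
have : t ^+ N * (N%:R ^+ 2 * (1 - t) + 2 * N%:R + 1) >= 0.
  by rewrite mulr_ge0// addr_ge0// addr_ge0 ?mulr_ge0 ?sqr_ge0// subr_ge0.
lra.
Qed.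

Lemma gsum_shift m d t : 0 <= t -> t ^+ d * gsum m t <= gsum (m + d) t.
Proof.
move=> t0; elim: m => [|m IH].
  by rewrite gsum0 mulr1 add0n; exact: gsum_ge_pow.
by rewrite addSn !gsumS mulrDr lerD// -exprD addnS addnC.
Qed.

Lemma pow_ge_quad d (y : R) : 0 <= y ->
  1 + d%:R * y + d%:R * (d%:R - 1) / 2 * y ^+ 2 <= (1 + y) ^+ d.
Proof.
move=> y0; elim: d => [|d IH]; first by rewrite expr0; lra.
rewrite (exprS (1 + y)); have y1 : 0 <= 1 + y by lra.
apply: le_trans (ler_wpM2l y1 IH); rewrite -subr_ge0.
have -> : (1 + y) * (1 + d%:R * y + d%:R * (d%:R - 1) / 2 * y ^+ 2) -
  (1 + d.+1%:R * y + d.+1%:R * (d.+1%:R - 1) / 2 * y ^+ 2) =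
  d%:R * (d%:R - 1) / 2 * y ^+ 3 by rewrite -natr1; field.
rewrite mulr_ge0 ?exprn_ge0// divr_ge0//.
by case: d {IH} => [|d]; rewrite ?mul0r// mulr_ge0// subr_ge0 ler1n.
Qed.

Lemma cov_le n m t : 0 <= t -> cov11 n m t + cov22 n m t <= ssum n t + ssum m t.
Proof.
move=> t0; have K0 := ltW (Ksum_gt0 n m t0); rewrite /cov11 /cov22.
by apply: lerD; rewrite gerBl divr_ge0// mulr_ge0// sqr_ge0.
Qed.

(* Comparison with the best approximation [c * h] of [x], taken at [c = n / sqrt t]. *)
Lemma cov11_le n m t : 0 < t -> t * cov11 n m t <=
  t * ssum n t - 2 * t * n%:R * psum n t + n%:R ^+ 2 * gsum n t + n%:R ^+ 2 * gsum m t.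
Proof.
move=> t0; have K0 := Ksum_gt0 n m (ltW t0); rewrite -subr_ge0 /cov11.
have K1 : Ksum n m t != 0 by rewrite gt_eqF.
have -> : t * ssum n t - 2 * t * n%:R * psum n t + n%:R ^+ 2 * gsum n t + n%:R ^+ 2 * gsum m t
  - t * (ssum n t - t * psum n t ^+ 2 / Ksum n m t) =
  (t * psum n t - n%:R * Ksum n m t) ^+ 2 / Ksum n m t.
  by move: K1; rewrite /Ksum => K1; field.
by rewrite divr_ge0 ?sqr_ge0// ltW.
Qed.

(** For [t <= 1] the constant 4 suffices. For [t > 1], [8 / b ^+ 2] comes from using [quad] once for
    each of the two variances. *)
Lemma cov_bound n m t (b : R) : 0 <= t -> (m + 2 <= n)%N -> 0 < b ->
  (n - m)%:R = b * n%:R ->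
  (1 + (n%:R * (t - 1)) ^+ 2) * (cov11 n m t + cov22 n m t) <=
  (4 + 8 / b ^+ 2) * (n%:R ^+ 2 * Ksum n m t).
Proof.
move=> t0 mn b0 nb; set x := n%:R * (t - 1).
have nmd : n = (m + (n - m))%N by lia.
have nm2 : (2 <= n - m)%N by lia.
have n2 : 2 <= n%:R :> R by rewrite ler_nat; lia.
have n4 : 4 <= n%:R ^+ 2 :> R by nra.
have mnR : m%:R <= n%:R :> R by rewrite ler_nat; lia.
have K0 := Ksum_gt0 n m t0; have b2 : 0 <= 8 / b ^+ 2 by rewrite divr_ge0// sqr_ge0.
have Gn := gsum_ge1 n t0; have Gm := gsum_ge1 m t0.
have Sn := ssum_ge0 n t0; have Sm := ssum_ge0 m t0.
have cS := cov_le n m t0.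
have KE : Ksum n m t = gsum n t + gsum m t by [].
have X0 : 0 <= 1 + x ^+ 2 by have := sqr_ge0 x; lra.
have nK : 0 <= n%:R ^+ 2 * Ksum n m t by rewrite mulr_ge0 ?sqr_ge0// ltW.
have rest : 4 * (n%:R ^+ 2 * Ksum n m t) <= (4 + 8 / b ^+ 2) * (n%:R ^+ 2 * Ksum n m t).
  by rewrite ler_wpM2r// lerDl.
have Bn := ssum_le n t0; have Bm := ssum_le m t0.
have Bm' : t * ssum m t <= n%:R ^+ 2 * gsum m t.
  apply: (le_trans Bm); rewrite ler_wpM2r//; first lra.
  by rewrite ler_pXn2r ?nnegrE.
have xE : x ^+ 2 = n%:R ^+ 2 * (t - 1) ^+ 2 by rewrite /x exprMn.
have [t1|t1] := leP t 1.
  apply: le_trans rest; apply: (le_trans (ler_wpM2l X0 cS)).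
  have h1 := ssum_le_below n t0 t1; have h2 := ssum_le_below m t0 t1.
  have hx : x ^+ 2 * (ssum n t + ssum m t) <= 2 * (n%:R ^+ 2 * Ksum n m t).
    rewrite xE -mulrA (mulrCA 2) ler_wpM2l ?sqr_ge0// KE; lra.
  suff h0 : ssum n t + ssum m t <= 2 * (n%:R ^+ 2 * Ksum n m t) by lra.
  (* [ssum_le] loses a factor [t], harmless for [t >= 1/2]; below, [(t - 1) ^+ 2 >= 1/4] in the
     closed form does the work and [n ^+ 2 >= 4] absorbs the constant. *)
  have [th|th] := leP 2^-1 t.
    have : 2^-1 * (ssum n t + ssum m t) <= t * (ssum n t + ssum m t).
      by rewrite ler_wpM2r// addr_ge0.
    by rewrite KE; lra.
  have : 4^-1 * (ssum n t + ssum m t) <= (t - 1) ^+ 2 * (ssum n t + ssum m t).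
    by rewrite ler_wpM2r ?addr_ge0//; nra.
  have : 4 * Ksum n m t <= n%:R ^+ 2 * Ksum n m t by rewrite ler_wpM2r// ltW.
  by rewrite KE; lra.
have tp : 0 < t by lra.
have c22 : cov22 n m t <= ssum m t.
  by rewrite /cov22 gerBl divr_ge0 ?(ltW K0)// mulr_ge0// sqr_ge0.
have S0 : cov11 n m t + cov22 n m t <= n%:R ^+ 2 * Ksum n m t.
  apply: (le_trans cS).
  have : 1 * (ssum n t + ssum m t) <= t * (ssum n t + ssum m t).
    by rewrite ler_wpM2r ?addr_ge0//; lra.
  by rewrite KE; lra.
(* With [d = n - m = b n], [gsum n] is at least [t ^ d * gsum m], and [t ^ d] at least
   [d (d - 1) / 2 * (t - 1) ^ 2]; [d >= 2] turns [d (d - 1) / 2] into [d ^ 2 / 4]. *)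
have quad : x ^+ 2 * gsum m t <= 4 / b ^+ 2 * gsum n t.
  have := gsum_shift m (n - m) t0; rewrite -{1}nmd => sh.
  have y0 : 0 <= t - 1 by lra.
  have y1 : 1 + (t - 1) = t by ring.
  have := pow_ge_quad (n - m) y0; rewrite y1 nb => pq.
  have bn2 : 2 <= b * n%:R by rewrite -nb ler_nat.
  have bt : (b * n%:R) ^+ 2 / 4 * (t - 1) ^+ 2 <= t ^+ (n - m).
    apply: le_trans pq.
    have : 0 <= b * n%:R * (t - 1) by rewrite mulr_ge0//; lra.
    have : (b * n%:R) ^+ 2 / 4 * (t - 1) ^+ 2 <= b * n%:R * (b * n%:R - 1) / 2 * (t - 1) ^+ 2.
      by rewrite ler_wpM2r ?sqr_ge0//; nra.
    lra.
  have : (b * n%:R) ^+ 2 / 4 * (t - 1) ^+ 2 * gsum m t <= gsum n t.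
    by apply: le_trans sh; rewrite ler_wpM2r//; lra.
  have -> : (b * n%:R) ^+ 2 / 4 * (t - 1) ^+ 2 * gsum m t = b ^+ 2 / 4 * (x ^+ 2 * gsum m t).
    by rewrite xE; field.
  have b4 : 0 < b ^+ 2 / 4 by rewrite divr_gt0// exprn_gt0.
  move=> h; rewrite -(ler_pM2l b4); apply: (le_trans h).
  by rewrite le_eqVlt; apply/orP; left; apply/eqP; field; rewrite gt_eqF.
(* Bounding [cov11] by [ssum n] would give no decay here, as [ssum n] becomes comparable with
   [n ^ 2 * gsum n] for [t > 1]; subtracting [n H] from [z dH/dz] cancels the dominant top
   coefficients. *)
have X11 : x ^+ 2 * cov11 n m t <= n%:R ^+ 2 * (2 * gsum n t + x ^+ 2 * gsum m t).
  have h := cov11_le n m tp.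
  have E := dist2_closed2 n t.
  have h' := ler_wpM2l (sqr_ge0 (t - 1)) h.
  have T0 := exprn_ge0 n t0.
  have : t * ((t - 1) ^+ 2 * cov11 n m t) <= t * (2 * gsum n t + x ^+ 2 * gsum m t).
    have e1 : 0 <= t * t ^+ n by rewrite mulr_ge0.
    have e2 : 0 <= (2 * n%:R + 1) * t by rewrite mulr_ge0//; lra.
    have e3 : 0 <= n%:R ^+ 2 * (t - 1) by rewrite mulr_ge0 ?sqr_ge0//; lra.
    have e4 : 1 * (x ^+ 2 * gsum m t) <= t * (x ^+ 2 * gsum m t).
      by rewrite ler_wpM2r ?mulr_ge0 ?sqr_ge0//; lra.
    by rewrite xE in e4 *; lra.
  rewrite ler_pM2l// => h2.
  by rewrite {1}xE -mulrA ler_wpM2l ?sqr_ge0.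
have X22 : x ^+ 2 * cov22 n m t <= n%:R ^+ 2 * (x ^+ 2 * gsum m t).
  rewrite mulrCA ler_wpM2l ?sqr_ge0//; apply: (le_trans c22); apply: le_trans Bm'.
  by rewrite ler_peMl//; lra.
have : n%:R ^+ 2 * (x ^+ 2 * gsum m t) <= n%:R ^+ 2 * (4 / b ^+ 2 * gsum n t).
  by rewrite ler_wpM2l ?sqr_ge0.
have : 0 <= 8 / b ^+ 2 * (n%:R ^+ 2 * gsum m t).
  by rewrite mulr_ge0// mulr_ge0 ?sqr_ge0//; lra.
have : 0 <= n%:R ^+ 2 * gsum n t by rewrite mulr_ge0 ?sqr_ge0//; lra.
have : 0 <= n%:R ^+ 2 * gsum m t by rewrite mulr_ge0 ?sqr_ge0//; lra.
by move: S0; rewrite KE; lra.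
Qed.

(** The terms of index above [m] have weight [j ^ 2 >= m ^ 2], whereas those up to [m] fall short of
    the weight [m ^ 2] by [m ^ 3 / 2] in total ([W]); each of the [n - m] extra powers is at least
    1. *)
Lemma cross_ge n m t : 1 <= t -> (m <= n)%N ->
  (n - m)%:R * m%:R ^+ 3 / 2 <= t * (ssum n t * gsum m t - ssum m t * gsum n t).
Proof.
move=> t1 mn; have t0 : 0 <= t by lra.
have W : m%:R ^+ 3 / 2 <= m%:R ^+ 2 * gsum m t - t * ssum m t.
  elim: (m) => [|k IH]; first by rewrite ssum0 gsum0 expr0n /=; lra.
  have g1 : k%:R + 1 <= gsum k t.
    elim: (k) => [|l IHl]; first by rewrite gsum0 add0r.
    by rewrite gsumS -natr1 lerD// exprn_ege1.
  have -> : k.+1%:R ^+ 2 * gsum k.+1 t - t * ssum k.+1 t =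
     k%:R ^+ 2 * gsum k t - t * ssum k t + (2 * k%:R + 1) * gsum k t.
    by rewrite gsumS ssumS (exprS t) -natr1; ring.
  have k0 : 0 <= k%:R :> R by [].
  have h : (2 * k%:R + 1) * (k%:R + 1) <= (2 * k%:R + 1) * gsum k t by rewrite ler_wpM2l//; lra.
  have k2 := sqr_ge0 (k%:R : R).
  by rewrite -natr1; move: IH h k0 k2; lra.
have D : (n - m)%:R <= gsum n t - gsum m t /\
    m%:R ^+ 2 * (gsum n t - gsum m t) <= t * (ssum n t - ssum m t).
  rewrite -(subnK mn) addnK addnC; elim: (n - m)%N => [|k [IH1 IH2]].
    by rewrite addn0 !subrr !mulr0.
  rewrite addnS gsumS ssumS -natr1.
  have p1 : 1 <= t ^+ (m + k).+1 by exact: exprn_ege1.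
  split; first lra.
  have : m%:R ^+ 2 * t ^+ (m + k).+1 <= (m + k).+1%:R ^+ 2 * t ^+ (m + k).+1.
    rewrite ler_wpM2r//; first lra.
    by rewrite ler_pXn2r ?nnegrE// ler_nat; lia.
  by rewrite (exprS t (m + k)); lra.
have [D1 D2] := D.
have -> : t * (ssum n t * gsum m t - ssum m t * gsum n t) =
  t * (ssum n t - ssum m t) * gsum m t - t * ssum m t * (gsum n t - gsum m t) by ring.
have gm := gsum_ge1 m t0.
have : m%:R ^+ 2 * (gsum n t - gsum m t) * gsum m t <= t * (ssum n t - ssum m t) * gsum m t.
  by rewrite ler_wpM2r//; lra.
have : (n - m)%:R * (m%:R ^+ 3 / 2) <= (gsum n t - gsum m t) * (m%:R ^+ 2 * gsum m t - t * ssum m t).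
  by rewrite ler_pM// divr_ge0// exprn_ge0.
lra.
Qed.

End sum_estimates.

Section seq_limits.
Variable R : realType.
Implicit Types (f g : nat -> R) (a b : R).

Lemma seqC a : (fun _ : nat => a) @ \oo --> a. Proof. exact: cvg_cst. Qed.
Lemma seqD f g a b : f @ \oo --> a -> g @ \oo --> b -> (fun k => f k + g k) @ \oo --> a + b.
Proof. exact: cvgD. Qed.
Lemma seqN f a : f @ \oo --> a -> (fun k => - f k) @ \oo --> - a.
Proof. exact: cvgN. Qed.
Lemma seqB f g a b : f @ \oo --> a -> g @ \oo --> b -> (fun k => f k - g k) @ \oo --> a - b.
Proof. exact: cvgB. Qed.
Lemma seqM f g a b : f @ \oo --> a -> g @ \oo --> b -> (fun k => f k * g k) @ \oo --> a * b.
Proof. exact: cvgM. Qed.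
Lemma seqV f a : a != 0 -> f @ \oo --> a -> (fun k => (f k)^-1) @ \oo --> a^-1.
Proof. exact: cvgV. Qed.

End seq_limits.
Arguments seqC {R} a.
Arguments seqD {R f g a b} _ _.
Arguments seqB {R f g a b} _ _.
Arguments seqM {R f g a b} _ _.
Arguments seqN {R f a} _.
Arguments seqV {R f a} _ _.

Lemma cvg_near_eq (U : topologicalType) (f g : nat -> U) (l : U) :
  (\forall k \near \oo, f k = g k) -> f @ \oo --> l -> g @ \oo --> l.
Proof. by move=> fg; apply: cvg_trans; exact: near_eq_cvg. Qed.

Section sum_limits.
Variable R : realType.
Variable n : nat -> nat.
Hypothesis n_gt0 : forall k, (0 < n k)%N.
Local Notation nu k := ((n k)%:R : R).
Hypothesis nuV : (fun k => (nu k)^-1) @ \oo --> (0 : R).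

(** [lim0], [lim1], [lim2] are the integrals of [u ^ i * exp (u x)] over [[0, b]] for [i = 0, 1, 2],
    the last two obtained from their predecessor by integration by parts. *)
Definition lim0 (b x : R) : R := (expR (b * x) - 1) / x.
Definition lim1 (b x : R) : R := (b * expR (b * x) - lim0 b x) / x.
Definition lim2 (b x : R) : R := (b ^+ 2 * expR (b * x) - 2 * lim1 b x) / x.

Variable x : R.
Hypothesis x0 : x != 0.
Let t (k : nat) : R := 1 + x / nu k.

Let nu0 k : nu k != 0. Proof. by rewrite pnatr_eq0 -lt0n. Qed.
Let nup k : 0 < nu k. Proof. by rewrite ltr0n. Qed.

Lemma cvg_base : t @ \oo --> (1 : R).
Proof.
have := seqD (seqC (1 : R)) (seqM (seqC x) nuV).
by rewrite mulr0 addr0 => H; exact: H.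
Qed.

Lemma near_base_gt0 : \forall k \near \oo, 0 < t k.
Proof. exact: (cvgr_gt _ cvg_base). Qed.

(** Squeeze by [1 - 1 / t <= ln t <= t - 1], which after multiplication by [n] become [x / t] and
    [x]. *)
Lemma cvg_ln_base : (fun k => nu k * ln (t k)) @ \oo --> x.
Proof.
have c1 : (fun k => x / t k) @ \oo --> x.
  have := seqM (seqC x) (seqV (oner_neq0 R) cvg_base).
  by rewrite invr1 mulr1 => H; exact: H.
apply: (squeeze_cvgr _ c1 (seqC x)).
near=> k; have tk : 0 < t k by near: k; exact: near_base_gt0.
have xE : x = nu k * (t k - 1) by rewrite /t addrAC subrr add0r mulrC divfK.
have h1 : ln (t k) <= t k - 1.
  by rewrite -{1}(subrK 1 (t k)) addrC le_ln1Dx//; lra.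
have h2 : 1 - (t k)^-1 <= ln (t k).
  rewrite -[leRHS]opprK -lnV ?posrE// lerNr opprB.
  by rewrite -{1}(subrK 1 (t k)^-1) addrC le_ln1Dx//; have := tk; rewrite -invr_gt0; lra.
rewrite {1}xE -mulrA mulrBl mul1r divff ?gt_eqF// ler_pM2l// h2 /=.
by rewrite [leRHS]xE ler_pM2l.
Unshelve. all: by end_near. Qed.

Variables (N : nat -> nat) (b : R).
Hypothesis Nb : (fun k => (N k)%:R / nu k) @ \oo --> b.

Lemma cvg_pow : (fun k => t k ^+ N k) @ \oo --> expR (b * x).
Proof.
have H : (fun k => expR ((N k)%:R / nu k * (nu k * ln (t k)))) @ \oo --> expR (b * x).
  apply: continuous_cvg; first exact: continuous_expR.
  exact: seqM Nb cvg_ln_base.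
apply: (cvg_near_eq _ H); near=> k.
have tk : 0 < t k by near: k; exact: near_base_gt0.
by rewrite mulrA divfK// expRM_natl lnK// posrE.
Unshelve. all: by end_near. Qed.

(** In the closed form [t - 1] is [x / n], and one divides by [x]; this is where [x != 0] enters,
    here and for the next two sums. *)
Lemma cvg_gsum : (fun k => gsum (N k) (t k) / nu k) @ \oo --> lim0 b x.
Proof.
have H := seqM (seqB (seqM cvg_base cvg_pow) (seqC (1 : R))) (seqC x^-1).
rewrite mul1r in H; apply: (@cvg_near_eq _ (fun k => (t k * t k ^+ N k - 1) * x^-1) _ _ _ H); near=> k => /=.
have := gsum_closed (N k) (t k); have -> : t k - 1 = x / nu k by rewrite /t addrAC subrr add0r.
move=> <-; field; rewrite x0 nu0//.
Unshelve. all: by end_near. Qed.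

Lemma cvg_psum : (fun k => psum (N k) (t k) / nu k ^+ 2) @ \oo --> lim1 b x.
Proof.
have H := seqM (seqB (seqM (seqD Nb nuV) cvg_pow) cvg_gsum) (seqC x^-1).
rewrite addr0 in H; apply: (@cvg_near_eq _ (fun k => (((N k)%:R / nu k + (nu k)^-1) * t k ^+ N k - gsum (N k) (t k) / nu k) * x^-1) _ _ _ H); near=> k => /=.
have := psum_closed (N k) (t k); have -> : t k - 1 = x / nu k by rewrite /t addrAC subrr add0r.
move=> E; have -> : ((N k)%:R / nu k + (nu k)^-1) * t k ^+ N k - gsum (N k) (t k) / nu k =
  (((N k)%:R + 1) * t k ^+ N k - gsum (N k) (t k)) / nu k by field; rewrite nu0.
by rewrite -E; field; rewrite x0 nu0.
Unshelve. all: by end_near. Qed.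

Lemma cvg_ssum : (fun k => ssum (N k) (t k) / nu k ^+ 3) @ \oo --> lim2 b x.
Proof.
have H := seqM (seqD (seqB (seqM (seqB (seqM Nb Nb) (seqM nuV nuV)) cvg_pow)
  (seqM (seqC (2 : R)) cvg_psum)) (seqM cvg_gsum nuV)) (seqC x^-1).
rewrite !mulr0 subr0 addr0 in H; apply: (@cvg_near_eq _ (fun k => (((N k)%:R / nu k * ((N k)%:R / nu k) - (nu k)^-1 * (nu k)^-1) * t k ^+ N k
   - 2 * (psum (N k) (t k) / nu k ^+ 2) + gsum (N k) (t k) / nu k * (nu k)^-1) * x^-1) _ _ _ H); near=> k => /=.
have := ssum_closed (N k) (t k); have -> : t k - 1 = x / nu k by rewrite /t addrAC subrr add0r.
move=> E.
have -> : ((N k)%:R / nu k * ((N k)%:R / nu k) - (nu k)^-1 * (nu k)^-1) * t k ^+ N k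
   - 2 * (psum (N k) (t k) / nu k ^+ 2) + gsum (N k) (t k) / nu k * (nu k)^-1 =
  (((N k)%:R ^+ 2 - 1) * t k ^+ N k - 2 * psum (N k) (t k) + gsum (N k) (t k)) / nu k ^+ 2.
  by field; rewrite nu0.
by rewrite -E; field; rewrite x0 nu0.
Unshelve. all: by end_near. Qed.

End sum_limits.

Section cov_limits.
Variable R : realType.
Implicit Types (a x : R).

Definition klim a x : R := lim0 1 x + lim0 a x.
Definition clim11 a x : R := lim2 1 x - lim1 1 x ^+ 2 / klim a x.
Definition clim12 a x : R := - (lim1 1 x * lim1 a x / klim a x).
Definition clim22 a x : R := lim2 a x - lim1 a x ^+ 2 / klim a x.

(* The limit of [n ^ -2 * kap n m (1 + x / n)] for [m / n -> a]. *)
Definition kaplim a x : \bar R :=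
  Phi (clim11 a x / (pi * klim a x)) (clim12 a x / (pi * klim a x))
      (clim22 a x / (pi * klim a x)).

Lemma lim0_gt0 (b x : R) : 0 < b -> x != 0 -> 0 < lim0 b x.
Proof.
move=> b0 x0; rewrite /lim0; case: (ltgtP x 0) x0 => // xs _.
  rewrite nmulr_lgt0 ?invr_lt0// subr_lt0 -expR0 ltr_expR pmulr_rlt0//.
by rewrite divr_gt0// subr_gt0 -expR0 ltr_expR mulr_gt0.
Qed.

(** Up to a nonzero factor this is the strict inequality [1 - x < exp (- x)]. *)
Lemma lim1_neq0 x : x != 0 -> lim1 1 x != 0.
Proof.
move=> x0; rewrite /lim1 /lim0 !mul1r mulf_neq0 ?invr_eq0//.
have -> : expR x - (expR x - 1) / x = expR x / x * (expR (- x) - (1 - x)).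
  by rewrite expRN; field; rewrite x0 gt_eqF// expR_gt0.
rewrite mulf_neq0//; first by rewrite mulf_neq0 ?invr_eq0// gt_eqF// expR_gt0.
by rewrite subr_eq0 gt_eqF// expR_gt1Dx// oppr_eq0.
Qed.

Variables (n m : nat -> nat) (a : R).
Hypotheses (n_gt0 : forall k, (0 < n k)%N) (a0 : 0 < a).
Local Notation nu k := ((n k)%:R : R).
Hypothesis nuV : (fun k => (nu k)^-1) @ \oo --> (0 : R).
Hypothesis mna : (fun k => (m k)%:R / nu k) @ \oo --> a.
Variable x : R.
Hypothesis x0 : x != 0.
Let t (k : nat) : R := 1 + x / nu k.

Let nu0 k : nu k != 0. Proof. by rewrite pnatr_eq0 -lt0n. Qed.
Let nup k : 0 < nu k. Proof. by rewrite ltr0n. Qed.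

Let nn1 : (fun k => nu k / nu k) @ \oo --> (1 : R).
Proof. by under eq_fun do rewrite divff//; exact: seqC. Qed.

Lemma klim_gt0 : 0 < klim a x.
Proof. by rewrite addr_gt0// lim0_gt0. Qed.

Let k0 : klim a x != 0. Proof. by rewrite gt_eqF// klim_gt0. Qed.

Lemma cvg_Ksum : (fun k => Ksum (n k) (m k) (t k) / nu k) @ \oo --> klim a x.
Proof.
have H := seqD (cvg_gsum n_gt0 nuV x0 nn1) (cvg_gsum n_gt0 nuV x0 mna).
by apply: (@cvg_near_eq _ (fun k => gsum (n k) (t k) / nu k + gsum (m k) (t k) / nu k) _ _ _ H); near=> k; rewrite /= -mulrDl.
Unshelve. all: by end_near. Qed.

Let near_t : \forall k \near \oo, 0 < t k. Proof. exact: near_base_gt0. Qed.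

Lemma cvg_cov11 : (fun k => cov11 (n k) (m k) (t k) / nu k ^+ 3) @ \oo --> clim11 a x.
Proof.
have p1 := cvg_psum n_gt0 nuV x0 nn1.
have H := seqB (cvg_ssum n_gt0 nuV x0 nn1)
  (seqM (seqM (cvg_base nuV x) (seqM p1 p1)) (seqV k0 cvg_Ksum)).
rewrite mul1r -expr2 in H; apply: (@cvg_near_eq _ (fun k => ssum (n k) (t k) / nu k ^+ 3 - t k * ((psum (n k) (t k) / nu k ^+ 2) * (psum (n k) (t k) / nu k ^+ 2)) * (Ksum (n k) (m k) (t k) / nu k)^-1) _ _ _ H); near=> k => /=.
have tk : 0 < t k by near: k; exact: near_t.
have K1 : Ksum (n k) (m k) (t k) != 0 by rewrite gt_eqF// Ksum_gt0// ltW.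
by rewrite /cov11 /t; field; rewrite nu0 /=; exact: K1.
Unshelve. all: by end_near. Qed.

Lemma cvg_cov12 : (fun k => cov12 (n k) (m k) (t k) / nu k ^+ 3) @ \oo --> clim12 a x.
Proof.
have p1 := cvg_psum n_gt0 nuV x0 nn1; have p2 := cvg_psum n_gt0 nuV x0 mna.
have H := seqN (seqM (seqM (cvg_base nuV x) (seqM p1 p2)) (seqV k0 cvg_Ksum)).
rewrite mul1r in H; apply: (@cvg_near_eq _ (fun k => - (t k * ((psum (n k) (t k) / nu k ^+ 2) * (psum (m k) (t k) / nu k ^+ 2)) * (Ksum (n k) (m k) (t k) / nu k)^-1)) _ _ _ H); near=> k => /=.
have tk : 0 < t k by near: k; exact: near_t.
have K1 : Ksum (n k) (m k) (t k) != 0 by rewrite gt_eqF// Ksum_gt0// ltW.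
by rewrite /cov12 /t; field; rewrite nu0 /=; exact: K1.
Unshelve. all: by end_near. Qed.

Lemma cvg_cov22 : (fun k => cov22 (n k) (m k) (t k) / nu k ^+ 3) @ \oo --> clim22 a x.
Proof.
have p2 := cvg_psum n_gt0 nuV x0 mna.
have H := seqB (cvg_ssum n_gt0 nuV x0 mna)
  (seqM (seqM (cvg_base nuV x) (seqM p2 p2)) (seqV k0 cvg_Ksum)).
rewrite mul1r -expr2 in H; apply: (@cvg_near_eq _ (fun k => ssum (m k) (t k) / nu k ^+ 3 - t k * ((psum (m k) (t k) / nu k ^+ 2) * (psum (m k) (t k) / nu k ^+ 2)) * (Ksum (n k) (m k) (t k) / nu k)^-1) _ _ _ H); near=> k => /=.
have tk : 0 < t k by near: k; exact: near_t.
have K1 : Ksum (n k) (m k) (t k) != 0 by rewrite gt_eqF// Ksum_gt0// ltW.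
by rewrite /cov22 /t; field; rewrite nu0 /=; exact: K1.
Unshelve. all: by end_near. Qed.

(** The Gram inequality of the finite sums passes to the limit as [lim1 ^+ 2 <= lim2 * lim0], whose
    left side is nonzero. *)
Lemma lim2_gt0 : 0 < lim2 1 x.
Proof.
have l0 : 0 < lim0 1 x by exact: lim0_gt0.
suff h : lim1 1 x ^+ 2 <= lim2 1 x * lim0 1 x.
  rewrite -(pmulr_lgt0 _ l0); apply: lt_le_trans h.
  by rewrite lt_def sqr_ge0 sqrf_eq0 lim1_neq0.
have p1 := cvg_psum n_gt0 nuV x0 nn1.
have c1 := seqM (cvg_base nuV x) (seqM p1 p1); rewrite mul1r -expr2 in c1.
have c2 := seqM (cvg_ssum n_gt0 nuV x0 nn1) (cvg_gsum n_gt0 nuV x0 nn1).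
apply: (ler_cvg_to c1 c2); near=> k => /=.
have tk : 0 < t k by near: k; exact: near_t.
have := gram_ge0 (n k) (ltW tk); rewrite /gram subr_ge0 => h.
rewrite -/(t k).
have -> : t k * (psum (n k) (t k) / nu k ^+ 2 * (psum (n k) (t k) / nu k ^+ 2)) =
  t k * psum (n k) (t k) ^+ 2 / nu k ^+ 4 by field; rewrite nu0.
have -> : ssum (n k) (t k) / nu k ^+ 3 * (gsum (n k) (t k) / nu k) =
  ssum (n k) (t k) * gsum (n k) (t k) / nu k ^+ 4 by field; rewrite nu0.
by rewrite ler_pM2r// invr_gt0 exprn_gt0.
Unshelve. all: by end_near. Qed.

Lemma clim11_gt0 : 0 < clim11 a x.
Proof.
have la : 0 < lim0 a x by exact: lim0_gt0.
apply: (@lt_le_trans _ _ (lim2 1 x * lim0 a x / klim a x)).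
  by rewrite divr_gt0 ?klim_gt0// mulr_gt0// lim2_gt0.
have c1 := seqM (seqM (cvg_ssum n_gt0 nuV x0 nn1) (cvg_gsum n_gt0 nuV x0 mna)) (seqV k0 cvg_Ksum).
apply: (ler_cvg_to c1 cvg_cov11); near=> k => /=.
have tk : 0 < t k by near: k; exact: near_t.
have K1 : Ksum (n k) (m k) (t k) != 0 by rewrite gt_eqF// Ksum_gt0// ltW.
have := cov11_ge (n k) (m k) (ltW tk); rewrite -/(t k) => h.
have -> : ssum (n k) (t k) / nu k ^+ 3 * (gsum (m k) (t k) / nu k) / (Ksum (n k) (m k) (t k) / nu k) =
  ssum (n k) (t k) * gsum (m k) (t k) / Ksum (n k) (m k) (t k) / nu k ^+ 3.
  by field; rewrite nu0 K1.
by rewrite ler_pM2r// invr_gt0 exprn_gt0.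
Unshelve. all: by end_near. Qed.

Lemma clim_cs : clim12 a x ^+ 2 <= clim11 a x * clim22 a x.
Proof.
rewrite expr2; apply: (ler_cvg_to (seqM cvg_cov12 cvg_cov12) (seqM cvg_cov11 cvg_cov22)).
near=> k => /=; have tk : 0 < t k by near: k; exact: near_t.
by rewrite ![_ / _ * (_ / _)]mulrACA -expr2 ler_wpM2r ?cov_cs ?(ltW tk)//.
Unshelve. all: by end_near. Qed.

(** Homogeneity of [Phi]: the covariances are of order [n ^ 3] and [Ksum] of order [n], hence [kap]
    of order [n ^ 2]. *)
Lemma kap_scale k : 0 <= t k -> ((nu k ^+ 2)^-1%:E * kap (n k) (m k) (t k))%E =
  Phi (cov11 (n k) (m k) (t k) / nu k ^+ 3 / (pi * (Ksum (n k) (m k) (t k) / nu k)))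
      (cov12 (n k) (m k) (t k) / nu k ^+ 3 / (pi * (Ksum (n k) (m k) (t k) / nu k)))
      (cov22 (n k) (m k) (t k) / nu k ^+ 3 / (pi * (Ksum (n k) (m k) (t k) / nu k))).
Proof.
move=> tk; have K0 := Ksum_gt0 (n k) (m k) tk.
have pi0 := pi_gt0 R.
rewrite /kap muleA -EFinM -PhiZ; last by rewrite mulr_gt0 ?invr_gt0 ?mulr_gt0 ?exprn_gt0.
have K1 : Ksum (n k) (m k) (t k) != 0 by rewrite gt_eqF.
have p1 : pi != 0 :> R by rewrite gt_eqF.
have E c : (nu k ^+ 2)^-1 * (pi * Ksum (n k) (m k) (t k))^-1 * c =
    c / nu k ^+ 3 / (pi * (Ksum (n k) (m k) (t k) / nu k)).
  move: (nu0 k) K1 p1; move: (nu k) (Ksum _ _ _) (pi : R) => u K p u0 K0' p0.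
  by field; rewrite ?u0 ?K0' ?p0.
by rewrite !E.
Qed.

Lemma cvg_kap : (fun k => (nu k ^+ 2)^-1%:E * kap (n k) (m k) (t k))%E @ \oo --> kaplim a x.
Proof.
have pi0 := pi_gt0 R.
have cD := seqV (_ : pi * klim a x != 0) (seqM (seqC pi) cvg_Ksum).
have p0 : 0 < pi * klim a x by rewrite mulr_gt0// klim_gt0.
have {}cD := cD (lt0r_neq0 p0).
have := Phi_cvg _ (seqM cvg_cov11 cD) (seqM cvg_cov12 cD) (seqM cvg_cov22 cD).
move=> /(_ (lt0r_neq0 (divr_gt0 clim11_gt0 p0))).
move=> H; apply: (cvg_near_eq _ H); near=> k => /=.
have tk : 0 < t k by near: k; exact: near_t.
by rewrite kap_scale// ltW.
Unshelve. all: by end_near. Qed.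

End cov_limits.

(** * The limit *)

Section line_integral.
Variable R : realType.
Local Notation leb := (@lebR R).
Local Notation l2 := (@leb2 R).

Lemma measurable_real_sum d (W : measurableType d) (N : nat) (c : nat -> R) (e : nat -> nat) (f : W -> R) :
  measurable_fun setT f -> measurable_fun setT (fun w => \sum_(j < N) c j * f w ^+ e j).
Proof.
move=> mf; elim: N => [|N IH]; first by under eq_fun do rewrite big_ord0; exact: measurable_cst.
under eq_fun do rewrite big_ord_recr /=.
by apply: measurable_funD => //; apply: measurable_funM => //; exact: measurable_funX.
Qed.

Lemma measurable_kap n m : measurable_fun setT (@kap R n m).
Proof.
have mi : measurable_fun [set: R] (fun t : R => t) by exact: measurable_id.
have mg N : measurable_fun [set: R] (@gsum R N).
  have := measurable_real_sum N.+1 (fun=> 1) id mi.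
  by apply: eq_measurable_fun => t _; apply: eq_bigr => j _; rewrite mul1r.
have mp N : measurable_fun [set: R] (@psum R N).
  exact: (measurable_real_sum N.+1 (fun j => j%:R) predn mi).
have ms N : measurable_fun [set: R] (@ssum R N).
  exact: (measurable_real_sum N.+1 (fun j => j%:R ^+ 2) predn mi).
have mK : measurable_fun [set: R] (@Ksum R n m) by exact: measurable_funD.
have mKV := measurable_inv mK.
have tp N N' : measurable_fun [set: R] (fun t => t * psum N t * psum N' t / Ksum n m t).
  by apply: measurable_funM => //; apply: measurable_funM => //; exact: measurable_funM.
apply: emeasurable_funM.
  by apply/measurable_EFinP; apply: measurable_inv; exact: measurable_funM.
apply: measurable_Phi.
- apply: measurable_funB => //; apply: measurable_funM => //; apply: measurable_funM => //.
  exact: measurable_funX.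
- exact: measurableT_comp (tp n m).
- apply: measurable_funB => //; apply: measurable_funM => //; apply: measurable_funM => //.
  exact: measurable_funX.
Qed.

Lemma measurable_kaplim (a : R) : measurable_fun setT (kaplim a).
Proof.
have mi : measurable_fun [set: R] (fun t : R => t) by exact: measurable_id.
have mV := measurable_inv mi.
have me (b : R) : measurable_fun [set: R] (fun x : R => expR (b * x)).
  by apply: measurableT_comp => //; exact: measurable_funM.
have m0 (b : R) : measurable_fun [set: R] (lim0 b).
  by apply: measurable_funM => //; exact: measurable_funB.
have m1 (b : R) : measurable_fun [set: R] (lim1 b).
  by apply: measurable_funM => //; apply: measurable_funB => //; exact: measurable_funM.
have m2 (b : R) : measurable_fun [set: R] (lim2 b).
  by apply: measurable_funM => //; apply: measurable_funB; exact: measurable_funM.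
have mk : measurable_fun [set: R] (klim a) by exact: measurable_funD.
have mkV := measurable_inv mk.
have mpV : measurable_fun [set: R] (fun x => (pi * klim a x)^-1).
  by apply: measurable_inv; exact: measurable_funM.
have mc b : measurable_fun [set: R] (fun x => lim2 b x - lim1 b x ^+ 2 / klim a x).
  by apply: measurable_funB => //; apply: measurable_funM => //; exact: measurable_funX.
apply: measurable_Phi; apply: measurable_funM => //; [exact: mc| |exact: mc].
apply: measurableT_comp => //; apply: measurable_funM => //; exact: measurable_funM.
Qed.

Lemma Phi_ge0 (s11 s12 s22 : R) : (0 <= Phi s11 s12 s22)%E.
Proof. by apply: integral_ge0 => w _; rewrite lee_fin normr_ge0. Qed.

Lemma kap_ge0 n m (t : R) : 0 <= t -> (0 <= kap n m t)%E.
Proof.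
move=> t0; rewrite mule_ge0 ?Phi_ge0// lee_fin invr_ge0 mulr_ge0 ?pi_ge0//.
exact: ltW (Ksum_gt0 n m t0).
Qed.

(** One factor [1 / n] normalizes the count, the other is [dt = dx / n]. The indicator restricts to
    [t >= 0], and the absolute value keeps the argument of [kap] in the range where it is
    nonnegative. *)
Definition line_density n m (x : R) : \bar R :=
  ((n%:R ^+ 2)^-1%:E * (kap n m `|n%:R^-1 * x + 1|%R *
    (\1_(`[0%R, +oo[) (n%:R^-1 * x + 1)%R : R)%:E))%E.

Let dens n m (t : R) : \bar R := (kap n m `|t|%R * (\1_(`[0%R, +oo[) t : R)%:E)%E.

Let dens_ge0 n m t : (0 <= dens n m t)%E.
Proof. by rewrite mule_ge0 ?kap_ge0// lee_fin. Qed.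

Let mka n m : measurable_fun setT (fun t : R => kap n m `|t|).
Proof.
apply: (measurableT_comp (measurable_kap n m)).
by apply: continuous_measurable_fun; exact: norm_continuous.
Qed.

Let mdens n m : measurable_fun setT (dens n m).
Proof.
apply: emeasurable_funM; first exact: mka.
by apply/measurable_EFinP; exact: measurable_indic.
Qed.

Let maff n : measurable_fun setT (fun x : R => n%:R^-1 * x + 1 : R).
Proof. by apply: measurable_funD => //; exact: measurable_funM. Qed.

Lemma line_density_ge0 n m x : (0 <= line_density n m x)%E.
Proof. by rewrite mule_ge0 ?dens_ge0// lee_fin invr_ge0 sqr_ge0. Qed.

Lemma measurable_line_density n m : measurable_fun setT (line_density n m).
Proof. by apply: measurable_funeM; exact: measurableT_comp (mdens n m) (maff n). Qed.

Lemma expected_zeros_line : exists2 c : R, 0 < c &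
  forall (d : measure_display) (T : measurableType d) (P : probability T R) (n m : nat)
    (A : 'I_n.+1 -> T -> R[i]) (B : 'I_m.+1 -> T -> R[i]),
  (0 < n)%N -> kac_coefficients P A B ->
  (expected_zeros P A B * (n%:R^-1)%:E = c%:E * \int[leb]_x line_density n m x)%E.
Proof.
have [c c0 Hc] := radial_integral R; exists c => // d T P n m A B n0 kac.
have nn0 : n%:R != 0 :> R by rewrite pnatr_eq0 -lt0n.
have nV0 : n%:R^-1 != 0 :> R by rewrite invr_eq0.
rewrite (expected_zeros_kap kac n0).
transitivity ((c%:E * \int[leb]_t dens n m t) * (n%:R^-1)%:E)%E.
  have ka0 (t : R) : (0 <= kap n m `|t|)%E by exact: kap_ge0.
  congr (_ * _)%E; rewrite -(Hc _ (mka n m) ka0).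
  by apply: eq_integral => p _; rewrite ger0_norm// sq_ge0.
rewrite -muleA; congr (_ * _)%E.
have mda := measurableT_comp (mdens n m) (maff n).
have n20 : (0 <= ((n%:R ^+ 2)^-1 : R)%:E)%E by rewrite lee_fin invr_ge0 sqr_ge0.
have := ge0_integralZl leb measurableT mda (fun x _ => dens_ge0 n m _) n20.
rewrite /line_density /= => ->.
have := @lebR_affine R n%:R^-1 1 (dens n m) nV0 (mdens n m) (dens_ge0 n m).
rewrite /dens => ->; rewrite muleA -EFinM muleC; congr (_%:E * _)%E.
by rewrite ger0_norm ?invr_ge0// invrK expr2 invfM -mulrA mulVf// mulr1.
Qed.

(** [Phi_le] reduces the density to [cov11 + cov22], and [cov_bound] is applied with
    [b = (n - m) / n >= 1 - a], which makes the majorant independent of [n]. *)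
Lemma line_density_le n m (a x : R) : a < 1 -> (m + 2 <= n)%N -> m%:R <= a * n%:R ->
  (line_density n m x <= (4 * (4 + 8 / (1 - a) ^+ 2) * G2 R / pi * (1 + x ^+ 2)^-1)%:E)%E.
Proof.
move=> a1 mn man; set M := 4 * _ * _ / _.
have n0 : (0 < n)%N by lia.
have mn' : (m <= n)%N by lia.
have n0' : 0 < n%:R :> R by rewrite ltr0n.
have G0 := G2_gt0 R; have pi0 := pi_gt0 R.
have a2 : 0 < (1 - a) ^+ 2 by rewrite exprn_gt0// subr_gt0.
have D0 : 0 < 1 + x ^+ 2 by rewrite ltr_pwDl ?sqr_ge0.
have M0 : 0 <= M.
  by rewrite divr_ge0 ?(ltW pi0)// mulr_ge0 ?(ltW G0)// mulr_ge0// addr_ge0// divr_ge0// ltW.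
rewrite /line_density indicE; set t := _ * x + 1.
have [t0|t0] := boolP (t \in `[0%R, +oo[%classic); last first.
  by rewrite !mule0 lee_fin mulr_ge0// invr_ge0 ltW.
move: t0 => /set_mem; rewrite /= in_itv /= andbT => t0.
rewrite mule1 ger0_norm//.
have xE : x = n%:R * (t - 1) by rewrite /t addrK mulVKf// gt_eqF.
pose b : R := (n - m)%:R / n%:R.
have nb : (n - m)%:R = b * n%:R by rewrite /b divfK// gt_eqF.
have ba : 1 - a <= b by rewrite /b ler_pdivlMr// natrB//; lra.
have b0 : 0 < b by lra.
have K0 := Ksum_gt0 n m t0.
have c0 := cov11_gt0 m n0 t0; have cs := cov_cs n m t0.
have B0 := cov_bound t0 mn b0 nb; rewrite -xE in B0.
apply: (@le_trans _ _ ((n%:R ^+ 2)^-1 * ((pi * Ksum n m t)^-1 *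
    (4 * (cov11 n m t + cov22 n m t) * G2 R)))%:E).
  rewrite !EFinM lee_wpmul2l ?lee_fin ?invr_ge0 ?sqr_ge0//.
  rewrite lee_wpmul2l ?lee_fin ?invr_ge0 ?mulr_ge0 ?(ltW pi0) ?(ltW K0)//.
  by rewrite -!EFinM; exact: Phi_le.
have nK : 0 < n%:R ^+ 2 * Ksum n m t by rewrite mulr_gt0// exprn_gt0.
rewrite lee_fin ler_pdivlMr//.
have E (p K u c g X : R) : p != 0 -> K != 0 -> u != 0 ->
    (u ^+ 2)^-1 * ((p * K)^-1 * (4 * c * g)) * X = 4 * g / p * (X * c / (u ^+ 2 * K)).
  by move=> p0 K0' u0; field; rewrite p0 K0' u0.
rewrite E ?(lt0r_neq0 pi0) ?(lt0r_neq0 K0) ?(lt0r_neq0 n0')//.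
have -> : M = (4 * G2 R / pi) * (4 + 8 / (1 - a) ^+ 2).
  have a1' : 0 < 1 - a by rewrite subr_gt0.
  by rewrite /M (mulrAC 4) [LHS]mulrAC.
rewrite ler_wpM2l//; first by rewrite divr_ge0 ?(ltW pi0)// mulr_ge0// ltW.
rewrite ler_pdivrMr//; apply: (le_trans B0); rewrite ler_wpM2r ?(ltW nK)//.
rewrite lerD2l ler_wpM2l// lef_pV2 ?posrE ?exprn_gt0//; last by rewrite subr_gt0.
by rewrite ler_pXn2r ?nnegrE ?(ltW b0)// subr_ge0 ltW.
Qed.

Lemma integrable_cauchy (M : R) : 0 <= M ->
  leb.-integrable setT (fun x => (M * (1 + x ^+ 2)^-1)%:E).
Proof.
move=> M0; pose h (x : R) := ((1 + x ^+ 2)^-1)%:E.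
have h0 x : (0 <= h x)%E by rewrite lee_fin invr_ge0 addr_ge0// sqr_ge0.
have mh : measurable_fun setT h.
  by apply/measurable_EFinP; apply: measurable_inv; apply: measurable_funD.
have mHi : measurable_fun setT (fun x => h x * (\1_(`[0%R, +oo[) x : R)%:E)%E.
  by apply: emeasurable_funM => //; apply/measurable_EFinP; exact: measurable_indic.
have hi0 x : (0 <= h x * (\1_(`[0%R, +oo[) x : R)%:E)%E by rewrite mule_ge0// lee_fin.
have I1 : (\int[leb]_x (h x * (\1_(`[0%R, +oo[) x : R)%:E) = (pi / 2)%:E)%E.
  rewrite lebR_integral// -integral0y_oneDsqr [RHS]integral_mkcond.
  apply: eq_integral => x _; rewrite patchE indicE /h /oneDsqr.
  by case: ifPn => _; rewrite ?mule1 ?mule0.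
have I2 : (\int[leb]_x (h (-1 * x + 0)%R * (\1_(`[0%R, +oo[) (-1 * x + 0)%R : R)%:E) = (pi / 2)%:E)%E.
  have n1 : -1 != 0 :> R by rewrite oppr_eq0 oner_eq0.
  by rewrite (lebR_affine 0 n1 mHi hi0) I1 normrN1 invr1 mul1e.
have maff1 : measurable_fun [set: R] (fun x : R => -1 * x + 0).
  by apply: measurable_funD => //; exact: measurable_funM.
have I3 : (\int[leb]_x h x < +oo)%E.
  apply: (@le_lt_trans _ _ ((pi / 2)%:E + (pi / 2)%:E)%E); last by rewrite -EFinD ltry.
  rewrite -{1}I1 -I2 -ge0_integralD//; last exact: measurableT_comp mHi maff1.
  apply: ge0_le_integral => //.
  - by apply: emeasurable_funD => //; exact: measurableT_comp mHi maff1.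
  move=> x _; rewrite !indicE /h mulN1r addr0 sqrrN.
  have [x0|x0] := leP 0 x.
    rewrite [x \in _]mem_set ?mule1 ?leeDl ?mule_ge0 ?lee_fin//; last by rewrite /= in_itv /= x0.
    by rewrite invr_ge0 addr_ge0// sqr_ge0.
  rewrite [- x \in _]mem_set ?mule1 ?leeDr ?mule_ge0 ?lee_fin//; last by rewrite /= in_itv /= oppr_ge0 ltW.
  by rewrite invr_ge0 addr_ge0// sqr_ge0.
apply/integrableP; split.
  by apply/measurable_EFinP; apply: measurable_funM => //; exact/measurable_EFinP.
rewrite (eq_integral (fun x => (M%:E * h x)%E)); last first.
  move=> x _; rewrite gee0_abs//.
  by rewrite lee_fin mulr_ge0// invr_ge0 addr_ge0// sqr_ge0.
by rewrite ge0_integralZl//; apply: lte_mul_pinfty.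
Qed.

End line_integral.

Section limit_constant.
Variable R : realType.
Local Notation leb := (@lebR R).
Variable a : R.
Hypotheses (a0 : 0 < a) (a1 : a < 1).

Section along_sequence.
Variables n m : nat -> nat.
Hypothesis mn : forall k, (m k + 2 <= n k)%N.
Hypothesis man : forall k, (m k)%:R <= a * (n k)%:R.
Hypothesis nuV : (fun k => ((n k)%:R : R)^-1) @ \oo --> (0 : R).
Hypothesis mna : (fun k => (m k)%:R / (n k)%:R : R) @ \oo --> a.

Let n0 k : (0 < n k)%N. Proof. by have := mn k; lia. Qed.

Lemma cvg_line_density (x : R) : x != 0 ->
  (fun k => line_density (n k) (m k) x) @ \oo --> kaplim a x.
Proof.
move=> x0; have H := cvg_kap n0 a0 nuV mna x0.
apply: (@cvg_near_eq _ _ _ _ _ H); near=> k => /=.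
have tk : 0 < 1 + x / (n k)%:R by near: k; exact: near_base_gt0.
have tE : (n k)%:R^-1 * x + 1 = 1 + x / (n k)%:R by rewrite addrC mulrC.
rewrite /line_density tE ger0_norm ?(ltW tk)// indicE mem_set ?mule1//=.
by rewrite in_itv /= ltW.
Unshelve. all: by end_near. Qed.

Lemma cvg_integral_line_density :
  leb.-integrable setT (kaplim a) /\
  (fun k => \int[leb]_x line_density (n k) (m k) x)%E @ \oo --> (\int[leb]_x kaplim a x)%E.
Proof.
pose M : R := 4 * (4 + 8 / (1 - a) ^+ 2) * G2 R / pi.
have M0 : 0 <= M.
  rewrite divr_ge0 ?pi_ge0// mulr_ge0 ?(ltW (G2_gt0 R))// mulr_ge0//.
  by rewrite addr_ge0// divr_ge0// sqr_ge0.
have [] := @dominated_convergence _ _ R leb setT measurableT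
  (fun k x => line_density (n k) (m k) x) (kaplim a)
  (fun x => (M * (1 + x ^+ 2)^-1)%:E) => //.
- by move=> k; exact: measurable_line_density.
- exact: measurable_kaplim.
(* The pointwise limit is available off [x = 0], a null set. *)
- exists [set 0 : R]; split => //.
    exact: lebesgue_measure_set1.
  move=> x /= H; apply: contrapT => x0; apply: H => _.
  by apply: cvg_line_density; apply/eqP.
- exact: integrable_cauchy.
- apply: aeW => x k _; rewrite gee0_abs ?line_density_ge0//.
  exact: line_density_le.
Qed.

(** [cov_diff] and [cross_ge] divided by [n ^ 3]: the quantity [(n - m) m ^ 3 / (2 Ksum n ^ 3)]
    tends to the left-hand side. *)
Lemma clim_diff (x : R) : 0 < x ->
  (1 - a) * a ^+ 3 / 2 / klim a x <= clim11 a x - clim22 a x.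
Proof.
move=> xp; have x0 : x != 0 by rewrite gt_eqF.
have k0 := klim_gt0 a0 x0.
have C1 := seqM (cvg_base nuV x) (seqB (cvg_cov11 n0 a0 nuV mna x0) (cvg_cov22 n0 a0 nuV mna x0)).
rewrite mul1r in C1.
have C2 := seqM (seqM (seqM (seqB (seqC 1) mna) (seqM mna (seqM mna mna))) (seqC 2^-1))
  (seqV (lt0r_neq0 k0) (cvg_Ksum n0 nuV mna x0)).
have -> : (1 - a) * a ^+ 3 = (1 - a) * (a * (a * a)) by ring.
apply: (ler_cvg_to C2 C1); near=> k => /=.
have np : 0 < (n k)%:R :> R by rewrite ltr0n.
have t1 : 1 <= 1 + x / (n k)%:R :> R by rewrite lerDl divr_ge0// ltW.
set t := 1 + _ in t1 *; have t0 : 0 <= t by lra.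
have mnk : (m k <= n k)%N by have := mn k; lia.
have K0 := Ksum_gt0 (n k) (m k) t0.
have h1 := cross_ge t1 mnk; have h2 := cov_diff t0 mnk.
rewrite natrB// in h1.
rewrite -mulrBl.
have E1 (u v K : R) : u != 0 -> K != 0 ->
  (1 - v / u) * (v / u * (v / u * (v / u))) * 2^-1 / (K / u) =
  (u - v) * v ^+ 3 / 2 / K / u ^+ 3 by move=> u0 K0'; field; rewrite u0 K0'.
rewrite E1 ?(lt0r_neq0 np) ?(lt0r_neq0 K0)// [leRHS]mulrA ler_wpM2r ?invr_ge0 ?exprn_ge0//.
apply: (@le_trans _ _ (t * ((ssum (n k) t * gsum (m k) t - ssum (m k) t * gsum (n k) t) / Ksum (n k) (m k) t))).
  by rewrite mulrA ler_wpM2r// invr_ge0 ltW.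
by rewrite ler_wpM2l.
Unshelve. all: by end_near. Qed.

(** [Phi_ge] applied to [clim_diff]. On this interval [klim <= 2 e], used once for the denominator
    in [clim_diff] and once for the normalization by [pi * klim]. *)
Lemma kaplim_ge (x : R) : 0 < x -> x <= 1 ->
  (((1 - a) * a ^+ 3 / (2 * pi * (2 * expR 1) ^+ 2) * G2 R)%:E <= kaplim a x)%E.
Proof.
move=> xp x1; have x0 : x != 0 by rewrite gt_eqF.
have k0 := klim_gt0 a0 x0; have pi0 := pi_gt0 R; have e1 := expR_gt0 (1 : R).
have D := clim_diff xp.
have pk : 0 < pi * klim a x by rewrite mulr_gt0.
have a3 : 0 <= (1 - a) * a ^+ 3 by rewrite mulr_ge0 ?exprn_ge0 ?subr_ge0// ltW.
have kE : klim a x <= 2 * expR 1.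
  have l1 : lim0 1 x <= expR 1.
    rewrite /lim0 mul1r ler_pdivrMr//.
    have h := expR_ge1Dx (- x); have h2 : expR x <= expR 1 by rewrite ler_expR.
    have ex := expR_gt0 x.
    have : expR x * (1 - x) <= 1.
      by rewrite -ler_pdivlMl// mulr1 -expRN.
    have : x * expR x <= x * expR 1 by rewrite ler_wpM2l// ltW.
    lra.
  have l2 : lim0 a x <= lim0 1 x.
    rewrite /lim0 ler_wpM2r ?invr_ge0 ?(ltW xp)// lerB// ler_expR.
    by rewrite ler_wpM2r// ltW.
  by rewrite /klim; lra.
have D0 : 0 <= clim11 a x - clim22 a x.
  by apply: le_trans D; rewrite !divr_ge0// ltW.
rewrite /kaplim; apply: le_trans (Phi_ge _ _ _).
- rewrite lee_fin ler_wpM2r ?(ltW (G2_gt0 R))// -mulrBl.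
  rewrite ler_pdivlMr//; apply: le_trans D.
  rewrite ler_pdivlMr//.
  have E (u p e k : R) : p != 0 -> e != 0 ->
      u / (2 * p * (2 * e) ^+ 2) * (p * k) * k = u / 2 * (k ^+ 2 / (2 * e) ^+ 2).
    by move=> p0 e0; field; rewrite ?p0 ?e0.
  rewrite E ?(lt0r_neq0 pi0) ?(lt0r_neq0 e1)//.
  rewrite ler_piMr ?divr_ge0// ler_pdivrMr ?exprn_gt0 ?mulr_gt0// mul1r.
  by rewrite ler_pXn2r ?nnegrE// ltW// mulr_gt0.
- by rewrite divr_gt0// (clim11_gt0 n0 a0 nuV mna x0).
- rewrite exprMn expr2 [X in _ * X]expr2 mulrACA [leRHS]mulrACA.
  rewrite [leLHS]mulrACA ler_wpM2r ?mulr_ge0 ?invr_ge0 ?(ltW pk)//.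
  by rewrite -expr2 (clim_cs n0 a0 nuV mna x0).
- by rewrite ler_wpM2r ?invr_ge0 ?(ltW pk)//; move: D0; lra.
Qed.

Lemma integral_kaplim : exists2 C : R, 0 < C & (\int[leb]_x kaplim a x)%E = C%:E.
Proof.
have [/integrableP[mk Hk] _] := cvg_integral_line_density.
have kp x : (0 <= kaplim a x)%E by exact: Phi_ge0.
have I0 : (0 <= \int[leb]_x kaplim a x)%E by apply: integral_ge0.
have fk : (\int[leb]_x kaplim a x)%E \is a fin_num.
  rewrite ge0_fin_numE//; move: Hk.
  by under eq_integral do rewrite gee0_abs//.
exists (fine (\int[leb]_x kaplim a x)%E); last by rewrite fineK.
rewrite -lte_fin fineK//.
set de : R := (1 - a) * a ^+ 3 / (2 * pi * (2 * expR 1) ^+ 2) * G2 R.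
have de0 : 0 < de.
  rewrite mulr_gt0 ?G2_gt0// divr_gt0// mulr_gt0 ?exprn_gt0 ?subr_gt0 ?mulr_gt0 ?pi_gt0 ?expR_gt0//.
have mI : measurable `]0 : R, 1]%classic by [].
apply: (@lt_le_trans _ _ (\int[leb]_(x in `]0%R, 1%R]) de%:E)%E).
  rewrite integral_cst// [X in (_ * X)%E](_ : _ = 1%E) ?mule1 ?lte_fin//.
  transitivity (@lebesgue_measure R `]0%R, 1%R]%classic); first by [].
  by rewrite lebesgue_measure_itv /= lte_fin ltr01 sube0.
apply: (@le_trans _ _ (\int[leb]_(x in `]0%R, 1%R]) kaplim a x)%E); last first.
  by apply: ge0_subset_integral.
apply: ge0_le_integral => //.
- by move=> x _; rewrite lee_fin ltW.
- exact: measurable_funTS.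
- by move=> x /=; rewrite in_itv /= => /andP[xp x1]; exact: kaplim_ge.
Qed.

End along_sequence.

(** The properties of [kaplim a] were obtained along a sequence, so one has to be exhibited: [m] the
    integer part of [a n] works for every real [a], and the constant then depends on [a] alone. *)
Lemma integral_kaplim_pos : exists2 C : R, 0 < C & (\int[leb]_x kaplim a x)%E = C%:E.
Proof.
(* Ensures [2 <= (1 - a) * n], whence [m + 2 <= n]. *)
pose N0 := (Num.truncn (2 / (1 - a))).+1.
pose n k := (k + N0)%N; pose m k := Num.truncn (a * (n k)%:R).
have a1' : 0 < 1 - a by rewrite subr_gt0.
have an k : 0 <= a * (n k)%:R by rewrite mulr_ge0// ltW.
have man k : (m k)%:R <= a * (n k)%:R by rewrite truncn_le.
have np k : 0 < (n k)%:R :> R by rewrite ltr0n /n /N0 addnS.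
have nuV : (fun k => ((n k)%:R : R)^-1) @ \oo --> (0 : R).
  apply/gtr0_cvgV0; first by near=> k; exact: np.
  apply/cvgrnyP; apply/cvgnyPge => A; near=> k.
  by rewrite (@leq_trans k)// ?leq_addr//; near: k; exact: nbhs_infty_ge.
have mna : (fun k => (m k)%:R / (n k)%:R : R) @ \oo --> a.
  have l1 : (fun k => a - (n k)%:R^-1 : R) @ \oo --> a.
    by have := seqB (seqC a) nuV; rewrite subr0.
  apply: (squeeze_cvgr _ l1 (seqC a)); near=> k.
  rewrite ler_pdivlMr// ler_pdivrMr// man andbT mulrBl mulVf ?gt_eqF//.
  have := real_truncnS_gt (num_real (a * (n k)%:R)); rewrite -/(m k) -natr1; lra.
apply: (@integral_kaplim n m) => // k.
rewrite -(ler_nat R) natrD.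
have N0E : 2 / (1 - a) < N0%:R by apply: real_truncnS_gt; exact: num_real.
have : 2 <= (1 - a) * (n k)%:R.
  rewrite mulrC -ler_pdivrMr//; apply: (le_trans (ltW N0E)).
  by rewrite ler_nat leq_addl.
by have := man k; lra.
Unshelve. all: by end_near. Qed.

End limit_constant.

Theorem theorem2p1 (R : realType) (alpha : R) (alpha_gt0 : 0 < alpha)
    (alpha_lt1 : alpha < 1) :
  exists2 C : R, 0 < C &
    forall (n m : nat -> nat)
      (d : nat -> measure_display) (T : forall k : nat, measurableType (d k))
      (P : forall k : nat, probability (T k) R)
      (A : forall k : nat, 'I_(n k).+1 -> T k -> R[i])
      (B : forall k : nat, 'I_(m k).+1 -> T k -> R[i]),
      (forall k : nat, (0 < n k)%N /\ (0 < m k)%N) ->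
      (forall k : nat, (m k)%:R = alpha * (n k)%:R) ->
      n @ \oo --> \oo ->
      (forall k : nat, kac_coefficients (P k) (A k) (B k)) ->
      (fun k : nat =>
         (expected_zeros (P k) (A k) (B k) * ((n k)%:R^-1)%:E)%E) @ \oo
        --> C%:E.
Proof.
have [C C0 HC] := integral_kaplim_pos alpha_gt0 alpha_lt1.
have [c c0 Hc] := expected_zeros_line R.
(* [c] comes from radial integration and is the same for all [alpha]; [C] is the integral of the
   limiting density. *)
exists (c * C); first exact: mulr_gt0.
move=> n m d T P A B pos mE ninf kac.
have a1 : 0 < 1 - alpha by rewrite subr_gt0.
have np k : 0 < (n k)%:R :> R by rewrite ltr0n (pos k).1.
have [k0 Hk0] : exists k0, forall k, (k0 <= k)%N -> (m k + 2 <= n k)%N.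
  pose N0 := (Num.truncn (2 / (1 - alpha))).+1.
  have [k0 _ H] : \forall k \near \oo, (N0 <= n k)%N by move/cvgnyPge: ninf; apply.
  exists k0 => k kk; have {kk} := H k kk; rewrite /= -(ler_nat R) => h.
  rewrite -(ler_nat R) natrD mE.
  have N0E : 2 / (1 - alpha) < N0%:R by apply: real_truncnS_gt; exact: num_real.
  have : 2 <= (n k)%:R * (1 - alpha).
    by rewrite -ler_pdivrMr//; apply: (le_trans (ltW N0E)).
  lra.
under eq_fun do rewrite (Hc _ _ _ _ _ _ _ (pos _).1 (kac _)).
have nuV : (fun k => ((n k)%:R : R)^-1) @ \oo --> (0 : R).
  by apply/gtr0_cvgV0; [near=> k; exact: np|apply/cvgrnyP].
rewrite EFinM -HC; apply: cvgeZl => //.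
(* The domination needs [m + 2 <= n], which holds from [k0] on. *)
rewrite -(cvg_shiftn k0).
have [] := @cvg_integral_line_density R alpha alpha_gt0 alpha_lt1
  (fun k => n (k + k0)%N) (fun k => m (k + k0)%N) => //.
- by move=> k; apply: Hk0; exact: leq_addl.
- by move=> k; rewrite mE.
- by rewrite (cvg_shiftn k0 (fun k => ((n k)%:R : R)^-1)).
- under eq_fun do rewrite mE mulfK ?gt_eqF//.
  exact: cvg_cst.
Unshelve. all: by end_near. Qed.
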